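(* Let the species parameters $(e^{\alpha},m^{\alpha})$ and the data $f_0^{\alpha}\ge 0$ ($C^2$), $F^{\alpha}$, $R_0$, $Q_0$, with $E_{2,0}=B_0=0$, satisfy the Data Assumptions (A1)–(A5) of the context, and let $$E_{1,0}(x)=2\pi\int_{-\infty}^x\rho_0(y)\,dy-2\pi\int_x^{\infty}\rho_0(y)\,dy,\qquad \rho_0(x)=\sum_{\alpha}e^{\alpha}\int_{\mathbb{R}^2}f_0^{\alpha}(x,p)\,dp .$$ For $c\ge 1$ let $(f^{\alpha},E_1,E_2,B)$ be the global $C^1$ solution of the relativistic Vlasov–Maxwell system (RVM) with initial data $f^{\alpha}(0,x,p)=f_0^{\alpha}(x,p)$, $E_1(0,x)=E_{1,0}(x)$, $E_2(0,x)=0$, $B(0,x)=0$, and let $(f^{\alpha,\infty},E_1^{\infty})$ be the global $C^1$ solution of the limit system (VP) with $f^{\alpha,\infty}(0,x,p)=f_0^{\alpha}(x,p)$. Then for every $T>0$ there exists $C_0>0$, depending on $T$ and the initial data but not on $c$, such that for every $c\ge 1$ $$|f^{\alpha}(t,x,p)-f^{\alpha,\infty}(t,x,p)|+|E_1(t,x)-E_1^{\infty}(t,x)|+|E_2(t,x)|+|B(t,x)|\le C_0c^{-1}$$ for every $\alpha$ and every $(t,x,p)\in[0,T]\times\mathbb{R}\times\mathbb{R}^2$.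
   Context: The index $\alpha$ ranges over a finite set of particle species; species $\alpha$ has charge $e^{\alpha}\in\mathbb{R}$ and mass $m^{\alpha}>0$. For speed of light $c>0$ and $p=(p_1,p_2)\in\mathbb{R}^2$ put $$V^{\alpha}(p)=(V^{\alpha}_1(p),V^{\alpha}_2(p))=\frac{p}{\sqrt{(m^{\alpha})^2+c^{-2}|p|^2}},\qquad V^{\alpha,\infty}(p)=\frac{p}{m^{\alpha}} .$$ The system (RVM), the one and one-half dimensional relativistic Vlasov–Maxwell system for unknowns $f^{\alpha}(t,x,p)$, $E_1(t,x)$, $E_2(t,x)$, $B(t,x)$ with $t\ge 0$, $x\in\mathbb{R}$, $p\in\mathbb{R}^2$, is $$\partial_t f^{\alpha}+V_1^{\alpha}(p)\partial_x f^{\alpha}+e^{\alpha}\big(E_1+c^{-1}V_2^{\alpha}(p)B\big)\partial_{p_1}f^{\alpha}+e^{\alpha}\big(E_2-c^{-1}V_1^{\alpha}(p)B\big)\partial_{p_2}f^{\alpha}=0,$$ $$\partial_xE_1=4\pi\rho,\quad \partial_tE_1=-4\pi j_1,\quad \partial_tE_2+c\,\partial_xB=-4\pi j_2,\quad \partial_tB+c\,\partial_xE_2=0,$$ $$\rho(t,x)=\sum_{\alpha}e^{\alpha}\int_{\mathbb{R}^2}f^{\alpha}(t,x,p)\,dp,\qquad j(t,x)=(j_1,j_2)(t,x)=\sum_{\alpha}e^{\alpha}\int_{\mathbb{R}^2}V^{\alpha}(p)f^{\alpha}(t,x,p)\,dp .$$ Under the assumptions below this system has a global $C^1$ solution for each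 $c$. The limit system (VP) for $f^{\alpha,\infty}(t,x,p)$, $E_1^{\infty}(t,x)$ is $$\partial_tf^{\alpha,\infty}+V_1^{\alpha,\infty}(p)\partial_xf^{\alpha,\infty}+e^{\alpha}E_1^{\infty}\partial_{p_1}f^{\alpha,\infty}=0,\qquad \rho^{\infty}(t,x)=\sum_{\alpha}e^{\alpha}\int_{\mathbb{R}^2}f^{\alpha,\infty}(t,x,p)\,dp,$$ $$E_1^{\infty}(t,x)=2\pi\int_{-\infty}^x\rho^{\infty}(t,y)\,dy-2\pi\int_x^{\infty}\rho^{\infty}(t,y)\,dy .$$ It is known from earlier literature that, with initial data $f_0^{\alpha}$ as below, (VP) possesses a global $C^1$ solution; this is the solution referred to. Data Assumptions (the data $f_0^{\alpha}:\mathbb{R}\times\mathbb{R}^2\to[0,\infty)$, $E_{2,0},B_0:\mathbb{R}\to\mathbb{R}$ do not depend on $c$): there are $C^1$ functions $F^{\alpha}:\mathbb{R}^2\to[0,\infty)$ and constants $R_0,Q_0>0$ such that (A1) $|x|\ge R_0$ implies $f_0^{\alpha}(x,p)-F^{\alpha}(p)=E_{2,0}(x)=B_0(x)=0$ for all $\alpha$ and $p$; (A2) $|p|\ge Q_0$ implies $f_0^{\alpha}(x,p)=F^{\alpha}(p)=0$ for all $\alpha$ and $x$; (A3) $\sum_{\alpha}e^{\alpha}\int_{\mathbb{R}^2}F^{\alpha}(p)\,dp=0$; (A4) $\sum_{\alpha}e^{\alpha}\int_{\mathbb{R}^2}F^{\alpha}(p)\frac{p}{m^{\alpha}}\,dp=0$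 (as a vector in $\mathbb{R}^2$); (A5) $\sum_{\alpha}e^{\alpha}\int_{\mathbb{R}}\int_{\mathbb{R}^2}\big(f_0^{\alpha}(x,p)-F^{\alpha}(p)\big)\,dp\,dx=0$. *)

(* Defs.v *)
From HB Require Import structures.
From mathcomp Require Import all_boot all_order all_algebra.
From mathcomp Require Import all_classical all_reals all_analysis.

Set Implicit Arguments.
Unset Strict Implicit.
Unset Printing Implicit Defensive.

Import Order.TTheory GRing.Theory Num.Theory.
Import numFieldNormedType.Exports.

Local Open Scope classical_set_scope.
Local Open Scope ring_scope.

Section smoothness.
Context {R : realType}.

(* All directional derivatives exist and are continuous; on the
   finite-dimensional spaces used below this is the usual notion. *)
Definition C1 (V : normedModType R) (u : V -> R) : Prop :=
  (forall z v, derivable u z v) /\ (forall v, continuous ('D_v u)).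

Definition C2 (V : normedModType R) (u : V -> R) : Prop :=
  C1 u /\ forall v, C1 ('D_v u).

(* Difference quotients of g at t are only taken between nonnegative times, so
   the time derivative is the ordinary one for t > 0 and the right derivative
   for t = 0. Outside t >= 0 the values of g are irrelevant. *)
Definition tquot (g : R -> R) (t : R) : set_system R :=
  (fun h => h^-1 * (g (h + t) - g t)) @ within [set h | 0 <= h + t] 0^'.

Definition tderivable (g : R -> R) (t : R) : Prop := cvg (tquot g t).

Definition dt (g : R -> R) (t : R) : R := lim (tquot g t).

(* C^1 on [0, +oo[ * V, up to the boundary t = 0. *)
Definition C1_time (V : normedModType R) (u : R -> V -> R) : Prop :=
  let D := [set w : R * V | 0 <= w.1] in
  [/\ forall t z, 0 <= t -> tderivable (u ^~ z) t,
      forall t z v, 0 <= t -> derivable (u t) z v,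
      {within D, continuous (fun w : R * V => u w.1 w.2)},
      {within D, continuous (fun w : R * V => dt (u ^~ w.2) w.1)} &
      forall v, {within D, continuous (fun w : R * V => 'D_v (u w.1) w.2)}].

End smoothness.

Section plasma.
Context {R : realType}.


Local Notation mom := (R * R)%type.
Local Notation phase := (R * (R * R))%type.
Local Notation leb := (@lebesgue_measure R).
Local Notation leb2 := (leb \x leb)%E.

(* The norm of R * R in the library is the sup norm. *)
Definition enorm (p : mom) : R := Num.sqrt (p.1 ^+ 2 + p.2 ^+ 2).

Definition V1 (c m : R) (p : mom) : R :=
  p.1 / Num.sqrt (m ^+ 2 + c ^- 2 * enorm p ^+ 2).
Definition V2 (c m : R) (p : mom) : R :=
  p.2 / Num.sqrt (m ^+ 2 + c ^- 2 * enorm p ^+ 2).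

Definition V1oo (m : R) (p : mom) : R := p.1 / m.
Definition V2oo (m : R) (p : mom) : R := p.2 / m.

Definition dx (u : phase -> R) : phase -> R := 'D_((1, (0, 0)) : phase) u.
Definition dp1 (u : phase -> R) : phase -> R := 'D_((0, (1, 0)) : phase) u.
Definition dp2 (u : phase -> R) : phase -> R := 'D_((0, (0, 1)) : phase) u.

Section densities.
Context {A : finType}.
Variables (e m : A -> R).

Definition weighted_density (w : A -> mom -> R) (g : A -> phase -> R)
    (x : R) : R :=
  \sum_(a : A) e a * \int[leb2]_p (w a p * g a (x, p)).

Definition charge_density (g : A -> phase -> R) (x : R) : R :=
  \sum_(a : A) e a * \int[leb2]_p g a (x, p).

Definition current1 (c : R) (g : A -> phase -> R) : R -> R :=
  weighted_density (fun a => V1 c (m a)) g.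
Definition current2 (c : R) (g : A -> phase -> R) : R -> R :=
  weighted_density (fun a => V2 c (m a)) g.

Definition poisson_field (rho : R -> R) (x : R) : R :=
  2 * pi * \int[leb]_(y in `]-oo, x]) rho y
  - 2 * pi * \int[leb]_(y in `[x, +oo[) rho y.

Record data_assumptions (f0 : A -> phase -> R) (E20 B0 : R -> R)
    (F : A -> mom -> R) (R0 Q0 : R) : Prop := DataAssumptions {
  da_f0_ge0 : forall a z, 0 <= f0 a z ;
  da_F_ge0 : forall a (p : mom), 0 <= F a p ;
  da_F_C1 : forall a, C1 (F a) ;
  da_R0_gt0 : 0 < R0 ;
  da_Q0_gt0 : 0 < Q0 ;
  da_space : forall x : R, R0 <= `|x| ->
    [/\ forall a p, f0 a (x, p) - F a p = 0, E20 x = 0 & B0 x = 0] ;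
  da_momentum : forall a (p : mom), Q0 <= enorm p ->
    (forall x, f0 a (x, p) = 0) /\ F a p = 0 ;
  da_neutral : \sum_(a : A) e a * \int[leb2]_p F a p = 0 ;
  da_current1 : \sum_(a : A) e a * \int[leb2]_p (F a p * V1oo (m a) p) = 0 ;
  da_current2 : \sum_(a : A) e a * \int[leb2]_p (F a p * V2oo (m a) p) = 0 ;
  da_total_charge :
    \sum_(a : A) e a * \int[leb]_x \int[leb2]_p (f0 a (x, p) - F a p) = 0 }.

Record RVM_solution (c : R) (f : A -> R -> phase -> R) (E1 E2 B : R -> R -> R)
    : Prop := RVMSolution {
  rvm_f_C1 : forall a, C1_time (f a) ;
  rvm_E1_C1 : C1_time E1 ;
  rvm_E2_C1 : C1_time E2 ;
  rvm_B_C1 : C1_time B ;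
  (* |V| <= c, hence this also makes the integrals in the current meaningful *)
  rvm_integrable : forall a (t x : R), 0 <= t ->
    leb2.-integrable setT (fun p : mom => (f a t (x, p))%:E) ;
  rvm_vlasov : forall a (t x : R) (p : mom), 0 <= t ->
    dt (fun s => f a s (x, p)) t
    + V1 c (m a) p * dx (f a t) (x, p)
    + e a * (E1 t x + c^-1 * V2 c (m a) p * B t x) * dp1 (f a t) (x, p)
    + e a * (E2 t x - c^-1 * V1 c (m a) p * B t x) * dp2 (f a t) (x, p) = 0 ;
  rvm_gauss : forall t x : R, 0 <= t ->
    derive1 (E1 t) x = 4 * pi * charge_density (f ^~ t) x ;
  rvm_ampere1 : forall t x : R, 0 <= t ->
    dt (E1 ^~ x) t = - (4 * pi * current1 c (f ^~ t) x) ;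
  rvm_ampere2 : forall t x : R, 0 <= t ->
    dt (E2 ^~ x) t + c * derive1 (B t) x = - (4 * pi * current2 c (f ^~ t) x) ;
  rvm_faraday : forall t x : R, 0 <= t ->
    dt (B ^~ x) t + c * derive1 (E2 t) x = 0 }.

(* The formula for the field involves the charge density on the whole line, so
   that, unlike for RVM_solution, the Cauchy problem has no finite domain of
   dependence; the classical solution is singled out by its field being bounded
   on every time interval [0, T]. *)
Record VP_solution (f : A -> R -> phase -> R) (E1 : R -> R -> R)
    : Prop := VPSolution {
  vp_f_C1 : forall a, C1_time (f a) ;
  vp_E1_C1 : C1_time E1 ;
  vp_integrable : forall a (t x : R), 0 <= t ->
    leb2.-integrable setT (fun p : mom => (f a t (x, p))%:E) ;
  vp_charge_integrable : forall t : R, 0 <= t ->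
    leb.-integrable setT (fun x => (charge_density (f ^~ t) x)%:E) ;
  vp_E1_bounded : forall T : R, exists M : R,
    forall t x : R, 0 <= t <= T -> `|E1 t x| <= M ;
  vp_vlasov : forall a (t x : R) (p : mom), 0 <= t ->
    dt (fun s => f a s (x, p)) t
    + V1oo (m a) p * dx (f a t) (x, p)
    + e a * E1 t x * dp1 (f a t) (x, p) = 0 ;
  vp_field : forall t x : R, 0 <= t ->
    E1 t x = poisson_field (charge_density (f ^~ t)) x }.

End densities.
End plasma.

(* Main.v *)
(* For c = oo take the fields (E1, 0, 0) and the velocity p / m, so that both
   systems are Vlasov equations with velocities p / sqrt(m^2 + k |p|^2), where
   k = c^-2 or k = 0, whose velocities differ by O(1/c) on bounded momenta. All
   comparisons along characteristics are replaced by a maximum principle on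
   backward domains of dependence.

   For large c, a bootstrap: as long as |E1 - E1oo| + |E2| + |B| <= 1 on a
   backward light cone, momentum supports are bounded independently of c, and f -
   foo is bounded by the time integral of the deviation of the fields plus O(1/c).
   E1 - E1oo is integrated in time from Ampere's law. E2 + B and E2 - B are
   integrated along the light lines x -+ c t; the limit current j2oo vanishes
   outside a bounded interval in x, which a light line crosses in time O(1/c), so
   it only contributes O(1/c). Gronwall's lemma then bounds the deviation by C / c,
   which is below 1 if c is large, and the bootstrap closes.

   For bounded c it suffices to bound the fields. Along a light line j2 is
   dominated by the flux of particles through that line, with a constant linear in
   the size of the momentum support, hence in the integral of the fields; the
   total flux is at most the initial mass in the light cone.

   The limit solution is the same for all c, being unique: a neutral
   current-free background with a localized neutral perturbation keeps
   E1oo = 0 and foo = F outside a region growing at finite speed. *)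
Require Import Defs.
From HB Require Import structures.
From mathcomp Require Import all_boot all_order all_algebra.
From mathcomp Require Import all_classical all_reals all_analysis.
From mathcomp Require Import measurable_realfun ring lra.
Import Order.TTheory GRing.Theory Num.Theory.
Import numFieldNormedType.Exports.
Local Open Scope classical_set_scope.
Local Open Scope ring_scope.

Set Implicit Arguments.
Unset Strict Implicit.
Unset Printing Implicit Defensive.

(** Solutions are only [C1_time], and the relativistic fields carry no bound in [x], so no
    characteristic flow is built. The maximum principle asks only for a derivative along one
    straight line at each point of a compact set, and compactness of backward cones replaces the
    missing bound.

    All Gronwall arguments use the weight [expR (l * t)]. A time integration gains a factor [1 / l],
    and a force below this weight opens the momentum domain by at most [K / l * expR (l * t)]; a
    large [l] brings the coefficient of the unknown below [1 / 2]. This is the origin of the rates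
    [l := ... + 1].

    Derivatives of the relativistic [f] are not controlled uniformly in [c]: two densities are
    compared by differentiating the limit solution, or the background [F], along the characteristics
    of the other one.

    The limit field is an integral over the line. Its law in time is first found for differences
    between two points, then normalised at a far point where field and current vanish. The gain
    [1 / c] on light lines comes from [atan], the bounded primitive of [1 / (1 + y ^ 2)], a multiple
    of which dominates the limit current. *)

Section calculus.
Context {R : realType}.
Implicit Types (V : normedModType R).

(** * Derivatives as remainder estimates; [C^1] functions up to time zero *)

Lemma cvgr0P (g : R -> R) (d : R) (t : R) :
  ((fun h => h^-1 * (g (h + t) - g t)) @ 0^' --> d) <->
  (forall e : R, 0 < e -> exists2 r : R, 0 < r & forall h : R, `|h| < r ->
     `|g (t + h) - g t - h * d| <= e * `|h|).
Proof.
split.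
  move/cvgrPdist_le => H e e0; have /nbhs_ballP[r /= r0 rP] := H _ e0.
  exists r => // h hr; have [->|h0] := eqVneq h 0.
    by rewrite addr0 mul0r !subrr normr0 mulr0.
  have /= := rP h; rewrite -ball_normE /= sub0r normrN => /(_ hr h0) Hh.
  have -> : g (t + h) - g t - h * d = - (h * (d - h^-1 * (g (h + t) - g t))).
    by rewrite mulrBr mulrA divff// mul1r opprB (addrC h t).
  by rewrite normrN normrM mulrC ler_wpM2r.
move=> H; apply/cvgrPdist_le => e e0.
have [r r0 rP] := H _ e0; apply/nbhs_ballP; exists r => //= h.
rewrite -ball_normE /= sub0r normrN => hr h0; have := rP _ hr.
have -> : g (t + h) - g t - h * d = - (h * (d - h^-1 * (g (h + t) - g t))).
  by rewrite mulrBr mulrA divff// mul1r opprB (addrC h t).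
rewrite normrN normrM mulrC ler_pM2r ?normr_gt0//.
Qed.

(** Multiplying the difference quotient by [h] removes the punctured filter, and the estimate then
    holds at [h = 0] too. Derivatives are mostly handled in this form below. *)
Lemma is_deriveP V (G : V -> R) (z v : V) (d : R) :
  is_derive z v G d <->
  (forall e : R, 0 < e -> exists2 r : R, 0 < r & forall h : R, `|h| < r ->
     `|G (z + h *: v) - G z - h * d| <= e * `|h|).
Proof.
pose g h := G (z + h *: v).
have E : (fun h : R => h^-1 *: ((G \o shift z) (h *: v) - G z)) =
    (fun h => h^-1 * (g (h + 0) - g 0)).
  by apply/funext => h /=; rewrite /g addr0 scale0r addr0 (addrC z).
split=> [D|H].
  have : (fun h : R => h^-1 *: ((G \o shift z) (h *: v) - G z)) @ 0^' --> d.
    by rewrite -(@derive_val _ _ _ _ _ _ _ D); apply: (@ex_derive _ _ _ _ _ _ _ D).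
  rewrite E => /(cvgr0P g d 0) H e e0.
  have [r r0 rP] := H e e0; exists r => // h /rP.
  by rewrite /g add0r scale0r addr0.
have D : (fun h : R => h^-1 *: ((G \o shift z) (h *: v) - G z)) @ 0^' --> d.
  rewrite E; apply/(cvgr0P g d 0) => e e0.
  have [r r0 rP] := H e e0; exists r => // h /rP.
  by rewrite /g add0r scale0r addr0.
by split; [apply/cvg_ex; exists d; exact: D|exact: (cvg_lim _ D)].
Qed.

(** A directional derivative sees only the restriction to one line, so it can be carried to another
    space as soon as the two restrictions agree. *)
Lemma is_derive_transfer V (W : normedModType R) (G : V -> R) (g : W -> R) (z v : V) (y u : W) (d : R) :
  (forall h : R, G (z + h *: v) = g (y + h *: u)) -> is_derive z v G d -> is_derive y u g d.
Proof.
move=> Gg /is_deriveP H; have := Gg 0; rewrite !scale0r !addr0 => Gg0.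
by apply/is_deriveP => e e0; have [r r0 rP] := H e e0; exists r => // h /rP; rewrite Gg Gg0.
Qed.

Lemma is_derive_continuous (g : R -> R) (x d : R) :
  is_derive x 1 g d -> {for x, continuous g}.
Proof.
move=> D; apply: differentiable_continuous; apply/derivable1_diffP.
exact: (@ex_derive _ _ _ _ _ _ _ D).
Qed.

Lemma unit_sign (sg : R) : sg * sg = 1 -> `|sg| = 1.
Proof.
move=> sg2; have : `|sg| ^+ 2 = 1 by rewrite -normrX expr2 sg2 normr1.
by move/eqP; rewrite -[X in _ == X](expr1n _ 2) eqrXn2// => /eqP.
Qed.

Lemma expRM_ge1 (l s : R) : 0 <= l -> 0 <= s -> 1 <= expR (l * s).
Proof. by move=> l0 s0; rewrite -expR0 ler_expR mulr_ge0. Qed.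

(** Near an interior time the constraint [0 <= h + t] holds automatically, so the filter of [tquot]
    is the full punctured neighbourhood. *)
Lemma dt_is_derive (g : R -> R) (t : R) : 0 < t -> tderivable g t ->
  is_derive t 1 g (dt g t).
Proof.
move=> t0 Dg; apply/is_deriveP.
have sc (h : R) : h *: (1 : R) = h by exact: mulr1.
suff: (fun h => h^-1 * (g (h + t) - g t)) @ 0^' --> dt g t.
  move/cvgr0P => H e e0; have [r r0 rP] := H e e0; exists r => // h /rP.
  by rewrite sc.
have := Dg; rewrite /tderivable /dt /tquot.
suff -> : within [set h | 0 <= h + t] 0^' = (0 : R)^' by [].
rewrite eqEsubset; split=> A; rewrite /within /=; last first.
  by move=> H; near=> h => _; near: h.
move=> H; near=> h.
have : 0 <= h + t.
  near: h; apply/nbhs_ballP; exists t => //= y.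
  rewrite -ball_normE /= sub0r normrN => yt _.
  by rewrite -lerBlDr sub0r; have := lerNnormlW (ltW yt).
by near: h.
Unshelve. all: by end_near. Qed.

Lemma contP V (G : V -> R) (z : V) :
  {for z, continuous G} <->
  (forall e : R, 0 < e -> exists2 r : R, 0 < r & forall z', `|z' - z| < r ->
     `|G z' - G z| < e).
Proof.
split.
  move/cvgrPdist_lt => H e e0; have /nbhs_ballP[r /= r0 rP] := H _ e0.
  exists r => // z' zr; rewrite distrC; apply: rP.
  by rewrite -ball_normE /= distrC.
move=> H; apply/cvgrPdist_lt => e e0.
have [r r0 rP] := H _ e0; apply/nbhs_ballP; exists r => //= z'.
by rewrite -ball_normE /= distrC => /rP; rewrite distrC.
Qed.

Lemma is_deriveZdir V (G : V -> R) (z v : V) (d a : R) :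
  is_derive z v G d -> is_derive z (a *: v) G (a * d).
Proof.
move=> /is_deriveP H; apply/is_deriveP => e e0.
have a1 : 0 < `|a| + 1 by apply: ltr_wpDl.
have [r r0 rP] := H _ (divr_gt0 e0 a1); exists (r / (`|a| + 1)).
  exact: divr_gt0.
move=> h; rewrite ltr_pdivlMr// => hr.
rewrite scalerA mulrA; apply: (le_trans (rP _ _)).
  by rewrite normrM; apply: le_lt_trans hr; rewrite ler_wpM2l ?lerDl.
rewrite mulrAC ler_pdivrMr// normrM -mulrA.
apply: ler_wpM2l; first exact: ltW.
by apply: ler_wpM2l => //; rewrite lerDl.
Qed.

Lemma is_derive_line V (G : V -> R) (z v : V) (s d : R) :
  is_derive (z + s *: v) v G d -> is_derive s 1 (fun s => G (z + s *: v)) d.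
Proof.
move=> D; apply: (is_derive_transfer _ D) => h.
by rewrite scalerDl addrA (_ : h *: (1 : R) = h)//; exact: mulr1.
Qed.

(** Only partial derivatives are given, not total differentiability. The step [h *: (v + v2)] is
    split: the leg along [v2] uses the derivative at [w] alone, the leg along [v] the mean value
    theorem, for which existence of [dG] near [w] and its continuity at [w] suffice. *)
Lemma is_deriveD_dir V (G dG : V -> R) (w v v2 : V) (d2 r0 : R) : 0 < r0 ->
  (forall w', `|w' - w| < r0 -> is_derive w' v G (dG w')) ->
  {for w, continuous dG} -> is_derive w v2 G d2 ->
  is_derive w (v + v2) G (dG w + d2).
Proof.
move=> r00 Hv /contP cdG /is_deriveP H2; apply/is_deriveP => e e0.
have e20 : 0 < e / 2 by lra.
have [r1 r10 r1P] := cdG _ e20; have [r2 r20 r2P] := H2 _ e20.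
pose k := `|v| + `|v2| + 1.
have k0 : 0 < k by rewrite /k; have := normr_ge0 v; have := normr_ge0 v2; lra.
pose r3 := Num.min r0 r1.
have r30 : 0 < r3 by rewrite lt_min r00.
exists (Num.min r2 (r3 / k)); first by rewrite lt_min r20/= divr_gt0.
move=> h; rewrite lt_min ltr_pdivlMr// => /andP[hr2 hr3].
pose w1 := w + h *: v2.
pose phi (s : R) := G (w1 + s *: (h *: v)).
have close (s : R) : 0 <= s <= 1 -> `|w1 + s *: (h *: v) - w| < r3.
  move=> /andP[s0 s1]; apply: le_lt_trans hr3.
  rewrite /w1 addrAC (addrC w) addrK (le_trans (ler_normD _ _))// !normrZ.
  rewrite (ger0_norm s0) /k !mulrDr mulr1.
  have : s * (`|h| * `|v|) <= `|h| * `|v| by rewrite ler_piMl// mulr_ge0.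
  by have := normr_ge0 h; lra.
have dphi (s : R) : 0 <= s <= 1 ->
    is_derive s 1 phi (h * dG (w1 + s *: (h *: v))).
  move=> s01; apply: is_derive_line; apply: is_deriveZdir; apply: Hv.
  by have := close _ s01; rewrite lt_min => /andP[].
have [c c01 Ec] : exists2 c : R, c \in `]0, 1[%R &
    phi 1 - phi 0 = h * dG (w1 + c *: (h *: v)) * (1 - 0).
  apply: (@MVT _ phi (fun c => h * dG (w1 + c *: (h *: v))) (0 : R) 1 ltr01).
    by move=> s; rewrite in_itv/= => /andP[s0 s1]; apply: dphi; rewrite !ltW.
  apply: derivable_within_continuous => s; rewrite in_itv/= => s01.
  exact: (@ex_derive _ _ _ _ _ _ _ (dphi s s01)).
have Ephi1 : phi 1 = G (w + h *: (v + v2)).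
  by rewrite /phi scale1r /w1 scalerDr (addrC (h *: v)) addrA.
have Ephi0 : phi 0 = G (w + h *: v2) by rewrite /phi scale0r addr0.
have -> : G (w + h *: (v + v2)) - G w - h * (dG w + d2) =
    (phi 1 - phi 0 - h * dG w) + (G (w + h *: v2) - G w - h * d2).
  by rewrite Ephi1 Ephi0; ring.
apply: (le_trans (ler_normD _ _)); rewrite (splitr e) mulrDl; apply: lerD.
  rewrite Ec subr0 mulr1 -mulrBr normrM mulrC ler_wpM2r//; apply/ltW/r1P.
  have /close : 0 <= c <= 1.
    by move: c01; rewrite in_itv/= => /andP[? ?]; rewrite !ltW.
  by rewrite lt_min => /andP[].
exact: r2P.
Qed.

Lemma withinP V (D : set V) (f : V -> R) : {within D, continuous f} ->
  forall w, D w -> forall e : R, 0 < e -> exists2 r : R, 0 < r &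
    forall w', D w' -> `|w' - w| < r -> `|f w' - f w| < e.
Proof.
move=> /subspace_continuousP H w Dw e e0.
have /cvgrPdist_lt/(_ _ e0) := H w Dw.
rewrite near_withinE => /nbhs_ballP[r /= r0 rP].
exists r => // w' Dw' ww'; rewrite distrC; apply: rP => //.
by rewrite -ball_normE /= distrC.
Qed.

Lemma prod_norm_lt V (U : normedModType R) (w : V * U) (r : R) :
  (`|w| < r) = (`|w.1| < r) && (`|w.2| < r).
Proof. by rewrite prod_normE gt_max. Qed.

(* Freezing [u] before time 0 turns a function that is only meaningful for
   [t >= 0] into one that is continuous on the whole line. *)
Definition ext V (u : R -> V -> R) t z := u (Num.max 0 t) z.

Lemma extE V (u : R -> V -> R) t : 0 <= t -> ext u t = u t.
Proof. by move=> t0; apply/funext => z; rewrite /ext max_r. Qed.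

Lemma max0_dist (s t : R) : `|Num.max 0 s - Num.max 0 t| <= `|s - t|.
Proof.
have [s0|s0] := leP s 0; have [t0|t0] := leP t 0;
  rewrite ?(max_l s0) ?(max_l t0) ?(max_r (ltW s0)) ?(max_r (ltW t0)) //.
- by rewrite subrr normr0.
- by rewrite sub0r normrN gtr0_norm// distrC ger0_norm; lra.
- by rewrite subr0 gtr0_norm// ger0_norm; lra.
Qed.

Lemma ext_cont V (g : R -> V -> R) :
  {within [set w : R * V | 0 <= w.1], continuous (fun w : R * V => g w.1 w.2)} ->
  continuous (fun w : R * V => ext g w.1 w.2).
Proof.
move=> /withinP H w; apply/contP => e e0.
have [|r r0 rP] := H (Num.max 0 w.1, w.2) _ _ e0; first by rewrite /= le_max lexx.
exists r => // w' ww'; apply: (rP (Num.max 0 w'.1, w'.2)).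
  by rewrite /= le_max lexx.
move: ww'; rewrite !prod_norm_lt /= => /andP[w1 ->]; rewrite andbT.
exact: le_lt_trans (max0_dist _ _) w1.
Qed.

Lemma ext_continuous V (u : R -> V -> R) : C1_time u ->
  continuous (fun w : R * V => ext u w.1 w.2).
Proof. by case=> _ _ cu _ _; exact: ext_cont. Qed.

Lemma ext_dt V (u : R -> V -> R) (t : R) (z : V) : C1_time u -> 0 < t ->
  is_derive t 1 (fun s => ext u s z) (dt (u ^~ z) t).
Proof.
move=> [Dt _ _ _ _] t0.
have /is_deriveP H := dt_is_derive t0 (Dt t z (ltW t0)).
apply/is_deriveP => e e0; have [r r0 rP] := H e e0.
exists (Num.min r t); first by rewrite lt_min r0.
move=> h; rewrite lt_min => /andP[/rP + ht]; rewrite !extE//; first exact: ltW.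
by move/ltr_normlP : ht => [+ _]; rewrite /GRing.scale/= mulr1; lra.
Qed.

(** An instance of [is_deriveD_dir] with time as the leg whose derivative is continuous; for [t > 0]
    the freezing done by [ext] is not felt nearby. *)
Lemma ext_chain V (u : R -> V -> R) (t : R) (z v : V) : C1_time u -> 0 < t ->
  is_derive (0 : R) 1 (fun s => ext u (t + s) (z + s *: v))
    (dt (u ^~ z) t + 'D_v (u t) z).
Proof.
move=> [Dt Dv cu cdt cDv] t0.
pose G (w : R * V) := ext u w.1 w.2.
have near_t (s : R) : `|s - t| < t -> 0 < s.
  by move/ltr_normlP => [+ _]; lra.
have H1 (w' : R * V) : `|w' - (t, z)| < t ->
    is_derive w' (1, 0) G (dt (u ^~ w'.2) w'.1).
  rewrite prod_norm_lt /= => /andP[/near_t w0 _].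
  have /is_deriveP H := dt_is_derive w0 (Dt _ w'.2 (ltW w0)).
  apply/is_deriveP => e e0; have [r r0 rP] := H e e0.
  exists (Num.min r w'.1); first by rewrite lt_min r0.
  move=> h; rewrite lt_min => /andP[/rP + hw].
  rewrite /G/= scaler0 addr0 !extE//; first exact: ltW.
  by move/ltr_normlP : hw => [+ _]; rewrite /GRing.scale/= mulr1; lra.
have H2 : is_derive (t, z) (0, v) G ('D_v (u t) z).
  have /is_deriveP H := @derivableP _ _ _ _ _ _ (Dv t z v (ltW t0)).
  apply/is_deriveP => e e0; have [r r0 rP] := H e e0; exists r => // h /rP.
  by rewrite /G/= scaler0 addr0 extE// ltW.
have cdt' : {for (t, z), continuous (fun w : R * V => dt (u ^~ w.2) w.1)}.
  apply/contP => e e0; have [|r r0 rP] := withinP cdt (w := (t, z)) _ e0.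
    exact: ltW.
  exists (Num.min r t); first by rewrite lt_min r0.
  move=> w'; rewrite lt_min => /andP[wr wt]; apply: rP => //=.
  by move: wt; rewrite prod_norm_lt /= => /andP[/near_t/ltW].
have := is_deriveD_dir t0 H1 cdt' H2.
move=> /is_deriveP H; apply/is_deriveP => e e0.
have [r r0 rP] := H e e0; exists r => // h /rP.
have -> : (t, z) + h *: (((1, 0) : R * V) + (0, v)) = (t + h, z + h *: v).
  by congr (_, _); rewrite /= ?add0r ?addr0 // /GRing.scale/= mulr1.
by rewrite /G /= !add0r scale0r !addr0 /GRing.scale/= mulr1.
Qed.

Lemma derive_sum_dir V (g : V -> R) (z v w : V) :
  (forall z', derivable g z' v) -> {for z, continuous ('D_v g)} ->
  derivable g z w -> 'D_(v + w) g z = 'D_v g z + 'D_w g z.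
Proof.
move=> Dv cv /derivableP Dw.
have H := @is_deriveD_dir V g ('D_v g) z v w _ 1 ltr01 (fun w' _ => derivableP (Dv w')) cv Dw.
exact: (@derive_val _ _ _ _ _ _ _ H).
Qed.

Lemma ext_dir_cont V (u : R -> V -> R) (v : V) : C1_time u ->
  continuous (fun w : R * V => 'D_v (ext u w.1) w.2).
Proof.
by case=> _ _ _ _ /(_ v) H; apply: (ext_cont (g := fun t => 'D_v (u t)) H).
Qed.

Lemma cont_slice V (g : R -> V -> R) (t : R) :
  continuous (fun w : R * V => g w.1 w.2) -> continuous (g t).
Proof.
move=> cg z; apply/contP => e e0.
have /contP/(_ _ e0)[r r0 rP] := cg (t, z).
exists r => // z' zr; apply: (rP (t, z')).
by rewrite prod_norm_lt/= subrr normr0 r0 zr.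
Qed.

Lemma cont_slicel V (g : R -> V -> R) (z : V) :
  continuous (fun w : R * V => g w.1 w.2) -> continuous (g ^~ z).
Proof.
move=> cg t; apply/contP => e e0.
have /contP/(_ _ e0)[r r0 rP] := cg (t, z).
exists r => // t' tr; apply: (rP (t', z)).
by rewrite prod_norm_lt/= subrr normr0 r0 tr.
Qed.

Lemma ext_chain_field (u : R -> R -> R) (t z a : R) : C1_time u -> 0 < t ->
  is_derive t 1 (fun s => ext u s (z + (s - t) * a))
    (dt (u ^~ z) t + a * derive1 (u t) z).
Proof.
move=> Cu t0; have /is_deriveP H := ext_chain z a Cu t0.
have <- : 'D_a (u t) z = a * derive1 (u t) z.
  have [_ Dv _ _ _] := Cu.
  have /derivableP/(is_deriveZdir a) Da := Dv t z 1 (ltW t0).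
  rewrite derive1E -(@derive_val _ _ _ _ _ _ _ Da).
  by congr (derive _ _ _); rewrite /GRing.scale/= mulr1.
apply/is_deriveP => e e0; have [r r0 rP] := H e e0; exists r => // h /rP.
rewrite /GRing.scale/= !mulr1 !add0r mul0r !addr0 subrr mul0r addr0.
by rewrite [t + h - t]addrAC subrr add0r.
Qed.

(** With [(a, (b, d))] the phase velocity at [z], the derivative is the left-hand side of a Vlasov
    equation. The line is straight, velocity and force being frozen at [z], since only the
    derivative at [s = 0] is ever used. *)
Lemma ext_chain_phase (u : R -> R * (R * R) -> R) (t : R) (z : R * (R * R))
    (a b d : R) : C1_time u -> 0 < t ->
  is_derive (0 : R) 1
    (fun s => ext u (t + s) (z.1 + s * a, (z.2.1 + s * b, z.2.2 + s * d)))
    (dt (u ^~ z) t + a * dx (u t) z + b * dp1 (u t) z + d * dp2 (u t) z).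
Proof.
move=> Cu t0; have [_ Dv _ _ _] := Cu.
have := ext_chain z (a, (b, d)) Cu t0.
suff -> : 'D_((a, (b, d)) : R * (R * R)) (u t) z =
    a * dx (u t) z + b * dp1 (u t) z + d * dp2 (u t) z.
  by rewrite !addrA; case: z => z1 [z2 z3].
have cD v : continuous ('D_v (u t)).
  have := @cont_slice _ (fun t => 'D_v (ext u t)) t (@ext_dir_cont _ u v Cu).
  by rewrite extE// ltW.
have DZ (k : R) v : 'D_(k *: v) (u t) z = k * 'D_v (u t) z.
  have /derivableP/(is_deriveZdir k) Da := Dv t z v (ltW t0).
  exact: (@derive_val _ _ _ _ _ _ _ Da).
have -> : ((a, (b, d)) : R * (R * R)) =
    a *: (1, (0, 0)) + (b *: (0, (1, 0)) + d *: (0, (0, 1))).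
  by congr (_, (_, _)); rewrite /= /GRing.scale/= !(mulr0, mulr1, addr0, add0r).
rewrite !derive_sum_dir ?DZ ?addrA //; try exact: cD.
all: by move=> *; exact: (Dv t _ _ (ltW t0)).
Qed.

Lemma le_of_deriv_le0 (g : R -> R) (a b : R) : a <= b ->
  (forall s : R, a <= s <= b -> {for s, continuous g}) ->
  (forall s : R, a < s < b -> exists2 d : R, d <= 0 & is_derive s 1 g d) ->
  g b <= g a.
Proof.
move=> ab cg Dg.
have H s : s \in `]a, b[%R -> derivable g s 1 /\ derive1 g s <= 0.
  rewrite in_itv/= => /Dg[d d0 D]; rewrite derive1E (@derive_val _ _ _ _ _ _ _ D).
  by split=> //; apply: (@ex_derive _ _ _ _ _ _ _ D).
move: (ab); rewrite le_eqVlt => /predU1P[->//|ab'].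
have [||c + E] := @MVT _ g (derive1 g) a b ab'.
- by move=> s /H[+ _]; rewrite derive1E => /derivableP.
- by apply: continuous_in_subspaceT => s; rewrite inE/= in_itv/=; exact: cg.
move/H => [_ H0]; rewrite -subr_le0 E mulr_le0_ge0// subr_ge0//.
Qed.

End calculus.

(** * Maximum principle on compact space-time sets and backward domains *)

Section maximum_principle.
Context {R : realType}.

(** Subtracting [a * w.1] makes the derivative along the given line strictly negative. At a maximum
    with positive time, a short backward step stays in [Om] and would increase the perturbed
    function; hence the maximum sits at time 0, and [a] can be taken arbitrarily small. *)
Lemma max_principle (V : normedModType R) (Om : set (R * V)) (u : R * V -> R)
    (k : R) : compact Om -> continuous u ->
  (forall w, Om w -> 0 <= w.1) ->
  (forall w, Om w -> w.1 = 0 -> u w <= k) ->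
  (forall w, Om w -> 0 < w.1 -> exists v : V,
    (exists2 d : R, d <= 0 &
       is_derive (0 : R) 1 (fun s => u (w.1 + s, w.2 + s *: v)) d) /\
    (exists2 r : R, 0 < r & forall s : R, 0 < s < r ->
       Om (w.1 - s, w.2 - s *: v))) ->
  forall w, Om w -> u w <= k.
Proof.
move=> cOm cu Om0 uk step w Omw; apply/ler_addgt0Pr => e e0.
have w0 : 0 < w.1 + 1 by have := Om0 w Omw; lra.
(* The slope is small enough that the perturbation costs at most [e] at [w]. *)
pose a := e / (w.1 + 1).
have a0 : 0 < a by exact: divr_gt0.
pose U z := u z - a * z.1.
have cU : continuous U.
  move=> z; apply: cvgB; first exact: cu.
  by apply: cvgM; [exact: cvg_cst|exact: cvg_fst].
have [m + mmax] := compact_EVT_max (ex_intro _ w Omw) cOm (continuous_subspaceT cU).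
rewrite inE => Omm.
suff Um : U m <= k.
  have : U w <= k by apply: le_trans Um; apply: mmax; rewrite inE.
  rewrite /U lerBlDr => /le_trans; apply; rewrite lerD2l /a.
  by rewrite mulrAC ler_pdivrMr// ler_wpM2l ?(ltW e0)//; lra.
have := Om0 _ Omm; rewrite le_eqVlt => /predU1P[m0|m0].
  by rewrite /U -m0 mulr0 subr0; exact: uk.
(* Accuracy [a / 2]: the remainder consumes half of the gain [a * s] of a backward step of length
   [s], and what is left contradicts maximality. *)
have [v [[d d0 /is_deriveP/(_ _ (divr_gt0 a0 (ltr0Sn R 1)))]]] := step _ Omm m0.
move=> [r1 r10 r1P] [r2 r20 r2P]; exfalso.
pose s := Num.min r1 r2 / 2.
have s0 : 0 < s by rewrite divr_gt0// lt_min r10.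
have [sr1 sr2] : s < r1 /\ s < r2.
  have : s < Num.min r1 r2 by rewrite /s ltr_pdivrMr//; rewrite /s in s0; lra.
  by rewrite lt_min => /andP[].
have := mmax (m.1 - s, m.2 - s *: v); rewrite inE => /(_ (r2P s _)).
rewrite s0 sr2 => /(_ isT); rewrite /U /=.
have /r1P : `|- s| < r1 by rewrite normrN gtr0_norm.
have -> : - s *: (1 : R) = - s by exact: mulr1.
rewrite !add0r addr0 scale0r addr0 scaleNr normrN (gtr0_norm s0) -surjective_pairing.
move/ler_normlP => [H1 _].
have : 0 < a * s by rewrite mulr_gt0.
have : d * s <= 0 by rewrite mulr_le0_ge0// ltW.
move: H1; lra.
Qed.

Lemma is_derive_expRM (l s : R) :
  is_derive s 1 (fun s : R => expR (l * s)) (l * expR (l * s)).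
Proof.
have -> : (fun s : R => expR (l * s)) = expR \o (fun s => l * s) by [].
have D : is_derive s 1 (fun s : R => l * s) l.
  by apply: is_derive_eq; rewrite /GRing.scale/= mulr1.
have <- : expR (l * s) * l = l * expR (l * s) by exact: mulrC.
exact: is_derive1_comp.
Qed.

Lemma cont_expRM (l : R) : continuous (fun s : R => expR (l * s)).
Proof.
by move=> s; exact: is_derive_continuous (is_derive_expRM l s).
Qed.

(** The integral of [K * expR (l * r)] for [r] from [s] to [t]: the largest momentum shift between
    the two times under a force below that bound. *)
Definition prad (l K t s : R) := K / l * (expR (l * t) - expR (l * s)).

(* A backward domain of dependence: it shrinks in space at speed [w] and in
   momentum at speed [K exp(l s)]. *)
Definition domain (l K w t : R) (z : R * (R * R)) : set (R * (R * (R * R))) :=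
  [set y | [/\ 0 <= y.1 <= t, `|y.2.1 - z.1| <= w * (t - y.1),
     `|y.2.2.1 - z.2.1| <= prad l K t y.1 & `|y.2.2.2 - z.2.2| <= prad l K t y.1]].

Lemma prad_le (l K t s : R) : 0 < l -> 0 <= K -> prad l K t s <= K / l * expR (l * t).
Proof.
move=> l0 K0; rewrite /prad ler_wpM2l//; first by rewrite divr_ge0// ltW.
by rewrite lerBlDr lerDl expR_ge0.
Qed.

Lemma closed_le_cont (T : topologicalType) (f g : T -> R) :
  continuous f -> continuous g -> closed [set y | f y <= g y].
Proof.
move=> cf cg; have -> : [set y | f y <= g y] = (fun y => f y - g y) @^-1` [set x | x <= 0].
  by apply/seteqP; split=> y /=; rewrite subr_le0.
apply: preimage_closed; last exact: closed_le.
by move=> x _; apply: cvgB; [exact: cf|exact: cg].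
Qed.

Lemma compact_domain (l K w t : R) (z : R * (R * R)) :
  0 < l -> 0 <= K -> 0 <= w -> compact (domain l K w t z).
Proof.
move=> l0 K0 w0.
pose P := K / l * expR (l * t).
apply: (@subclosed_compact _ _ (`[0, t] `*` (`[z.1 - w * t, z.1 + w * t] `*`
   (`[z.2.1 - P, z.2.1 + P] `*` `[z.2.2 - P, z.2.2 + P])))).
- have -> : domain l K w t z = [set y | 0 <= y.1] `&` [set y | y.1 <= t] `&`
    [set y | `|y.2.1 - z.1| <= w * (t - y.1)] `&`
    [set y | `|y.2.2.1 - z.2.1| <= prad l K t y.1] `&`
    [set y | `|y.2.2.2 - z.2.2| <= prad l K t y.1].
    apply/seteqP; split=> y /=.
      by move=> [/andP[]].
    by move=> [[[[h1 h2]]]] ? ? ?; split=> //; rewrite h1 h2.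
  have c1 : continuous (fun y : R * (R * (R * R)) => y.1) by move=> y; exact: cvg_fst.
  have c2 : continuous (fun y : R * (R * (R * R)) => y.2) by move=> y; exact: cvg_snd.
  have c21 : continuous (fun y : R * (R * (R * R)) => y.2.1).
    by move=> y; apply: continuous_comp (c2 y) _; exact: cvg_fst.
  have c22 : continuous (fun y : R * (R * (R * R)) => y.2.2).
    by move=> y; apply: continuous_comp (c2 y) _; exact: cvg_snd.
  have c221 : continuous (fun y : R * (R * (R * R)) => y.2.2.1).
    by move=> y; apply: continuous_comp (c22 y) _; exact: cvg_fst.
  have c222 : continuous (fun y : R * (R * (R * R)) => y.2.2.2).
    by move=> y; apply: continuous_comp (c22 y) _; exact: cvg_snd.
  have cp : continuous (fun y : R * (R * (R * R)) => prad l K t y.1).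
    move=> y; apply: cvgM; first exact: cvg_cst.
    apply: cvgB; first exact: cvg_cst.
    by apply: (@continuous_comp _ _ _ (fun y : R * (R * (R * R)) => y.1) (fun s => expR (l * s)) y (c1 y)); exact: cont_expRM.
  have cn (f : R * (R * (R * R)) -> R) (x : R) : continuous f -> continuous (fun y => `|f y - x|).
    move=> cf y; apply: cvg_norm; apply: cvgB; [exact: cf|exact: cvg_cst].
  do 4?[apply: closedI]; apply: closed_le_cont => //; try exact: cn; try (by move=> y; exact: cvg_cst).
  move=> y; apply: cvgM; first exact: cvg_cst.
  by apply: cvgB; [exact: cvg_cst|exact: cvg_fst].
- by do 3?[apply: compact_setX]; exact: segment_compact.
- move=> [s [y [q1 q2]]] [/= /andP[s0 st] yw q1w q2w].
  have wts : w * (t - s) <= w * t by rewrite ler_wpM2l//; lra.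
  have pP := prad_le t s l0 K0; rewrite -/P in pP.
  have := le_trans yw wts; have := le_trans q1w pP; have := le_trans q2w pP.
  move=> /ler_normlP[? ?] /ler_normlP[? ?] /ler_normlP[? ?].
  by rewrite !in_itv/= s0 st; do !split=> //; apply/andP; split; lra.
Qed.

(** A backward step remains in the domain because the domain opens backwards at the admissible
    speeds. The spatial radius is linear in time, so [<=] suffices there; the momentum radius is
    not, and the strict inequalities absorb its first-order remainder. *)
Lemma transport_le (u : R * (R * (R * R)) -> R) (l K w t k : R) (z : R * (R * R)) :
  0 < l -> 0 < K -> 0 <= w -> 0 <= t -> continuous u ->
  (forall y, domain l K w t z y -> y.1 = 0 -> u y <= k) ->
  (forall y, domain l K w t z y -> 0 < y.1 -> exists v : R * (R * R),
    [/\ exists2 d : R, d <= 0 &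
       is_derive (0 : R) 1 (fun s => u (y.1 + s, (y.2.1 + s * v.1,
         (y.2.2.1 + s * v.2.1, y.2.2.2 + s * v.2.2)))) d,
     `|v.1| <= w, `|v.2.1| < K * expR (l * y.1) &
     `|v.2.2| < K * expR (l * y.1)]) ->
  u (t, z) <= k.
Proof.
move=> l0 K0 w0 t0 cu init step.
apply: (@max_principle _ (domain l K w t z) u k) => //.
- by apply: compact_domain => //; exact: ltW.
- by move=> y [/andP[]].
- move=> y Oy y0; have [v [[d d0 D] v1 v2 v3]] := step y Oy y0.
  exists v; split; first by exists d => //; case: y v D {v1 v2 v3 Oy y0} => [a [b [c f]]] [? [? ?]].
  have Dp : is_derive y.1 1 (prad l K t) (- (K * expR (l * y.1))).
    have D1 := is_derive_expRM l y.1.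
    have -> : prad l K t = (K / l) \*: (cst (expR (l * t)) - (fun s : R => expR (l * s))) by [].
    apply: is_derive_eq; rewrite sub0r /GRing.scale/= mulrN mulrA divfK//.
    exact: lt0r_neq0.
  have H (b : R) : `|b| < K * expR (l * y.1) -> exists2 r : R, 0 < r &
     forall s, 0 < s < r -> prad l K t y.1 + s * `|b| <= prad l K t (y.1 - s).
    rewrite -subr_gt0 => /(proj1 (is_deriveP _ _ _ _) Dp)[r r0 rP]; exists r => // s /andP[s0 sr].
    have := rP (- s); rewrite normrN gtr0_norm// => /(_ sr).
    have -> : - s *: (1 : R) = - s by exact: mulr1.
    by move/ler_normlP => [+ _]; lra.
  have [r2 r20 r2P] := H _ v2; have [r3 r30 r3P] := H _ v3.
  exists (Num.min y.1 (Num.min r2 r3)); first by rewrite !lt_min y0 r20.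
  move=> s /andP[s0]; rewrite !lt_min => /and3P[sy sr2 sr3].
  have {}r2P := r2P s; rewrite s0 sr2 in r2P; have {}r2P := r2P isT.
  have {}r3P := r3P s; rewrite s0 sr3 in r3P; have {}r3P := r3P isT.
  have tri (a b c rr : R) : `|a - c| <= rr -> `|a - s * b - c| <= rr + s * `|b|.
    move=> ac; rewrite addrAC (le_trans (ler_normB _ _))//.
    by rewrite normrM (gtr0_norm s0) lerD2r.
  case: Oy => /andP[_ yt] Y1 Y2 Y3; split => /=.
  + by apply/andP; split; lra.
  + apply: (le_trans (tri _ _ _ _ Y1)).
    have : s * `|v.1| <= s * w by rewrite ler_wpM2l// ltW.
    by rewrite opprB; lra.
  + exact: (le_trans (tri _ _ _ _ Y2)).
  + exact: (le_trans (tri _ _ _ _ Y3)).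
- split; rewrite /= ?subrr ?normr0 ?mulr0 ?t0 ?lexx //.
  all: by rewrite /prad subrr mulr0.
Qed.

End maximum_principle.

(** * Continuity and differentiation of bounded linear functionals in a parameter *)

Section parametric_functional.
Context {R : realType}.

Lemma mvt_remainder (g dg : R -> R) (t r d e : R) :
  (forall s, `|s - t| < r -> is_derive s 1 g (dg s)) ->
  (forall s, `|s - t| < r -> `|dg s - d| <= e) ->
  forall h, `|h| < r -> `|g (t + h) - g t - h * d| <= e * `|h|.
Proof.
move=> Dg dge h hr.
pose phi (s : R) := g (t + s * h).
have close (s : R) : 0 <= s <= 1 -> `|t + s * h - t| < r.
  move=> /andP[s0 s1]; rewrite addrAC subrr add0r normrM ger0_norm//.
  by apply: le_lt_trans hr; rewrite ler_piMl.
have dphi (s : R) : 0 <= s <= 1 -> is_derive s 1 phi (h * dg (t + s * h)).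
  move=> /close/Dg H; apply: (@is_derive_line _ _ g t h s).
  by rewrite -[X in is_derive _ X](mulr1 h); apply: is_deriveZdir.
have [c c01 Ec] : exists2 c : R, c \in `]0, 1[%R &
    phi 1 - phi 0 = h * dg (t + c * h) * (1 - 0).
  apply: (@MVT _ phi (fun c => h * dg (t + c * h)) (0 : R) 1 ltr01).
    by move=> s; rewrite in_itv/= => /andP[s0 s1]; apply: dphi; rewrite !ltW.
  apply: derivable_within_continuous => s; rewrite in_itv/= => s01.
  exact: (@ex_derive _ _ _ _ _ _ _ (dphi s s01)).
move: Ec; rewrite /phi mul1r mul0r addr0 subr0 mulr1 => ->.
rewrite -mulrBr normrM mulrC ler_wpM2r//; apply/dge/close.
by move: c01; rewrite in_itv/= => /andP[? ?]; rewrite !ltW.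
Qed.

Lemma tube (T : normedModType R) (X : topologicalType) (K : set X)
    (G : T -> X -> R) (t : T) : compact K ->
  (forall p, K p -> {for (t, p), continuous (fun w : T * X => G w.1 w.2)}) ->
  forall e : R, 0 < e -> exists2 r : R, 0 < r &
    forall s p, `|s - t| < r -> K p -> `|G s p - G t p| <= e.
Proof.
move=> cK cG e e0.
have e20 : 0 < e / 2 by lra.
have : \forall s \near t, K `<=` (fun p => `|G s p - G t p| <= e).
  move/compact_near_coveringP : cK; apply => p Kp.
  have /cvgrPdist_lt/(_ _ e20)[[/= A B] [/= At Bp] AB] := cG p Kp.
  exists (B, A) => //= -[q s] /= [Bq As].
  have /= H1 := AB (s, q) (conj As Bq).
  have /= H2 := AB (t, q) (conj (nbhs_singleton At) Bq).
  rewrite (_ : G s q - G t q = (G t p - G t q) - (G t p - G s q)); last by ring.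
  by rewrite (le_trans (ler_normB _ _))//; lra.
move=> /nbhs_ballP[r /= r0 rP]; exists r => // s p st Kp.
by apply: rP => //; rewrite -ball_normE /= distrC.
Qed.

(** [L] will be the momentum integral over a box and the integral over a segment, and [ok] the
    integrands on which it is linear. Linearity and a bound by the supremum over the compact [K] are
    enough, since [tube] makes all estimates uniform in [p]. *)
Variables (X : topologicalType) (K : set X) (L : (X -> R) -> R)
  (ok : (X -> R) -> Prop) (C : R).
Hypotheses (cK : compact K) (C0 : 0 <= C).
Hypothesis okB : forall g h, ok g -> ok h -> ok (fun p => g p - h p).
Hypothesis okZ : forall a g, ok g -> ok (fun p => a * g p).
Hypothesis LB : forall g h, ok g -> ok h -> L (fun p => g p - h p) = L g - L h.
Hypothesis LZ : forall a g, ok g -> L (fun p => a * g p) = a * L g.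
Hypothesis Lbd : forall g M, ok g -> (forall p, K p -> `|g p| <= M) ->
  `|L g| <= C * M.

Lemma param_continuous (T : normedModType R) (G : T -> X -> R) (t : T) (r0 : R) :
  0 < r0 -> (forall s, `|s - t| < r0 -> ok (G s)) ->
  (forall p, K p -> {for (t, p), continuous (fun w : T * X => G w.1 w.2)}) ->
  {for t, continuous (fun s => L (G s))}.
Proof.
move=> r00 okG cG; apply/contP => e e0.
have C1 : 0 < C + 1 by exact: ltr_wpDl.
have [r r0' rP] := tube cK cG (divr_gt0 e0 C1).
exists (Num.min r r0); first by rewrite lt_min r0'.
move=> s; rewrite lt_min => /andP[sr /okG okGs].
have okGt : ok (G t) by apply: okG; rewrite subrr normr0.
rewrite -LB//; apply: (@le_lt_trans _ _ (C * (e / (C + 1)))).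
  by apply: Lbd; [exact: okB|move=> p; exact: rP].
by rewrite mulrA ltr_pdivrMr// mulrC ltr_pM2l//; lra.
Qed.

Lemma param_derive (G dG : R -> X -> R) (t r0 : R) : 0 < r0 ->
  (forall s, `|s - t| < r0 -> ok (G s)) -> ok (dG t) ->
  (forall s p, `|s - t| < r0 -> K p -> is_derive s 1 (G ^~ p) (dG s p)) ->
  (forall p, K p -> {for (t, p), continuous (fun w : R * X => dG w.1 w.2)}) ->
  is_derive t 1 (fun s => L (G s)) (L (dG t)).
Proof.
move=> r00 okG okdG DG cdG; apply/is_deriveP => e e0.
have C1 : 0 < C + 1 by exact: ltr_wpDl.
have [r r0' rP] := tube cK cdG (divr_gt0 e0 C1).
exists (Num.min r r0); first by rewrite lt_min r0'.
move=> h hr.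
have -> : h *: (1 : R) = h by exact: mulr1.
have okGt : ok (G t) by apply: okG; rewrite subrr normr0.
have okGh : ok (G (t + h)).
  by apply: okG; rewrite addrAC subrr add0r; move: hr; rewrite lt_min => /andP[].
have okd : ok (fun p => h * dG t p) by exact: okZ.
rewrite -LB// -LZ// -LB//; last exact: okB.
apply: (@le_trans _ _ (C * (e / (C + 1) * `|h|))).
  apply: Lbd; first by do 2?apply: okB.
  move=> p Kp; apply: (@mvt_remainder (G ^~ p) (dG ^~ p) t (Num.min r r0)) => //.
    by move=> s; rewrite lt_min => /andP[_ ?]; exact: DG.
  by move=> s; rewrite lt_min => /andP[? _]; exact: rP.
rewrite mulrA ler_wpM2r// mulrA ler_pdivrMr// mulrC ler_wpM2l ?(ltW e0)//; lra.
Qed.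

End parametric_functional.

(** * Integrals over momentum space of continuous, compactly supported functions *)

Section momentum_integral.
Context {R : realType}.
Local Notation leb := (@lebesgue_measure R).
Local Notation leb2 := (leb \x leb)%E.
Local Notation mom := (R * R)%type.
Implicit Types (P M a : R) (g h : mom -> R).

(** The product sigma-algebra is generated by rectangles, so an open set is exhibited as a countable
    union of rational boxes; a box that is not inside [U] is replaced by [set0]. *)
Lemma measurable_open2 (U : set mom) : open U ->
  measurable (U : set (measurableTypeR R * measurableTypeR R)).
Proof.
move=> oU.
pose bx (a b r : rat) : set mom :=
  `](ratr a - ratr r), (ratr a + ratr r)[ `*` `](ratr b - ratr r), (ratr b + ratr r)[.
have -> : U = \bigcup_(a : rat) \bigcup_(b : rat) \bigcup_(r : rat)
    (if `[< bx a b r `<=` U >] then bx a b r else set0).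
  apply/seteqP; split=> [p Up|p [a _ [b _ [r _]]]]; last first.
    by case: ifPn => // /asboolP; apply.
  have /nbhs_ballP[e /= e0 eU] : nbhs p U by exact: open_nbhs_nbhs.
  have e20 : 0 < e / 2 by lra.
  have [r] := rat_in_itvoo e20; rewrite in_itv/= => /andP[r0 re].
  have rat_near (x : R) : exists q : rat, `|x - ratr q| < ratr r.
    have xr : x - ratr r < x + ratr r by lra.
    have [q] := rat_in_itvoo xr; rewrite in_itv/= => /andP[q1 q2]; exists q.
    by rewrite ltr_norml; apply/andP; split; lra.
  have [a ap] := rat_near p.1; have [b bp] := rat_near p.2.
  have inb (x : R) (q : rat) : `|x - ratr q| < ratr r ->
      x \in `](ratr q - ratr r), (ratr q + ratr r)[.
    by rewrite ltr_norml in_itv/= => /andP[? ?]; apply/andP; split; lra.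
  exists a => //; exists b => //; exists r => //; rewrite ifT.
    by split; exact: inb.
  apply/asboolP => -[q1 q2] [/=]; rewrite !in_itv/= => /andP[q11 q12] /andP[q21 q22].
  apply: eU; rewrite -ball_normE /= prod_norm_lt/=.
  move: ap bp; rewrite !ltr_norml => /andP[? ?] /andP[? ?].
  by apply/andP; split; apply/andP; split; lra.
apply: bigcupT_measurable_rat => a; apply: bigcupT_measurable_rat => b.
apply: bigcupT_measurable_rat => r; case: ifPn => // _.
by apply: measurableX; exact: measurable_itv.
Qed.

Lemma continuous_measurable2 (g : mom -> R) : continuous g ->
  measurable_fun setT (g : measurableTypeR R * measurableTypeR R -> R).
Proof.
move=> cg; apply: (measurability _ (RGenOInfty.measurableE R)).
move=> /= _ [_ [a ->]] <-; rewrite setTI; apply: measurable_open2.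
by move/continuousP : cg; apply; exact: interval_open.
Qed.

Definition cbox (P : R) (g : mom -> R) :=
  continuous g /\ forall p, P < `|p| -> g p = 0.

Definition box (P : R) : set mom := `[-P, P] `*` `[-P, P].

Lemma boxE P (p : mom) : box P p <-> `|p| <= P.
Proof.
rewrite prod_normE ge_max !ler_norml /box /= !in_itv/=; split.
  by move=> [-> ->].
by move=> /andP[].
Qed.

Lemma compact_box P : compact (box P).
Proof. by apply: compact_setX; exact: segment_compact. Qed.

Lemma measurable_box P :
  measurable (box P : set (measurableTypeR R * measurableTypeR R)).
Proof. by apply: measurableX; exact: measurable_itv. Qed.

Lemma leb2_box P : 0 <= P -> leb2 (box P) = ((2 * P) ^+ 2)%:E.
Proof.
move=> P0; rewrite product_measure1E//= !lebesgue_measure_itv/= lte_fin.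
case: ifPn => [_|]; last rewrite -leNgt => P1.
  by rewrite -EFinB -EFinM; congr EFin; ring.
have -> : P = 0 by lra.
by rewrite mulr0 expr0n mule0.
Qed.

Lemma leb2_box_fin P : 0 <= P -> (leb2 (box P) < +oo)%E.
Proof. by move=> P0; rewrite leb2_box// ltry. Qed.

Lemma cboxW P P' g : P <= P' -> cbox P g -> cbox P' g.
Proof. by move=> PP' [cg g0]; split=> // p /(le_lt_trans PP')/g0. Qed.

Lemma cbox_bounded P g : cbox P g -> exists2 M : R, 0 <= M & forall p, `|g p| <= M.
Proof.
move=> [cg g0].
have : compact (g @` box P).
  by apply: continuous_compact; [exact: continuous_subspaceT|exact: compact_box].
move=> /compact_bounded[M [_ /(_ (M + 1))]]; rewrite ltrDl ltr01 => /(_ isT) H.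
exists `|M + 1| => // p; have [pP|/g0->] := leP `|p| P; last by rewrite normr0.
by apply: (le_trans _ (ler_norm _)); apply: H; exists p => //; exact/boxE.
Qed.

Lemma cbox_restrict P g : cbox P g -> g = g \_ (box P).
Proof.
move=> [_ g0]; apply/funext => p; rewrite patchE.
case: ifPn => //; rewrite notin_setE => pP; apply: g0.
by rewrite ltNge; apply/negP => ?; apply: pP; apply/boxE.
Qed.

Lemma cbox_integrable P g : 0 <= P -> cbox P g -> leb2.-integrable setT (EFin \o g).
Proof.
move=> P0 Bg; have [cg g0] := Bg.
have mb := measurable_box P.
have : leb2.-integrable (box P) (EFin \o g).
  apply: measurable_bounded_integrable => //.
  - exact: leb2_box_fin.
  - exact: measurable_funS (continuous_measurable2 cg).
  - have [M M0 MP] := cbox_bounded Bg; exists M; split; first exact: num_real.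
    by move=> x Mx p _ /=; apply: (le_trans (MP p)); exact: ltW.
by move/(integrable_mkcond _ mb); rewrite restrict_EFin -cbox_restrict.
Qed.

Definition momI (g : mom -> R) : R := (\int[leb2]_p g p)%R.

Lemma cboxB P g h : cbox P g -> cbox P h -> cbox P (fun p => g p - h p).
Proof.
move=> [cg g0] [ch h0]; split; last by move=> p pP; rewrite g0// h0// subrr.
by move=> p; apply: cvgB; [exact: cg|exact: ch].
Qed.

Lemma cboxD P g h : cbox P g -> cbox P h -> cbox P (fun p => g p + h p).
Proof.
move=> [cg g0] [ch h0]; split; last by move=> p pP; rewrite g0// h0// addr0.
by move=> p; apply: cvgD; [exact: cg|exact: ch].
Qed.

Lemma cboxM P (k : mom -> R) g : continuous k -> cbox P g -> cbox P (fun p => k p * g p).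
Proof.
move=> ck [cg g0]; split; last by move=> p pP; rewrite g0// mulr0.
by move=> p; apply: cvgM; [exact: ck|exact: cg].
Qed.

Lemma cboxZ P a g : cbox P g -> cbox P (fun p => a * g p).
Proof. by apply: cboxM => p; exact: cvg_cst. Qed.

Lemma momIB P g h : 0 <= P -> cbox P g -> cbox P h ->
  momI (fun p => g p - h p) = momI g - momI h.
Proof.
by move=> P0 Bg Bh; rewrite /momI RintegralB//; exact: cbox_integrable P0 _.
Qed.

Lemma momID P g h : 0 <= P -> cbox P g -> cbox P h ->
  momI (fun p => g p + h p) = momI g + momI h.
Proof.
by move=> P0 Bg Bh; rewrite /momI RintegralD//; exact: cbox_integrable P0 _.
Qed.

Lemma momIZ P a g : 0 <= P -> cbox P g -> momI (fun p => a * g p) = a * momI g.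
Proof.
by move=> P0 Bg; rewrite /momI RintegralZl//; exact: cbox_integrable P0 _.
Qed.

Lemma momI_le P g h : 0 <= P -> cbox P g -> cbox P h ->
  (forall p, g p <= h p) -> momI g <= momI h.
Proof.
move=> P0 Bg Bh gh; apply: le_Rintegral => //; exact: cbox_integrable P0 _.
Qed.

Lemma momI_bound P g M : 0 <= P -> cbox P g ->
  (forall p, box P p -> `|g p| <= M) -> `|momI g| <= (2 * P) ^+ 2 * M.
Proof.
move=> P0 Bg gM; have mb := measurable_box P.
have Ib := cbox_integrable P0 Bg.
have -> : momI g = \int[leb2]_(p in box P) g p.
  by rewrite Rintegral_mkcond -cbox_restrict.
have Ibx : leb2.-integrable (box P) (EFin \o g).
  by apply: integrableS Ib.
apply: (le_trans (le_normr_Rintegral _ _)) => //.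
apply: (@le_trans _ _ (\int[leb2]_(p in box P) M)).
  apply: le_Rintegral => //.
    by apply: (integrable_abse Ibx).
  apply: measurable_bounded_integrable => //.
    exact: leb2_box_fin.
  exact: bounded_cst.
by rewrite Rintegral_cst// [X in M * fine X <= _](leb2_box P0) /= mulrC.
Qed.

Lemma is_derive_slice1 g (g1 : R) (x y : R) : is_derive (x, y) (1, 0) g g1 ->
  is_derive x 1 (fun x => g (x, y)) g1.
Proof.
move=> D; apply: (is_derive_transfer _ D) => h.
by congr (g (_, _)); rewrite /= scaler0 addr0.
Qed.

Lemma is_derive_slice2 g (g1 : R) (x y : R) : is_derive (x, y) (0, 1) g g1 ->
  is_derive y 1 (fun y => g (x, y)) g1.
Proof.
move=> D; apply: (is_derive_transfer _ D) => h.
by congr (g (_, _)); rewrite /= scaler0 addr0.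
Qed.

Lemma integral_derive_compact (F F' : R -> R) (P : R) :
  continuous F' -> (forall x : R, is_derive x 1 F (F' x)) ->
  (forall x, P < `|x| -> F x = 0) -> (forall x, P < `|x| -> F' x = 0) ->
  (\int[leb]_x (F' x)%:E = 0)%E.
Proof.
move=> cF' DF F0 F'0; pose Q := `|P| + 1.
have PQ : P < Q by rewrite /Q; have := ler_norm P; lra.
have Q0 : 0 < Q by rewrite /Q; have := normr_ge0 P; lra.
have cF : continuous F by move=> x; exact: is_derive_continuous (DF x).
have -> : (fun x => (F' x)%:E) = (fun x => (F' x)%:E) \_ `[-Q, Q].
  apply/funext => x; rewrite patchE; case: ifPn => //.
  rewrite notin_setE /= in_itv/= => /negP; rewrite -ler_norml -ltNge => xQ.
  by rewrite F'0//; exact: lt_trans PQ xQ.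
rewrite -integral_mkcond (@continuous_FTC2 _ _ F)//; last 3 first.
- exact: continuous_subspaceT.
- split.
  + by move=> x _; exact: (@ex_derive _ _ _ _ _ _ _ (DF x)).
  + by apply: cvg_at_right_filter; exact: cF.
  + by apply: cvg_at_left_filter; exact: cF.
- by move=> x _; rewrite derive1E (@derive_val _ _ _ _ _ _ _ (DF x)).
- by rewrite F0 ?F0 ?subee// ?normrN gtr0_norm.
- by lra.
Qed.

(** Fubini with the differentiated variable innermost leaves a one-dimensional integral of a
    derivative with compact support. This is the integration by parts that removes the force terms
    from the continuity equation. *)
Lemma momI_dp1 P g (g1 : mom -> R) : 0 <= P -> cbox P g -> cbox P g1 ->
  (forall p : mom, is_derive p (1, 0) g (g1 p)) -> momI g1 = 0.
Proof.
move=> P0 [cg g0] B1 D; have [cg1 g10] := B1.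
have I1 := cbox_integrable P0 B1.
rewrite /momI /Rintegral -(integral21_prod_meas1 I1) integral0_eq//= => y _.
apply: (@integral_derive_compact (fun x => g (x, y)) _ P).
- apply: (@cont_slicel _ _ (fun x y => g1 (x, y)) y).
  by rewrite (_ : (fun w => _) = g1)//; apply/funext => -[].
- by move=> x; exact: is_derive_slice1.
- by move=> x xP; apply: g0; rewrite prod_normE lt_max xP.
- by move=> x xP; apply: g10; rewrite prod_normE lt_max xP.
Qed.

Lemma momI_dp2 P g (g2 : mom -> R) : 0 <= P -> cbox P g -> cbox P g2 ->
  (forall p : mom, is_derive p (0, 1) g (g2 p)) -> momI g2 = 0.
Proof.
move=> P0 [cg g0] B2 D; have [cg2 g20] := B2.
have I2 := cbox_integrable P0 B2.
rewrite /momI /Rintegral -(integral12_prod_meas1 I2) integral0_eq//= => x _.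
apply: (@integral_derive_compact (fun y => g (x, y)) _ P).
- apply: (@cont_slice _ _ (fun x y => g2 (x, y)) x).
  by rewrite (_ : (fun w => _) = g2)//; apply/funext => -[].
- by move=> y; exact: is_derive_slice2.
- by move=> y yP; apply: g0; rewrite prod_normE lt_max yP orbT.
- by move=> y yP; apply: g20; rewrite prod_normE lt_max yP orbT.
Qed.

Lemma momI_continuous (T : normedModType R) P (G : T -> mom -> R) (t : T) (r : R) :
  0 <= P -> 0 < r -> (forall s, `|s - t| < r -> cbox P (G s)) ->
  (forall p, {for (t, p), continuous (fun w : T * mom => G w.1 w.2)}) ->
  {for t, continuous (fun s => momI (G s))}.
Proof.
move=> P0 r0 BG cG.
apply: (@param_continuous _ _ (box P) momI (cbox P) ((2 * P) ^+ 2) _ _ _ _ _ T G t r) => //.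
- exact: compact_box.
- exact: sqr_ge0.
- exact: cboxB.
- by move=> g h; exact: momIB.
- by move=> g M; exact: momI_bound.
Qed.

Lemma momI_derive P (G dG : R -> mom -> R) (t r : R) :
  0 <= P -> 0 < r -> (forall s, `|s - t| < r -> cbox P (G s)) -> cbox P (dG t) ->
  (forall s p, `|s - t| < r -> is_derive s 1 (G ^~ p) (dG s p)) ->
  (forall p, {for (t, p), continuous (fun w : R * mom => dG w.1 w.2)}) ->
  is_derive t 1 (fun s => momI (G s)) (momI (dG t)).
Proof.
move=> P0 r0 BG BdG DG cdG.
apply: (@param_derive _ _ (box P) momI (cbox P) ((2 * P) ^+ 2) _ _ _ _ _ _ _ G dG t r) => //.
- exact: compact_box.
- exact: sqr_ge0.
- exact: cboxB.
- by move=> a g; exact: cboxZ.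
- by move=> g h; exact: momIB.
- by move=> a g; exact: momIZ.
- by move=> g M; exact: momI_bound.
- by move=> s p sr _; exact: DG.
Qed.

End momentum_integral.

(** * Relativistic and classical velocities *)

Section velocity.
Context {R : realType}.
Implicit Types (k m c : R) (p : R * R).

(* [k = c^-2] gives the relativistic velocity and [k = 0] the classical one. *)
Definition gam k m p : R := Num.sqrt (m ^+ 2 + k * (p.1 ^+ 2 + p.2 ^+ 2)).
Definition vel1 k m p : R := p.1 / gam k m p.
Definition vel2 k m p : R := p.2 / gam k m p.

Lemma enormE p : enorm p ^+ 2 = p.1 ^+ 2 + p.2 ^+ 2.
Proof. by rewrite sqr_sqrtr// addr_ge0// sqr_ge0. Qed.

Lemma V1E c m p : V1 c m p = vel1 (c ^- 2) m p.
Proof. by rewrite /V1 enormE. Qed.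

Lemma V2E c m p : V2 c m p = vel2 (c ^- 2) m p.
Proof. by rewrite /V2 enormE. Qed.

Lemma V1ooE m p : 0 < m -> V1oo m p = vel1 0 m p.
Proof. by move=> m0; rewrite /V1oo /vel1 /gam mul0r addr0 sqrtr_sqr gtr0_norm. Qed.

Lemma V2ooE m p : 0 < m -> V2oo m p = vel2 0 m p.
Proof. by move=> m0; rewrite /V2oo /vel2 /gam mul0r addr0 sqrtr_sqr gtr0_norm. Qed.

Lemma norm_le_enorm p : `|p| <= enorm p.
Proof.
rewrite prod_normE ge_max /enorm -!sqrtr_sqr !ler_wsqrtr//.
  by rewrite lerDr sqr_ge0.
by rewrite lerDl sqr_ge0.
Qed.

Lemma gamE k m p : 0 <= k ->
  gam k m p ^+ 2 = m ^+ 2 + k * (p.1 ^+ 2 + p.2 ^+ 2).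
Proof.
by move=> k0; rewrite sqr_sqrtr// addr_ge0 ?sqr_ge0// mulr_ge0// addr_ge0// sqr_ge0.
Qed.

Lemma gam_ge k m p : 0 <= k -> 0 < m -> m <= gam k m p.
Proof.
move=> k0 m0; rewrite -{1}(gtr0_norm m0) -sqrtr_sqr ler_wsqrtr// lerDl.
by rewrite mulr_ge0 ?addr_ge0 ?sqr_ge0.
Qed.

Lemma gam_gt0 k m p : 0 <= k -> 0 < m -> 0 < gam k m p.
Proof. by move=> k0 m0; apply: lt_le_trans (gam_ge p k0 m0). Qed.

Lemma gam_le k m p : 0 <= k <= 1 -> 0 < m -> gam k m p <= m + 2 * `|p|.
Proof.
move=> /andP[k0 k1] m0; have mp : 0 <= m + 2 * `|p|.
  by rewrite addr_ge0 ?(ltW m0)// mulr_ge0.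
rewrite -(ler_pXn2r (n := 2)) ?nnegrE ?(ltW (gam_gt0 _ _ _))// gamE//.
have p1 : p.1 ^+ 2 <= `|p| ^+ 2.
  by rewrite -[p.1 ^+ 2]real_normK ?num_real// ler_pXn2r ?nnegrE// prod_normE le_max lexx.
have p2 : p.2 ^+ 2 <= `|p| ^+ 2.
  by rewrite -[p.2 ^+ 2]real_normK ?num_real// ler_pXn2r ?nnegrE// prod_normE le_max lexx orbT.
have : k * (p.1 ^+ 2 + p.2 ^+ 2) <= p.1 ^+ 2 + p.2 ^+ 2.
  by rewrite ler_piMl// addr_ge0// sqr_ge0.
have := normr_ge0 p; nra.
Qed.

Lemma over_gam_le k m (y : R) p : 0 <= k -> 0 < m -> `|y / gam k m p| <= `|y| / m.
Proof.
move=> k0 m0; rewrite normrM normfV (gtr0_norm (gam_gt0 _ _ _))//.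
by rewrite ler_wpM2l// lef_pV2 ?posrE ?gam_gt0// gam_ge.
Qed.

(** The mass-shell relation: [c * gam] is the energy divided by [c]. It dominates both momentum
    components, which is why velocities stay below [c]. *)
Lemma gam_lorentz c m p : 0 < c -> 0 < m ->
  (c * gam (c ^- 2) m p) ^+ 2 = (c * m) ^+ 2 + p.1 ^+ 2 + p.2 ^+ 2.
Proof.
move=> c0 m0; rewrite exprMn gamE ?invr_ge0 ?sqr_ge0//; field.
exact: lt0r_neq0.
Qed.

Lemma norm_le_lorentz c m p : 0 < c -> 0 < m ->
  `|p.1| <= c * gam (c ^- 2) m p /\ `|p.2| <= c * gam (c ^- 2) m p.
Proof.
move=> c0 m0; have k0 : 0 <= c ^- 2 by rewrite invr_ge0 sqr_ge0.
have g0 := gam_gt0 p k0 m0.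
have cg : 0 <= c * gam (c ^- 2) m p by rewrite mulr_ge0// ltW.
have E := gam_lorentz p c0 m0.
split; rewrite -(ler_pXn2r (n := 2)) ?nnegrE// E real_normK ?num_real//.
  by rewrite -addrA addrCA lerDl addr_ge0 ?sqr_ge0.
by rewrite lerDr addr_ge0 ?sqr_ge0.
Qed.

Lemma vel1_lt_c c m p : 0 < c -> 0 < m -> `|vel1 (c ^- 2) m p| <= c.
Proof.
move=> c0 m0; have k0 : 0 <= c ^- 2 by rewrite invr_ge0 sqr_ge0.
rewrite normrM normfV (gtr0_norm (gam_gt0 _ _ _))// ler_pdivrMr ?gam_gt0//.
exact: (norm_le_lorentz _ _ _).1.
Qed.

Lemma vel2_lt_c c m p : 0 < c -> 0 < m -> `|vel2 (c ^- 2) m p| <= c.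
Proof.
move=> c0 m0; have k0 : 0 <= c ^- 2 by rewrite invr_ge0 sqr_ge0.
rewrite normrM normfV (gtr0_norm (gam_gt0 _ _ _))// ler_pdivrMr ?gam_gt0//.
exact: (norm_le_lorentz _ _ _).2.
Qed.

(* The transverse velocity is controlled by the flux of particles through a
   light line [x -+ c t]: both tend to zero as [p.1] grows. *)
Lemma vel2_le_flux c m sg p : 0 < c -> 0 < m -> `|sg| = 1 ->
  `|vel2 (c ^- 2) m p| <= gam (c ^- 2) m p / m * (c - sg * vel1 (c ^- 2) m p).
Proof.
move=> c0 m0 sg1; have k0 : 0 <= c ^- 2 by rewrite invr_ge0 sqr_ge0.
have g0 := gam_gt0 p k0 m0.
have [n1 n2] := norm_le_lorentz p c0 m0; have E := gam_lorentz p c0 m0.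
set g := gam _ _ _ in g0 n1 n2 E *.
rewrite normrM normfV (gtr0_norm g0) ler_pdivrMr//.
have -> : g / m * (c - sg * vel1 (c ^- 2) m p) * g = g * (c * g - sg * p.1) / m.
  by rewrite /vel1 -/g; field; rewrite (lt0r_neq0 m0) (lt0r_neq0 g0).
rewrite ler_pdivlMr//.
have s1 : sg * p.1 <= `|p.1|.
  by rewrite (le_trans (ler_norm _))// normrM sg1 mul1r.
have s2 : g * (c * g - `|p.1|) <= g * (c * g - sg * p.1).
  by rewrite ler_wpM2l ?(ltW g0)// lerB.
apply: le_trans s2.
(* The mass shell factors as a difference of squares. Its right-hand side is at least
   [2 * (c * m) * |p.2|], and the second factor on the left is at most [2 * (c * g)]. *)
have H : (c * g - `|p.1|) * (c * g + `|p.1|) = (c * m) ^+ 2 + p.2 ^+ 2.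
  rewrite -subr_sqr E real_normK ?num_real//; ring.
have H2 : (c * m) ^+ 2 + p.2 ^+ 2 <= (c * g - `|p.1|) * (2 * (c * g)).
  by rewrite -H ler_wpM2l ?subr_ge0//; lra.
have H3 : 2 * (c * m) * `|p.2| <= (c * m) ^+ 2 + p.2 ^+ 2.
  rewrite -[p.2 ^+ 2]real_normK ?num_real//.
  have := sqr_ge0 (c * m - `|p.2|); rewrite sqrrB; lra.
have c20 : 0 < 2 * c by lra.
rewrite -(ler_pM2l c20); move: (le_trans H3 H2); lra.
Qed.

Lemma flux_ge0 c m sg p : 0 < c -> 0 < m -> `|sg| = 1 ->
  0 <= c - sg * vel1 (c ^- 2) m p.
Proof.
move=> c0 m0 sg1; rewrite subr_ge0 (le_trans (ler_norm _))// normrM sg1 mul1r.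
exact: vel1_lt_c.
Qed.

(** From [(gam - m) * (gam + m) = k * |p| ^ 2] with the Euclidean norm: the difference [gam - m] is
    of first order in [k], hence of order [c ^- 2] in use. *)
Lemma vel_classical k m (x : R) p : 0 <= k -> 0 < m ->
  `|x / gam k m p - x / gam 0 m p| <=
  `|x| * (k * (p.1 ^+ 2 + p.2 ^+ 2)) / m ^+ 3.
Proof.
move=> k0 m0.
have -> : gam 0 m p = m by rewrite /gam mul0r addr0 sqrtr_sqr gtr0_norm.
have g0 := gam_gt0 p k0 m0; have gm := gam_ge p k0 m0.
have E := gamE m p k0.
set g := gam _ _ _ in g0 gm E *; set q := p.1 ^+ 2 + p.2 ^+ 2 in E *.
have q0 : 0 <= q by rewrite addr_ge0// sqr_ge0.
have -> : x / g - x / m = - (x * ((g - m) / (g * m))).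
  by field; rewrite (lt0r_neq0 m0) (lt0r_neq0 g0).
rewrite normrN normrM -mulrA ler_wpM2l//.
rewrite ger0_norm; last by rewrite divr_ge0 ?subr_ge0// mulr_ge0// ltW.
rewrite ler_pdivrMr ?mulr_gt0// mulrAC ler_pdivlMr ?exprn_gt0//.
have H : (g - m) * (g + m) = k * q by rewrite -subr_sqr E; ring.
have d0 : 0 <= g - m by rewrite subr_ge0.
have H1 : (g - m) * m <= k * q by rewrite -H ler_wpM2l//; lra.
have -> : (g - m) * m ^+ 3 = ((g - m) * m) * (m * m) by ring.
apply: ler_pM => //.
- by rewrite mulr_ge0// ltW.
- by rewrite mulr_ge0// ltW.
- by rewrite ler_wpM2r ?(ltW m0).
Qed.

Lemma continuous_gam k m : continuous (gam k m).
Proof.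
move=> p; apply: (@continuous_comp _ _ _ (fun p => m ^+ 2 + k * (p.1 ^+ 2 + p.2 ^+ 2)) Num.sqrt); last exact: sqrt_continuous.
apply: cvgD; first exact: cvg_cst.
apply: cvgM; first exact: cvg_cst.
by apply: cvgD; rewrite expr2; under eq_fun do rewrite expr2; apply: cvgM;
  (exact: cvg_fst || exact: cvg_snd).
Qed.

Lemma continuous_over_gam (xi : R * R -> R) k m : continuous xi -> 0 <= k -> 0 < m ->
  continuous (fun p => xi p / gam k m p).
Proof.
move=> cx k0 m0 p; apply: cvgM; first exact: cx.
by apply: cvgV; [rewrite lt0r_neq0// gam_gt0|exact: continuous_gam].
Qed.

Lemma continuous_vel1 k m : 0 <= k -> 0 < m -> continuous (vel1 k m).
Proof. by apply: continuous_over_gam => p; exact: cvg_fst. Qed.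

Lemma continuous_vel2 k m : 0 <= k -> 0 < m -> continuous (vel2 k m).
Proof. by apply: continuous_over_gam => p; exact: cvg_snd. Qed.

(** The common value of the derivative of [vel2] in [p.1] and of [vel1] in [p.2]. Their equality
    makes the magnetic force divergence free in momentum. *)
Definition dvel k m p : R := - (k * p.1 * p.2) / gam k m p ^+ 3.

Lemma continuous_dvel k m : 0 <= k -> 0 < m -> continuous (dvel k m).
Proof.
move=> k0 m0 p; apply: cvgM.
  apply: cvgN; apply: cvgM; last exact: cvg_snd.
  by apply: cvgM; [exact: cvg_cst|exact: cvg_fst].
apply: cvgV; first by rewrite lt0r_neq0// exprn_gt0// gam_gt0.
under eq_fun do rewrite exprS expr2.
rewrite exprS expr2; apply: cvgM; first exact: continuous_gam.
by apply: cvgM; exact: continuous_gam.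
Qed.

Lemma dvel_aux k m (x y : R) : 0 <= k -> 0 < m ->
  is_derive x 1 (fun x : R => y / Num.sqrt (m ^+ 2 + k * (x ^+ 2 + y ^+ 2)))
    (- (k * x * y) / (Num.sqrt (m ^+ 2 + k * (x ^+ 2 + y ^+ 2))) ^+ 3).
Proof.
move=> k0 m0.
have u0 : 0 < m ^+ 2 + k * (x ^+ 2 + y ^+ 2).
  by rewrite ltr_wpDr ?exprn_gt0// mulr_ge0// addr_ge0// sqr_ge0.
have s0 : 0 < Num.sqrt (m ^+ 2 + k * (x ^+ 2 + y ^+ 2)) by rewrite sqrtr_gt0.
pose u (x : R) := m ^+ 2 + k * (x ^+ 2 + y ^+ 2).
have Du : is_derive x 1 u (2 * k * x).
  have -> : u = cst (m ^+ 2) + k \*: ((@id R) ^+ 2 + cst (y ^+ 2)) by [].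
  by apply: is_derive_eq; rewrite /GRing.scale/=; ring.
have Ds : is_derive x 1 (Num.sqrt \o u) ((2 * Num.sqrt (u x))^-1 * (2 * k * x)).
  apply: is_derive1_comp.
  exact: is_derive1_sqrt.
have sn : (Num.sqrt \o u) x != 0 by rewrite lt0r_neq0.
have Dv : is_derive x 1 (y \*: (fun x => ((Num.sqrt \o u) x)^-1))
    (y * (- (Num.sqrt (u x)) ^- 2 * ((2 * Num.sqrt (u x))^-1 * (2 * k * x)))).
  apply: is_deriveZ.
  exact: is_deriveV.
apply: (is_derive_eq Dv); rewrite -/(u x); field.
by rewrite lt0r_neq0.
Qed.

Lemma is_derive_vel2 k m p : 0 <= k -> 0 < m ->
  is_derive p (1, 0) (vel2 k m) (dvel k m p).
Proof.
move=> k0 m0; apply: (is_derive_transfer _ (dvel_aux p.1 p.2 k0 m0)) => h.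
by rewrite /vel2 /gam /= scaler0 addr0.
Qed.

Lemma is_derive_vel1 k m p : 0 <= k -> 0 < m ->
  is_derive p (0, 1) (vel1 k m) (dvel k m p).
Proof.
move=> k0 m0; rewrite /dvel /gam (mulrAC k p.1) (addrC (p.1 ^+ 2)).
apply: (is_derive_transfer _ (dvel_aux p.2 p.1 k0 m0)) => h.
by rewrite /vel1 /gam /= scaler0 addr0 (addrC (p.1 ^+ 2)).
Qed.

End velocity.

(** * Vlasov equations with general [k] and comparison along their characteristics *)

Section transport.
Context {R : realType}.
Local Notation phase := (R * (R * R))%type.
Implicit Types (k m q : R) (H : R -> R -> R) (f : R -> phase -> R).

(** [H] stands for [B / c]; the limit system is the case [k = 0] with [E2] and [H] zero. *)
Definition force1 k m q (E1 : R -> R -> R) H (t : R) (z : phase) : R :=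
  q * (E1 t z.1 + vel2 k m z.2 * H t z.1).
Definition force2 k m q (E2 : R -> R -> R) H (t : R) (z : phase) : R :=
  q * (E2 t z.1 - vel1 k m z.2 * H t z.1).

Definition material k m q (E1 E2 : R -> R -> R) H f (t : R) (z : phase) : R :=
  dt (f ^~ z) t + vel1 k m z.2 * dx (f t) z
  + force1 k m q E1 H t z * dp1 (f t) z + force2 k m q E2 H t z * dp2 (f t) z.

(** Phase velocities that respect the speed limits of [transport_le] all over the backward domain of
    [(t, z)]. *)
Definition slow k m q (E1 E2 : R -> R -> R) H (l K w t : R) (z : phase) :=
  forall y, domain l K w t z y -> 0 < y.1 ->
  [/\ `|vel1 k m y.2.2| <= w, `|force1 k m q E1 H y.1 y.2| < K * expR (l * y.1) &
      `|force2 k m q E2 H y.1 y.2| < K * expR (l * y.1)].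

Definition along k m q (E1 E2 : R -> R -> R) H (G : R * phase -> R) (y : R * phase) (s : R) : R :=
  G (y.1 + s, (y.2.1 + s * vel1 k m y.2.2,
    (y.2.2.1 + s * force1 k m q E1 H y.1 y.2,
     y.2.2.2 + s * force2 k m q E2 H y.1 y.2))).

Lemma material_along k m q (E1 E2 : R -> R -> R) H f (y : R * phase) : C1_time f -> 0 < y.1 ->
  is_derive (0 : R) 1 (along k m q E1 E2 H (fun w => ext f w.1 w.2) y)
    (material k m q E1 E2 H f y.1 y.2).
Proof. by move=> Cf y0; exact: ext_chain_phase. Qed.

(** The transport principle applied to [f - G - h] and [G - f - h]. The function [G] need not solve
    any equation: its rate of change along the characteristics of [f] is a defect, paid for by the
    growth of [h]. *)
Lemma vlasov_compare k m q (E1 E2 : R -> R -> R) H f (G : R * phase -> R) (h dh : R -> R)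
    (l K w t : R) (z : phase) :
  C1_time f -> 0 < l -> 0 < K -> 0 <= w -> 0 <= t ->
  slow k m q E1 E2 H l K w t z ->
  (forall (t : R) (z : phase), 0 < t -> material k m q E1 E2 H f t z = 0) ->
  continuous G -> continuous h ->
  (forall s : R, 0 < s -> is_derive s 1 h (dh s)) ->
  (forall y, domain l K w t z y -> 0 < y.1 -> exists2 d : R, `|d| <= dh y.1 &
     is_derive (0 : R) 1 (along k m q E1 E2 H G y) d) ->
  (forall y, domain l K w t z y -> y.1 = 0 -> `|f 0 y.2 - G y| <= h 0) ->
  `|f t z - G (t, z)| <= h t.
Proof.
move=> Cf l0 K0 w0 t0 sl vf cG ch Dh DG init.
have cf := ext_continuous Cf.
suff main (sg : R) : `|sg| = 1 -> sg * (f t z - G (t, z)) <= h t.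
  rewrite ler_norml -[X in X && _]/(- h t <= _).
  have := main 1 (normr1 _); have := main (- 1); rewrite normrN1 => /(_ erefl).
  by rewrite mul1r mulN1r => H1 H2; apply/andP; split; lra.
move=> sg1.
pose u (y : R * phase) := sg * (ext f y.1 y.2 - G y) - h y.1.
have -> : sg * (f t z - G (t, z)) = u (t, z) + h t by rewrite /u /= extE// subrK.
rewrite -lerBrDr subrr.
apply: (@transport_le _ u l K w t 0 z) => //.
- move=> y; apply: cvgB; last by apply: (@continuous_comp _ _ _ (fun y : R * phase => y.1) h); [exact: cvg_fst|exact: ch].
  apply: cvgM; first exact: cvg_cst.
  by apply: cvgB; [exact: cf|exact: cG].
- move=> y Dy y0; rewrite /u y0 extE// subr_le0.
  apply: le_trans (init y Dy y0); rewrite (le_trans (ler_norm _))//.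
  by rewrite normrM sg1 mul1r.
- move=> y Dy y0; have [v1 v2 v3] := sl y Dy y0.
  exists (vel1 k m y.2.2, (force1 k m q E1 H y.1 y.2, force2 k m q E2 H y.1 y.2)).
  split => //=; have [d dd Dd] := DG y Dy y0.
  exists (sg * (0 - d) - dh y.1).
    rewrite subr_le0 sub0r; apply: le_trans dd.
    by rewrite (le_trans (ler_norm _))// normrM sg1 mul1r normrN.
  have D1 := material_along k m q E1 E2 H Cf y0; rewrite (vf _ _ y0) in D1.
  have D2 : is_derive (0 : R) 1 (fun s => h (y.1 + s)) (dh y.1).
    by apply: (is_derive_transfer _ (Dh _ y0)) => a; rewrite add0r.
  exact: (is_deriveB (is_deriveZ sg (is_deriveB D1 Dd)) D2).
Qed.

End transport.

(** * Densities and currents of one species; the continuity equation *)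

Section conservation.
Context {R : realType}.
Local Notation mom := (R * R)%type.
Local Notation phase := (R * mom)%type.
Local Notation leb := (@lebesgue_measure R).

Lemma cont_assoc (g : R * phase -> R) : continuous g ->
  continuous (fun w : (R * R) * mom => g (w.1.1, (w.1.2, w.2))).
Proof.
move=> cg w; apply/contP => e e0.
have /contP/(_ _ e0)[r r0 rP] := cg (w.1.1, (w.1.2, w.2)).
exists r => // z' zr; apply: (rP (z'.1.1, (z'.1.2, z'.2))).
by move: zr; rewrite !prod_norm_lt/= -andbA.
Qed.

(** Since [n] is bounded near [(t, x)], the functions [N s] are Lipschitz in space with one constant
    there; continuity in time at the single point [x] then gives joint continuity. *)
Lemma cont_joint (N n : R -> R -> R) (t x r : R) : 0 < r ->
  (forall s y, `|s - t| < r -> `|y - x| < r -> is_derive y 1 (N s) (n s y)) ->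
  {for (t, x), continuous (fun w : R * R => n w.1 w.2)} ->
  {for t, continuous (N ^~ x)} ->
  {for (t, x), continuous (fun w : R * R => N w.1 w.2)}.
Proof.
move=> r0 DN /contP/(_ 1 ltr01)[r1 r10 r1P] /contP cN; apply/contP => e e0.
pose k := `|n t x| + 1.
have k0 : 0 < k by rewrite ltr_wpDl.
have [r2 r20 r2P] := cN _ (divr_gt0 e0 (ltr0Sn R 1)).
pose r3 := Num.min r (Num.min r1 r2).
have r30 : 0 < r3 by rewrite !lt_min r0 r10.
exists (Num.min r3 (e / 2 / k)); first by rewrite lt_min r30/= !divr_gt0.
move=> [s y]; rewrite lt_min => /andP[]; rewrite !prod_norm_lt/=.
move=> /andP[sr yr] /andP[_ ye].
have /and3P[sr0 sr1 sr2] : [&& `|s - t| < r, `|s - t| < r1 & `|s - t| < r2].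
  by move: sr; rewrite !lt_min.
have H1 : `|N s y - N s x| <= k * `|y - x|.
  have := @mvt_remainder _ (N s) (n s) x r3 0 k.
  move=> /(_ _ _ (y - x) yr); rewrite mulr0 subr0 (addrC x) subrK; apply.
    by move=> y'; rewrite lt_min => /andP[? _]; exact: DN.
  move=> y'; rewrite !lt_min subr0 => /and3P[_ yr1 _].
  have : `|n s y' - n t x| < 1 by apply: (r1P (s, y')); rewrite prod_norm_lt/= sr1.
  have := ler_distD 0 (n s y') (n t x); rewrite /k.
  have := ler_normD (n s y' - n t x) (n t x); rewrite subrK; lra.
have H2 := r2P s sr2.
rewrite (_ : N s y - N t x = (N s y - N s x) + (N s x - N t x)); last by ring.
rewrite (le_lt_trans (ler_normD _ _))//.
move: ye; rewrite ltr_pdivlMr// mulrC => ye.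
by rewrite (splitr e) ltrD// (le_lt_trans H1).
Qed.

(* Locally uniformly compact momentum support. *)
Definition lucs (f : R -> phase -> R) := forall T L : R, exists2 P : R, 0 <= P &
  forall (t x : R) (p : mom), 0 <= t <= T -> `|x| <= L -> P < `|p| ->
    f t (x, p) = 0.

(** Built on [ext], hence meaningful and continuous for all real times; this allows time integrals
    to start before 0. *)
Definition dens (f : R -> phase -> R) (t x : R) := momI (fun p => ext f t (x, p)).
Definition cur (v : mom -> R) (f : R -> phase -> R) (t x : R) :=
  momI (fun p => v p * ext f t (x, p)).
Definition dcur (v : mom -> R) (f : R -> phase -> R) (t x : R) :=
  momI (fun p => v p * dx (ext f t) (x, p)).

Lemma cont_slice_mom (u : R -> phase -> R) (t x : R) :
  continuous (fun w : R * phase => u w.1 w.2) -> continuous (fun p => u t (x, p)).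
Proof.
move=> cu; have := @cont_slice R phase u t cu => cut p.
apply/contP => e e0; have /contP/(_ _ e0)[r r0 rP] := cut (x, p).
exists r => // p' pr; apply: (rP (x, p')).
by rewrite prod_norm_lt/= subrr normr0 r0 pr.
Qed.

Lemma cbox_ext (f : R -> phase -> R) (P t x : R) : C1_time f -> 0 <= t ->
  (forall p, P < `|p| -> f t (x, p) = 0) -> cbox P (fun p => ext f t (x, p)).
Proof.
move=> Cf t0 f0; split; first exact: cont_slice_mom (ext_continuous Cf).
by move=> p pP; rewrite extE// f0.
Qed.

Lemma weighted_continuous (u : R -> phase -> R) (v : mom -> R) (P t x r : R) : 0 <= P -> 0 < r ->
  continuous v -> continuous (fun w : R * phase => u w.1 w.2) ->
  (forall s y, `|s - t| < r -> `|y - x| < r -> cbox P (fun p => u s (y, p))) ->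
  {for (t, x), continuous (fun w : R * R => momI (fun p => v p * u w.1 (w.2, p)))}.
Proof.
move=> P0 r0 cv cu HP.
apply: (@momI_continuous _ _ P (fun w p => v p * u w.1 (w.2, p)) (t, x) r) => //.
  by move=> [s y]; rewrite prod_norm_lt/= => /andP[? ?]; apply: cboxM => //; exact: HP.
move=> p; apply: cvgM; last exact: (cont_assoc cu).
by apply: (@continuous_comp _ _ _ (fun w : (R * R) * mom => w.2) v); [exact: cvg_snd|exact: cv].
Qed.

Section species.
Variable f : R -> phase -> R.
Hypotheses (Cf : C1_time f) (Lf : lucs f).

Lemma lucs_local (t x : R) : exists2 P : R, 0 <= P &
  forall s y p, `|s - t| < 1 -> `|y - x| < 1 -> P < `|p| -> ext f s (y, p) = 0.
Proof.
have [P P0 HP] := Lf (`|t| + 1) (`|x| + 1); exists P => // s y p st yx pP.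
apply: HP => //.
  rewrite le_max lexx ge_max addr_ge0//= -lerBlDr.
  have := ler_dist_dist s t; have := ler_norm s; have := ler_norm (`|s| - `|t|); lra.
have := ler_norm (`|y| - `|x|); have := ler_dist_dist y x; lra.
Qed.

Lemma cbox_local (t x : R) : exists2 P : R, 0 <= P &
  forall s y, `|s - t| < 1 -> `|y - x| < 1 -> cbox P (fun p => ext f s (y, p)).
Proof.
have [P P0 HP] := lucs_local t x; exists P => // s y st yx; split.
  exact: cont_slice_mom (ext_continuous Cf).
by move=> p; exact: HP.
Qed.

Lemma derive_zero (V : normedModType R) (g : V -> R) (z v : V) (r : R) : 0 < r ->
  (forall z', `|z' - z| < r -> g z' = 0) -> is_derive z v g 0.
Proof.
move=> r0 g0; apply/is_deriveP => e e0; exists (r / (`|v| + 1)).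
  by rewrite divr_gt0// ltr_wpDl.
move=> h; rewrite ltr_pdivlMr ?ltr_wpDl// => hr.
rewrite !g0 ?subrr ?normr0 // ?mulr0 ?subrr ?normr0 ?mulr_ge0 ?(ltW e0)//.
rewrite addrAC subrr add0r normrZ; apply: le_lt_trans hr.
by rewrite ler_wpM2l// lerDl.
Qed.

(** Vanishing of the derivative is read off from vanishing of [f] on a neighbourhood; the radius in
    [y] is halved to leave room for that neighbourhood within the range of [lucs_local]. *)
Lemma cbox_local_dir (v : phase) (t x : R) : 0 <= t -> exists2 P : R, 0 <= P &
  forall s y, `|s - t| < 1 -> `|y - x| < 2^-1 ->
    cbox P (fun p => 'D_v (ext f s) (y, p)).
Proof.
move=> t0; have [P P0 HP] := lucs_local t x; exists P => // s y st yx; split.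
  exact: (@cont_slice_mom (fun t => 'D_v (ext f t)) s y (@ext_dir_cont _ _ f v Cf)).
move=> p pP; have pP0 : 0 < Num.min (`|p| - P) 2^-1.
  by rewrite lt_min subr_gt0 pP invr_gt0 ltr0n.
suff H : is_derive (y, p) v (ext f s) 0 by exact: (@derive_val _ _ _ _ _ _ _ H).
apply: derive_zero pP0 _ => -[y' p']; rewrite lt_min !prod_norm_lt/=.
move=> /andP[/andP[_ pp] /andP[yy _]]; apply: HP => //.
  rewrite (_ : y' - x = (y' - y) + (y - x)); last by ring.
  by rewrite (le_lt_trans (ler_normD _ _))//; lra.
have pp' : `|p' - p| < `|p| - P by rewrite prod_norm_lt.
have := ler_norm (`|p| - `|p'|); have := ler_dist_dist p p'.
by rewrite (distrC p p'); lra.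
Qed.

Lemma dens_continuous : continuous (fun w : R * R => dens f w.1 w.2).
Proof.
move=> [t x]; have [P P0 HP] := cbox_local t x.
apply: (@momI_continuous _ _ P (fun w p => ext f w.1 (w.2, p)) (t, x) 1) => //.
  by move=> [s y]; rewrite prod_norm_lt/= => /andP[]; exact: HP.
by move=> p; apply: (cont_assoc (ext_continuous Cf)).
Qed.

Lemma cur_continuous (v : mom -> R) : continuous v ->
  continuous (fun w : R * R => cur v f w.1 w.2).
Proof.
move=> cv [t x]; have [P P0 HP] := cbox_local t x.
exact: (weighted_continuous P0 ltr01 cv (ext_continuous Cf) HP).
Qed.

Lemma dcur_continuous (v : mom -> R) (t x : R) : 0 <= t -> continuous v ->
  {for (t, x), continuous (fun w : R * R => dcur v f w.1 w.2)}.
Proof.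
move=> t0 cv; have [P P0 HP] := cbox_local_dir (1, (0, 0)) x t0.
have r0 : 0 < (2^-1 : R) by rewrite invr_gt0 ltr0n.
have cu := @ext_dir_cont _ _ f (1, (0, 0)) Cf.
apply: (@weighted_continuous (fun t => dx (ext f t)) v P t x _ P0 r0 cv cu) => s y st yx.
by apply: HP => //; lra.
Qed.

Lemma cur_derive (v : mom -> R) (t x : R) : 0 <= t -> continuous v ->
  is_derive x 1 (cur v f t) (dcur v f t x).
Proof.
move=> t0 cv; have [P P0 HP] := cbox_local t x.
have [P' P'0 HP'] := cbox_local_dir (1, (0, 0)) x t0.
have r0 : 0 < (2^-1 : R) by rewrite invr_gt0 ltr0n.
have tt : `|t - t| < 1 by rewrite subrr normr0.
pose Q := Num.max P P'.
have [PQ P'Q] : P <= Q /\ P' <= Q by rewrite !le_max !lexx orbT.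
apply: (@momI_derive _ Q (fun y p => v p * ext f t (y, p))
   (fun y p => v p * dx (ext f t) (y, p)) x (2^-1)) => //.
- exact: le_trans PQ.
- move=> s sx; apply: cboxM => //; apply: cboxW PQ _; apply: HP => //; lra.
- by apply: cboxM => //; apply: cboxW P'Q _; apply: HP' => //; rewrite subrr normr0.
- move=> s p _; have [_ Dv _ _ _] := Cf.
  have /derivableP D := Dv t (s, p) (1, (0, 0)) t0.
  suff : is_derive s 1 (fun y => ext f t (y, p)) (dx (ext f t) (s, p)).
    by move=> D1; exact: (is_deriveZ (v p) D1).
  rewrite extE//; apply: (is_derive_transfer _ D) => h.
  by congr (f t (_, _)); rewrite /= scaler0 addr0.
- move=> p; apply: cvgM.
    by apply: (@continuous_comp _ _ _ (fun w : R * mom => w.2) v); [exact: cvg_snd|exact: cv].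
  have := @cont_slice _ _ (fun t => dx (ext f t)) t (@ext_dir_cont _ _ f (1, (0, 0)) Cf).
  by rewrite (_ : (fun w : R * mom => dx (ext f t) (w.1, w.2)) = dx (ext f t)); [exact|apply/funext => -[]].
Qed.

Lemma dens_derive_dt (t x : R) : 0 < t -> exists2 P : R, 0 <= P &
  cbox P (fun p => dt (f ^~ (x, p)) t) /\
  is_derive t 1 (dens f ^~ x) (momI (fun p => dt (f ^~ (x, p)) t)).
Proof.
move=> t0; have [P P0 HP] := cbox_local t x; exists P => //.
have [_ _ _ cdt _] := Cf.
have ct p : {for (t, p), continuous (fun w : R * mom => dt (f ^~ (x, w.2)) w.1)}.
  apply/contP => e e0.
  have [|r r0 rP] := withinP cdt (w := (t, (x, p))) _ e0; first exact: ltW.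
  exists (Num.min r t); first by rewrite lt_min r0.
  move=> [s p']; rewrite lt_min !prod_norm_lt/= => /andP[/andP[sr pr] /andP[st _]].
  apply: (rP (s, (x, p'))) => /=.
    by move/ltr_normlP : st => [+ _]; lra.
  by rewrite !prod_norm_lt/= sr subrr normr0 r0 pr.
have B : cbox P (fun p => dt (f ^~ (x, p)) t).
  split.
    move=> p; apply/contP => e e0; have /contP/(_ _ e0)[r r0 rP] := ct p.
    by exists r => // p' pr; apply: (rP (t, p')); rewrite prod_norm_lt/= subrr normr0 r0.
  move=> p pP; have D0 : is_derive t 1 (fun s => ext f s (x, p)) 0.
    apply: (derive_zero _ ltr01) => s st.
    have xx : `|x - x| < 1 by rewrite subrr normr0.
    by have [_ ->] := HP s x st xx.
  by rewrite -(@derive_val _ _ _ _ _ _ _ D0) (@derive_val _ _ _ _ _ _ _ (ext_dt (x, p) Cf t0)).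
split => //.
apply: (@momI_derive _ P (fun s p => ext f s (x, p)) (fun s p => dt (f ^~ (x, p)) s) t (Num.min 1 t)) => //.
- by rewrite lt_min ltr01.
- by move=> s; rewrite lt_min => /andP[st _]; apply: HP => //; rewrite subrr normr0.
- move=> s p; rewrite lt_min => /andP[_ /ltr_normlP[st _]]; apply: ext_dt => //; lra.
Qed.

(** Adding and subtracting [dv * g], with [g] the value of [f], turns the two magnetic terms into
    momentum derivatives of [vel2 * f] and [vel1 * f]. *)
Lemma material_divergence (d v v' dv x y z q a b h g : R) :
  d + v * x + q * (a + v' * h) * y + q * (b - v * h) * z = 0 ->
  d = - 1 * (v * x) - (q * a * y + q * b * z
       + q * h * ((v' * y + dv * g) - (v * z + dv * g))).
Proof. by move=> E; lra. Qed.

Lemma momI_divergence S (u1 u2 u3 u4 u5 : mom -> R) (a b c : R) : 0 <= S ->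
  cbox S u1 -> cbox S u2 -> cbox S u3 -> cbox S u4 -> cbox S u5 ->
  momI u2 = 0 -> momI u3 = 0 -> momI u4 = 0 -> momI u5 = 0 ->
  momI (fun p => - 1 * u1 p - (a * u2 p + b * u3 p + c * (u4 p - u5 p))) =
  - momI u1.
Proof.
move=> S0 B1 B2 B3 B4 B5 Z2 Z3 Z4 Z5.
have B45 := cboxB B4 B5; have Ba := cboxZ a B2; have Bb := cboxZ b B3.
have Bc := cboxZ c B45; have Bab := cboxD Ba Bb.
rewrite (momIB S0 (cboxZ (- 1) B1) (cboxD Bab Bc)) (momID S0 Bab Bc) (momID S0 Ba Bb).
rewrite (momIZ _ S0 B1) (momIZ _ S0 B2) (momIZ _ S0 B3) (momIZ _ S0 B45) (momIB S0 B4 B5).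
by rewrite Z2 Z3 Z4 Z5; ring.
Qed.

(** The continuity equation. After integration over momenta every force term is a momentum
    derivative of a compactly supported function and drops out. *)
Lemma dens_derive k m q (E1 E2 H : R -> R -> R) (t x : R) : 0 <= k -> 0 < m ->
  (forall (t : R) (z : phase), 0 < t -> material k m q E1 E2 H f t z = 0) ->
  0 < t -> is_derive t 1 (dens f ^~ x) (- dcur (vel1 k m) f t x).
Proof.
move=> k0 m0 vf t0; have [P P0 [B D]] := dens_derive_dt x t0.
have t0' := ltW t0; have [_ Dv _ _ _] := Cf.
have [Q Q0 HQ] := cbox_local t x.
have [Px Px0 HPx] := cbox_local_dir (1, (0, 0)) x t0'.
have [P1 P10 HP1] := cbox_local_dir (0, (1, 0)) x t0'.
have [P2 P20 HP2] := cbox_local_dir (0, (0, 1)) x t0'.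
pose S := Num.max P (Num.max Q (Num.max Px (Num.max P1 P2))).
have [PS QS PxS P1S P2S] : [/\ P <= S, Q <= S, Px <= S, P1 <= S & P2 <= S].
  by rewrite !le_max !lexx !orbT.
have S0 : 0 <= S by exact: le_trans PS.
have tt : `|t - t| < 1 by rewrite subrr normr0.
have xx : `|x - x| < 1 by rewrite subrr normr0.
have xx2 : `|x - x| < 2^-1 by rewrite subrr normr0 invr_gt0 ltr0n.
have cv1 := @continuous_vel1 R k m k0 m0.
have cv2 := @continuous_vel2 R k m k0 m0.
have cdv := @continuous_dvel R k m k0 m0.
have B0 := cboxW PS B.
have Bf := cboxW QS (HQ t x tt xx).
have Bx := cboxW PxS (HPx t x tt xx2).
have B1 := cboxW P1S (HP1 t x tt xx2).
have B2 := cboxW P2S (HP2 t x tt xx2).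
rewrite !extE// in Bf Bx B1 B2.
have Bvx := cboxM cv1 Bx.
have Dp1 (p : mom) : is_derive p (1, 0) (fun p => f t (x, p)) (dp1 (f t) (x, p)).
  have /derivableP Dp := Dv t (x, p) (0, (1, 0)) t0'.
  by apply: (is_derive_transfer _ Dp) => h; congr (f t (_, _)); rewrite /= scaler0 addr0.
have Dp2 (p : mom) : is_derive p (0, 1) (fun p => f t (x, p)) (dp2 (f t) (x, p)).
  have /derivableP Dp := Dv t (x, p) (0, (0, 1)) t0'.
  by apply: (is_derive_transfer _ Dp) => h; congr (f t (_, _)); rewrite /= scaler0 addr0.
have Z1 : momI (fun p => dp1 (f t) (x, p)) = 0 by exact: momI_dp1 S0 Bf B1 Dp1.
have Z2 : momI (fun p => dp2 (f t) (x, p)) = 0 by exact: momI_dp2 S0 Bf B2 Dp2.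
pose g1 p := vel2 k m p * dp1 (f t) (x, p) + dvel k m p * f t (x, p).
pose g2 p := vel1 k m p * dp2 (f t) (x, p) + dvel k m p * f t (x, p).
have Bg1 : cbox S g1 := cboxD (cboxM cv2 B1) (cboxM cdv Bf).
have Bg2 : cbox S g2 := cboxD (cboxM cv1 B2) (cboxM cdv Bf).
have Z3 : momI g1 = 0.
  apply: (momI_dp1 S0 (cboxM cv2 Bf) Bg1) => p.
  apply: (is_derive_eq (is_deriveM (is_derive_vel2 p k0 m0) (Dp1 p))).
  by rewrite /GRing.scale/= /g1; ring.
have Z4 : momI g2 = 0.
  apply: (momI_dp2 S0 (cboxM cv1 Bf) Bg2) => p.
  apply: (is_derive_eq (is_deriveM (is_derive_vel1 p k0 m0) (Dp2 p))).
  by rewrite /GRing.scale/= /g2; ring.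
apply: (is_derive_eq D).
have -> : (fun p => dt (f ^~ (x, p)) t) = (fun p => - 1 * (vel1 k m p * dx (f t) (x, p))
    - (q * E1 t x * dp1 (f t) (x, p) + q * E2 t x * dp2 (f t) (x, p)
       + q * H t x * (g1 p - g2 p))).
  apply/funext => p; have := vf t (x, p) t0.
  exact: material_divergence.
rewrite (momI_divergence _ _ _ S0 Bvx B1 B2 Bg1 Bg2 Z1 Z2 Z3 Z4).
by rewrite /dcur extE.
Qed.

Lemma segment_integrable (g : R -> R) (a b : R) : continuous g ->
  leb.-integrable `[a, b] (EFin \o g).
Proof.
move=> cg; apply: continuous_compact_integrable; first exact: segment_compact.
exact: continuous_subspaceT.
Qed.

Lemma segment_FTC1 (g : R -> R) (a x : R) : continuous g -> a < x ->
  is_derive x 1 (fun x => \int[leb]_(y in `[a, x]) g y) (g x).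
Proof.
move=> cg ax; have xx : x < x + 1 by lra.
have [D E] := continuous_FTC1_closed xx (@segment_integrable g a (x + 1) cg) ax (cg x).
by split; [exact: D|rewrite -derive1E].
Qed.

Lemma segment_FTC2 (g dg : R -> R) (a b : R) : a < b -> continuous dg ->
  (forall x : R, is_derive x 1 g (dg x)) ->
  \int[leb]_(y in `[a, b]) dg y = g b - g a.
Proof.
move=> ab cdg D.
have cg : continuous g by move=> x; exact: is_derive_continuous (D x).
rewrite /Rintegral (@continuous_FTC2 _ _ g)//.
- exact: continuous_subspaceT.
- split.
  + by move=> x _; exact: (@ex_derive _ _ _ _ _ _ _ (D x)).
  + by apply: cvg_at_right_filter; exact: cg.
  + by apply: cvg_at_left_filter; exact: cg.
- by move=> x _; rewrite derive1E (@derive_val _ _ _ _ _ _ _ (D x)).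
Qed.

Lemma segment_bound (g : R -> R) (a b M : R) : a <= b -> continuous g ->
  (forall y, `[a, b]%classic y -> `|g y| <= M) ->
  `|\int[leb]_(y in `[a, b]) g y| <= (b - a) * M.
Proof.
move=> ab cg gM; have I := @segment_integrable g a b cg.
apply: (le_trans (le_normr_Rintegral _ I)) => //.
have -> : (b - a) * M = \int[leb]_(y in `[a, b]) M.
  rewrite Rintegral_cst//= lebesgue_measure_itv/= lte_fin.
  case: ifPn => [_|]; first by rewrite -EFinB /= mulrC.
  by rewrite -leNgt => ba; rewrite (_ : b = a) ?subrr ?mul0r ?mulr0//; lra.
apply: le_Rintegral => //.
- exact: (integrable_abse I).
- by apply: segment_integrable => y; exact: cvg_cst.
Qed.

Section param_segment.
Variables (a b : R).
Hypothesis ab : a <= b.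

Lemma segment_param_derive (G dG : R -> R -> R) (t r : R) : 0 < r ->
  (forall s, `|s - t| < r -> continuous (G s)) -> continuous (dG t) ->
  (forall s y, `|s - t| < r -> is_derive s 1 (G ^~ y) (dG s y)) ->
  (forall y, {for (t, y), continuous (fun w : R * R => dG w.1 w.2)}) ->
  is_derive t 1 (fun s => \int[leb]_(y in `[a, b]) G s y)
    (\int[leb]_(y in `[a, b]) dG t y).
Proof.
move=> r0 cG cdG D cd.
apply: (@param_derive R R `[a, b]%classic (fun g => \int[leb]_(y in `[a, b]) g y)
   (fun g => continuous g) (b - a) _ _ _ _ _ _ _ G dG t r) => //.
- exact: segment_compact.
- by rewrite subr_ge0.
- by move=> g h cg ch y; apply: cvgB; [exact: cg|exact: ch].
- by move=> k g cg y; apply: cvgM; [exact: cvg_cst|exact: cg].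
- by move=> g h cg ch; rewrite RintegralB//; exact: segment_integrable.
- by move=> k g cg; rewrite RintegralZl//; exact: segment_integrable.
- by move=> g M cg; exact: segment_bound.
- by move=> s y sr _; exact: D.
Qed.

Lemma segment_param_continuous (G : R -> R -> R) (t : R) :
  (forall s, continuous (G s)) ->
  (forall y, {for (t, y), continuous (fun w : R * R => G w.1 w.2)}) ->
  {for t, continuous (fun s => \int[leb]_(y in `[a, b]) G s y)}.
Proof.
move=> cG cd.
apply: (@param_continuous R R `[a, b]%classic (fun g => \int[leb]_(y in `[a, b]) g y)
   (fun g => continuous g) (b - a) _ _ _ _ _ R G t 1) => //.
- exact: segment_compact.
- by rewrite subr_ge0.
- by move=> g h cg ch y; apply: cvgB; [exact: cg|exact: ch].
- by move=> g h cg ch; rewrite RintegralB//; exact: segment_integrable.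
- by move=> g M cg; exact: segment_bound.
Qed.

End param_segment.

(* [N] is a potential of the continuity equation [n_t + j_x = 0]. *)
Lemma mass_potential k m q (E1 E2 H : R -> R -> R) (L : R) : 0 <= k -> 0 < m ->
  (forall (t : R) (z : phase), 0 < t -> material k m q E1 E2 H f t z = 0) ->
  exists N : R -> R -> R,
  [/\ forall t x : R, 0 <= t -> `|x| < L ->
        {for (t, x), continuous (fun w : R * R => N w.1 w.2)},
      forall t x : R, `|x| < L -> is_derive x 1 (N t) (dens f t x) &
      forall t x b : R, 0 < t -> `|x| < L ->
        is_derive t 1 (fun s => N s (x + (s - t) * b))
          (b * dens f t x - cur (vel1 k m) f t x)].
Proof.
move=> k0 m0 vf; pose a := - L - 1.
have La x : `|x| < L -> a < x by rewrite /a ltr_norml => /andP[]; lra.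
have cv := @continuous_vel1 R k m k0 m0.
pose J := cur (vel1 k m) f.
have cn := dens_continuous.
have cnt t : continuous (dens f t) := @cont_slice _ _ (dens f) t cn.
have cJ0 := cur_continuous cv.
have cJ (x : R) : continuous (J ^~ x) := @cont_slicel _ _ J x cJ0.
(* The second integral is the flux through the left end [a]; it cancels the boundary term at [a] in
   the time derivative of the first. It starts at [-1] so that [t = 0] lies strictly beyond its
   lower end. *)
pose N t x := \int[leb]_(y in `[a, x]) dens f t y - \int[leb]_(s in `[-1, t]) J s a.
have Nx (t x : R) : `|x| < L -> is_derive x 1 (N t) (dens f t x).
  move=> /La ax; have D := segment_FTC1 (cnt t) ax.
  have := is_deriveB D (is_derive_cst (\int[leb]_(s in `[-1, t]) J s a) x 1).
  by rewrite subr0.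
have m1 (t : R) : 0 <= t -> -1 < t by lra.
have DJ (t : R) : 0 <= t ->
    is_derive t 1 (fun t => \int[leb]_(s in `[-1, t]) J s a) (J t a).
  by move=> /m1 t1; exact: segment_FTC1.
have Nt (t x : R) : 0 < t -> `|x| < L ->
    is_derive t 1 (N ^~ x) (- cur (vel1 k m) f t x).
  move=> t0 /La ax; have t0' := ltW t0.
  have cd y : {for (t, y), continuous (fun w : R * R => - dcur (vel1 k m) f w.1 w.2)}.
    by apply: cvgN; exact: dcur_continuous.
  have cdt : continuous (fun y => dcur (vel1 k m) f t y).
    move=> y; have /contP H1 := @dcur_continuous _ t y t0' cv; apply/contP => e e0.
    have [r r0 rP] := H1 e e0; exists r => // y' yr; apply: (rP (t, y')).
    by rewrite prod_norm_lt/= subrr normr0 r0.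
  have cdt' : continuous (fun y => - dcur (vel1 k m) f t y).
    by move=> y; apply: cvgN; exact: cdt.
  have Ds (s y : R) : `|s - t| < t -> is_derive s 1 (dens f ^~ y) (- dcur (vel1 k m) f s y).
    move=> /ltr_normlP[st _]; have s0 : 0 < s by lra.
    exact: (dens_derive y k0 m0 vf s0).
  have D1 := @segment_param_derive a x (ltW ax) (dens f)
    (fun t y => - dcur (vel1 k m) f t y) t t t0 (fun s _ => cnt s) cdt' Ds cd.
  have D := is_deriveB D1 (DJ t t0').
  apply: (is_derive_eq D).
  have -> : \int[leb]_(y in `[a, x]) - dcur (vel1 k m) f t y =
      - 1 * \int[leb]_(y in `[a, x]) dcur (vel1 k m) f t y.
    rewrite -RintegralZl//; last exact: segment_integrable.
    by apply: eq_Rintegral => y _; rewrite mulN1r.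
  rewrite (segment_FTC2 ax cdt (fun x => cur_derive x t0' cv)) /J.
  by ring.
exists N; split; [|exact: Nx|].
- move=> t x t0 xL; have r0 : 0 < L - `|x| by rewrite subr_gt0.
  have H1 s y : `|s - t| < L - `|x| -> `|y - x| < L - `|x| ->
      is_derive y 1 (N s) (dens f s y).
    move=> _ yx; apply: Nx; have := ler_normD (y - x) x.
    by rewrite subrK; lra.
  apply: (cont_joint r0 H1 (cn (t, x))).
  apply: cvgB.
    exact: (@segment_param_continuous a x (ltW (La _ xL)) (dens f) t cnt (fun y => cn (t, y))).
  exact: is_derive_continuous (DJ t t0).
- move=> t x b t0 xL; have r0 : 0 < L - `|x| by rewrite subr_gt0.
  pose G (w : R * R) := N w.1 w.2.
  have H1 (w' : R * R) : `|w' - (t, x)| < L - `|x| ->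
      is_derive w' (0, b) G (b * dens f w'.1 w'.2).
    rewrite prod_norm_lt /= => /andP[_ yx].
    have yL : `|w'.2| < L by have := ler_normD (w'.2 - x) x; rewrite subrK; lra.
    apply: (is_derive_transfer _ (is_deriveZdir b (Nx w'.1 w'.2 yL))) => h.
    by rewrite /G/= scaler0 addr0 /GRing.scale/= mulr1.
  have H2 : is_derive (t, x) (1, 0) G (- cur (vel1 k m) f t x).
    by apply: (is_derive_transfer _ (Nt t x t0 xL)) => h; rewrite /G/= scaler0 addr0.
  have cG : {for (t, x), continuous (fun w : R * R => b * dens f w.1 w.2)}.
    by apply: cvgM; [exact: cvg_cst|exact: cn].
  have D := is_deriveD_dir r0 H1 cG H2.
  apply: (is_derive_transfer _ D) => h.
  by rewrite /G/= addr0 add0r [t + _ - t]addrAC subrr add0r /GRing.scale/= mulr1.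
Qed.

End species.
End conservation.

(** * Weighted suprema and bounds on compact sets *)

Section weighted_sup.
Context {R : realType}.

(* Gronwall's lemma in the form used here: in a weighted supremum norm, the
   integral inequality is an affine contraction. *)
Lemma contraction_bound (X : Type) (S : set X) (g wt : X -> R) (M a : R) :
  0 <= a -> (forall x, S x -> 0 < wt x) ->
  (forall x, S x -> g x <= M * wt x) ->
  (forall B : R, 0 <= B -> (forall x, S x -> g x <= B * wt x) ->
     forall x, S x -> g x <= (B / 2 + a) * wt x) ->
  forall x, S x -> g x <= (2 * a) * wt x.
Proof.
move=> a0 wt0 gM step x0 Sx0.
pose Y := [set r : R | exists2 x, S x & r = g x / wt x].
have Y0 : Y !=set0 by exists (g x0 / wt x0), x0.
have hY : has_sup Y.
  by split => //; exists M => r [x Sx ->]; rewrite ler_pdivrMr ?wt0//; exact: gM.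
(* [M] makes the supremum finite; its size is then forgotten, because [B <= B / 2 + a] forces
   [B <= 2 * a]. *)
pose B := Num.max 0 (sup Y).
have gB x : S x -> g x <= B * wt x.
  move=> Sx; rewrite -ler_pdivrMr ?wt0//; apply: (@le_trans _ _ (sup Y)).
    by apply: sup_upper_bound => //; exists x.
  by rewrite le_max lexx orbT.
have B0 : 0 <= B by rewrite le_max lexx.
have sY : sup Y <= B / 2 + a.
  apply: ge_sup => // r [x Sx ->]; rewrite ler_pdivrMr ?wt0//.
  exact: step.
have B2a : B <= 2 * a.
  have [s0|s0] := leP (sup Y) 0; first by rewrite /B max_l//; lra.
  by move: sY; rewrite /B max_r ?(ltW s0)//; lra.
apply: (le_trans (gB _ Sx0)); rewrite ler_wpM2r// ltW// wt0//.
Qed.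

Lemma cont_bounded (T : topologicalType) (K : set T) (g : T -> R) :
  compact K -> continuous g -> exists2 M : R, 0 <= M & forall w, K w -> `|g w| <= M.
Proof.
move=> cK cg.
have : compact (g @` K) by apply: continuous_compact => //; exact: continuous_subspaceT.
move=> /compact_bounded[M [_ /(_ (M + 1))]]; rewrite ltrDl ltr01 => /(_ isT) H.
exists `|M + 1| => // w Kw; apply: (le_trans _ (ler_norm _)).
by apply: H; exists w.
Qed.

Lemma ext_rect_bounded (u : R -> R -> R) (T L : R) : C1_time u ->
  exists2 M : R, 0 <= M & forall t x : R, 0 <= t <= T -> `|x| <= L -> `|u t x| <= M.
Proof.
move=> Cu; have cK : compact (`[0, T] `*` `[- L, L]).
  by apply: compact_setX; exact: segment_compact.
have [M M0 MP] := cont_bounded cK (ext_continuous Cu).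
exists M => // t x /andP[t0 tT] xL; have := MP (t, x); rewrite /= extE//; apply.
by split => /=; rewrite in_itv/= ?t0// -ler_norml.
Qed.

End weighted_sup.

(** * Range, momentum support and admissible speeds for one species *)

Section kinetic.
Context {R : realType}.
Local Notation mom := (R * R)%type.
Local Notation phase := (R * mom)%type.

Lemma is_derive_cst0 (V : normedModType R) (k : R) (z v : V) :
  is_derive z v (fun _ => k) 0.
Proof. exact: is_derive_cst. Qed.

Section one_species.
Variables (k m q : R) (E1 E2 H : R -> R -> R) (f : R -> phase -> R).
Hypotheses (Cf : C1_time f).
Hypothesis vf : forall (t : R) (z : phase), 0 < t -> material k m q E1 E2 H f t z = 0.

Lemma vlasov_near_cst (l K w t r b : R) (z : phase) :
  0 < l -> 0 < K -> 0 <= w -> 0 <= t -> slow k m q E1 E2 H l K w t z ->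
  (forall y, domain l K w t z y -> y.1 = 0 -> `|f 0 y.2 - b| <= r) ->
  `|f t z - b| <= r.
Proof.
move=> l0 K0 w0 t0 sl init.
apply: (@vlasov_compare _ k m q E1 E2 H f (fun _ => b) (fun _ => r) (fun _ => 0) l K w t z) => //.
- by move=> y; exact: cvg_cst.
- by move=> y; exact: cvg_cst.
- by move=> y _ _; exists 0; [rewrite normr0|exact: is_derive_cst0].
Qed.

(** The interval from 0 to [M] is the ball of radius [M / 2] about [M / 2], and comparison with a
    constant preserves such balls. *)
Lemma vlasov_range (l K w t M : R) (z : phase) :
  0 < l -> 0 < K -> 0 <= w -> 0 <= t -> slow k m q E1 E2 H l K w t z ->
  (forall z, 0 <= f 0 z <= M) -> 0 <= f t z <= M.
Proof.
move=> l0 K0 w0 t0 sl init.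
have : `|f t z - M / 2| <= M / 2.
  apply: vlasov_near_cst l0 K0 w0 t0 sl _ => y _ _.
  by have /andP[? ?] := init y.2; rewrite ler_norml; apply/andP; split; lra.
by rewrite ler_norml => /andP[? ?]; apply/andP; split; lra.
Qed.

(** Comparison with the constant 0 at radius 0: the backward domain of [z] reaches time 0 entirely
    outside the initial momentum support. *)
Lemma vlasov_support (l K w t Q : R) (z : phase) :
  0 < l -> 0 < K -> 0 <= w -> 0 <= t -> slow k m q E1 E2 H l K w t z ->
  (forall x (p : mom), Q <= enorm p -> f 0 (x, p) = 0) ->
  Q + K / l * expR (l * t) <= `|z.2| -> f t z = 0.
Proof.
move=> l0 K0 w0 t0 sl init Qz.
have : `|f t z - 0| <= 0.
  apply: (vlasov_near_cst l0 K0 w0 t0 sl) => y [_ _ y1 y2] _.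
  rewrite (surjective_pairing y.2) init ?subrr ?normr0//.
  apply: le_trans (norm_le_enorm _).
  have pK := prad_le t y.1 l0 (ltW K0).
  have : `|z.2 - y.2.2| <= K / l * expR (l * t).
    by rewrite prod_normE ge_max/= !(distrC z.2.1) !(distrC z.2.2) (le_trans y1)// (le_trans y2).
  have := ler_normD (z.2 - y.2.2) y.2.2; rewrite subrK; lra.
by rewrite subr0 normr_le0 => /eqP.
Qed.

End one_species.

Lemma domain_mom (l K w t : R) (z : phase) y : 0 < l -> 0 <= K ->
  domain l K w t z y -> `|y.2.2| <= `|z.2| + K / l * expR (l * t).
Proof.
move=> l0 K0 [_ _ y1 y2]; have pK := prad_le t y.1 l0 K0.
have : `|y.2.2 - z.2| <= K / l * expR (l * t).
  by rewrite prod_normE ge_max/= (le_trans y1)// (le_trans y2).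
have := ler_normD (y.2.2 - z.2) z.2; rewrite subrK; lra.
Qed.

(** Both velocity components are at most [c], so the magnetic force is at most [|B|] whatever the
    momentum, and [c] itself is an admissible spatial speed. *)
Lemma slow_RVM (c m q : R) (E1 E2 B : R -> R -> R) (b : R -> R) (l K w t : R) (z : phase) :
  0 < c -> 0 < m -> c <= w ->
  (forall y, domain l K w t z y -> 0 < y.1 ->
     `|E1 y.1 y.2.1| + `|E2 y.1 y.2.1| + `|B y.1 y.2.1| <= b y.1) ->
  (forall s, 0 < s <= t -> `|q| * b s < K * expR (l * s)) ->
  slow (c ^- 2) m q E1 E2 (fun t x => c^-1 * B t x) l K w t z.
Proof.
move=> c0 m0 cw bE bK y Dy y0; have H := bE y Dy y0.
have yt : 0 < y.1 <= t by case: Dy => /andP[_ ->]; rewrite y0.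
have red (v : R) : `|v| <= c -> `|v * (c^-1 * B y.1 y.2.1)| <= `|B y.1 y.2.1|.
  move=> vc; rewrite mulrA normrM ler_piMl// normrM normfV (gtr0_norm c0).
  by rewrite ler_pdivrMr// mul1r.
have h1 := red _ (vel1_lt_c y.2.2 c0 m0).
have h2 := red _ (vel2_lt_c y.2.2 c0 m0).
split; first exact: le_trans (vel1_lt_c _ c0 m0) cw.
- apply: le_lt_trans (bK _ yt); rewrite normrM ler_wpM2l//.
  by apply: le_trans H; apply: (le_trans (ler_normD _ _)); have := normr_ge0 (E2 y.1 y.2.1); lra.
- apply: le_lt_trans (bK _ yt); rewrite normrM ler_wpM2l//.
  by apply: le_trans H; apply: (le_trans (ler_normB _ _)); have := normr_ge0 (E1 y.1 y.2.1); lra.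
Qed.

(** Classical velocities are unbounded, so the spatial speed [w] has to depend on the momentum of
    [z] and on how far the domain extends in momentum. *)
Lemma slow_VP (m q M : R) (E1 : R -> R -> R) (l K w t : R) (z : phase) :
  0 < m -> 0 < l -> 0 <= K -> (`|z.2| + K / l * expR (l * t)) / m <= w ->
  (forall s x, 0 <= s <= t -> `|E1 s x| <= M) -> `|q| * M < K ->
  slow 0 m q E1 (fun _ _ => 0) (fun _ _ => 0) l K w t z.
Proof.
move=> m0 l0 K0 zw EM qK y Dy y0.
have yt : 0 <= y.1 <= t by case: Dy.
have e1 := expRM_ge1 (ltW l0) (ltW y0).
have K00 : 0 < K.
  apply: le_lt_trans qK; rewrite mulr_ge0//.
  by apply: le_trans (EM y.1 0 yt); exact: normr_ge0.
have Ke : K <= K * expR (l * y.1) by rewrite ler_peMr// ltW.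
split.
- apply: le_trans (over_gam_le _ _ _ _) _ => //; apply: le_trans zw.
  rewrite ler_wpM2r ?invr_ge0 ?(ltW m0)//; apply: le_trans (domain_mom l0 K0 Dy).
  by rewrite prod_normE le_max lexx.
- rewrite /force1 mulr0 addr0 normrM; apply: lt_le_trans Ke.
  by apply: le_lt_trans qK; rewrite ler_wpM2l// EM.
- by rewrite /force2 mulr0 subr0 mulr0 normr0; apply: lt_le_trans Ke.
Qed.

(** At speed [c] the domains stay over [|x| <= L + c * T], where continuous fields are bounded. The
    resulting [K] depends on [c] and [L], so this gives qualitative information only. *)
Lemma slow_RVM_exists (c m q : R) (E1 E2 B : R -> R -> R) (T L : R) :
  0 < c -> 0 < m -> C1_time E1 -> C1_time E2 -> C1_time B ->
  exists2 K : R, 0 < K & forall (t x : R) (p : mom), 0 <= t <= T -> `|x| <= L ->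
  slow (c ^- 2) m q E1 E2 (fun t x => c^-1 * B t x) 1 K c t (x, p).
Proof.
move=> c0 m0 C1 C2 CB.
have [M1 M10 H1] := ext_rect_bounded T (L + c * T) C1.
have [M2 M20 H2] := ext_rect_bounded T (L + c * T) C2.
have [M3 M30 H3] := ext_rect_bounded T (L + c * T) CB.
pose K := `|q| * (M1 + M2 + M3) + 1.
have K0 : 0 < K by rewrite ltr_wpDl// mulr_ge0// !addr_ge0.
exists K => // t x p /andP[t0 tT] xL.
apply: (@slow_RVM c m q E1 E2 B (fun _ => M1 + M2 + M3)) => //.
- move=> y [/andP[y0 yt] yx _ _] _; have yT : 0 <= y.1 <= T by rewrite y0 (le_trans yt).
  have yL : `|y.2.1| <= L + c * T.
    have ct : c * (t - y.1) <= c * T by rewrite ler_wpM2l ?(ltW c0)//; lra.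
    by have := ler_normD (y.2.1 - x) x; rewrite subrK; move: yx => /=; lra.
  by rewrite !lerD// ?H1 ?H2 ?H3.
- move=> s /andP[s0 _]; rewrite mul1r.
  have e1 : 1 <= expR s by rewrite -expR0 ler_expR ltW.
  apply: (@lt_le_trans _ _ K); first by rewrite /K ltrDl.
  by rewrite ler_peMr// ltW.
Qed.

Lemma lucs_RVM (c m q Q : R) (E1 E2 B : R -> R -> R) (f : R -> phase -> R) :
  0 < c -> 0 < m -> 0 <= Q -> C1_time f -> C1_time E1 -> C1_time E2 -> C1_time B ->
  (forall (t : R) (z : phase), 0 < t ->
     material (c ^- 2) m q E1 E2 (fun t x => c^-1 * B t x) f t z = 0) ->
  (forall x (p : mom), Q <= enorm p -> f 0 (x, p) = 0) -> lucs f.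
Proof.
move=> c0 m0 Q0 Cf C1 C2 CB vf init T L.
have [K K0 HK] := slow_RVM_exists q T L c0 m0 C1 C2 CB.
exists (Q + K * expR T); first by rewrite addr_ge0// mulr_ge0 ?expR_ge0// ltW.
move=> t x p tT xL pP; have /andP[t0 tT'] := tT.
apply: (vlasov_support Cf vf ltr01 K0 (ltW c0) t0 (HK t x p tT xL) init) => /=.
rewrite divr1 mul1r; apply/ltW/(le_lt_trans _ pP).
by rewrite lerD2l ler_wpM2l ?(ltW K0)// ler_expR.
Qed.

End kinetic.

(** * Integrals over half lines and the field they define *)

Section half_lines.
Context {R : realType}.
Local Notation leb := (@lebesgue_measure R).
Variable rho : R -> R.
Hypotheses (crho : continuous rho) (irho : leb.-integrable setT (EFin \o rho)).

Lemma half_line_integrable (i : interval R) :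
  leb.-integrable [set` i] (EFin \o rho).
Proof. by apply: integrableS irho. Qed.

Lemma tail_integral (F : nat -> interval R) :
  (forall x, \forall n \near \oo, x \notin F n) ->
  forall eps : R, 0 < eps -> \forall n \near \oo,
    `|\int[leb]_(x in [set` F n]) rho x| <= eps.
Proof.
move=> FN eps eps0.
pose g n : R -> \bar R := (EFin \o rho) \_ [set` F n].
have mrho := measurable_int _ irho.
have mg n : measurable_fun setT (g n).
  apply/(measurable_restrict _ _ _) => //.
  by apply: measurable_funS mrho.
have gcv : {ae leb, forall x, setT x -> g ^~ x @ \oo --> (cst 0%E) x}.
  apply: aeW => x _ /=; apply: cvg_near_cst.
  have := FN x; apply: filterS => n xF; rewrite /g patchE.
  by rewrite (_ : x \in _ = false)//; apply/negbTE; rewrite notin_setE /=; exact/negP.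
have gdom : {ae leb, forall x n, setT x -> (`|g n x| <= (abse \o (EFin \o rho)) x)%E}.
  apply: aeW => x n _; rewrite /g patchE; case: ifPn => // _.
  by rewrite abse0 /=.
have [_ _ cv] := @dominated_convergence _ _ R leb setT measurableT g (cst 0%E) _
  mg (measurable_cst _) gcv (integrable_abse irho) gdom.
move: cv; rewrite integral0 => /fine_cvgP[_ /cvgrPdist_le/(_ _ eps0)].
apply: filterS => n; rewrite sub0r normrN /=.
by rewrite [X in _ -> `|X| <= _]/Rintegral integral_mkcond.
Qed.

Definition poisson0 (x : R) : R :=
  2 * pi * \int[leb]_(y in `]-oo, x]) rho y - 2 * pi * \int[leb]_(y in `[x, +oo[) rho y.

Lemma split_half_lines (x : R) :
  \int[leb]_(y in `]-oo, x]) rho y + \int[leb]_(y in `[x, +oo[) rho y =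
  \int[leb]_y rho y.
Proof.
rewrite -Rintegral_itv_obnd_cbnd; last exact: half_line_integrable.
have E : [set: R] = `]-oo, x]%classic `|` `]x, +oo[%classic.
  by rewrite -setCitvl setUv.
rewrite [RHS](_ : _ = \int[leb]_(y in `]-oo, x]%classic `|` `]x, +oo[%classic) rho y); last by rewrite -E.
rewrite Rintegral_setU//; first by rewrite -E.
by rewrite -setCitvl; apply/disj_set2P; rewrite setICr.
Qed.

(** The two half lines add up to the total charge, so the field is [4 * pi] times one primitive
    minus a constant. *)
Lemma poisson0_derive (x : R) : is_derive x 1 poisson0 (4 * pi * rho x).
Proof.
have -> : poisson0 = (4 * pi) \*: (fun x => \int[leb]_(y in `]-oo, x]) rho y)
    - cst (2 * pi * \int[leb]_y rho y).
  apply/funext => y; rewrite /poisson0 -(split_half_lines y).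
  rewrite [RHS](_ : _ = (4 * pi) * \int[leb]_(y in `]-oo, y]) rho y - (2 * pi * (\int[leb]_(y in `]-oo, y]) rho y + \int[leb]_(y in `[y, +oo[) rho y)))//.
  ring.
have xx : x < x + 1 by lra.
have [D E] := @continuous_FTC1 R rho -oo%O x (x + 1) xx (half_line_integrable _) (ltNyr x) (@crho x).
have DA : is_derive x 1 (fun x => \int[leb]_(y in `]-oo, x]) rho y) (rho x).
  by split; [exact: D|rewrite -derive1E].
have := is_deriveB (is_deriveZ (4 * pi) DA) (is_derive_cst (2 * pi * \int[leb]_y rho y) x 1).
by rewrite subr0.
Qed.

(** At the two ends of the line the field tends to opposite multiples of the total charge. This
    fixes the additive constant that Gauss's law leaves open. *)
Lemma poisson0_sym (eps : R) : 0 < eps ->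
  \forall n \near \oo, `|poisson0 n%:R + poisson0 (- n%:R)| <= eps.
Proof.
move=> eps0; have p0 := pi_gt0 R.
pose d := eps / (8 * pi).
have d0 : 0 < d by rewrite divr_gt0// mulr_gt0.
have T1 := @tail_integral (fun n => `]-oo, (- n%:R : R)]) _ _ d0.
have T2 := @tail_integral (fun n => `[(n%:R : R), +oo[) _ _ d0.
have N1 x : \forall n \near \oo, x \notin `]-oo, (- n%:R : R)].
  near=> n; rewrite in_itv/= -ltNge ltrNl.
  by near: n; exact: nbhs_infty_gtr.
have N2 x : \forall n \near \oo, x \notin `[(n%:R : R), +oo[.
  near=> n; rewrite in_itv/= andbT -ltNge.
  by near: n; exact: nbhs_infty_gtr.
near=> n.
have H1 : `|\int[leb]_(x in `]-oo, (- n%:R : R)]) rho x| <= d by near: n; exact: T1.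
have H2 : `|\int[leb]_(x in `[(n%:R : R), +oo[) rho x| <= d by near: n; exact: T2.
rewrite /poisson0.
have S1 := split_half_lines n%:R; have S2 := split_half_lines (- n%:R).
set a := Rintegral _ _ _ in S1 *; set b := Rintegral _ _ _ in H2 S1 *.
set a' := Rintegral _ _ _ in H1 S2 *; set b' := Rintegral _ _ _ in S2 *.
have -> : 2 * pi * a - 2 * pi * b + (2 * pi * a' - 2 * pi * b') = 4 * pi * (a' - b).
  have -> : a = a' + b' - b by rewrite S2 -S1; ring.
  ring.
rewrite normrM (ger0_norm (_ : 0 <= 4 * pi)); last by rewrite mulr_ge0// ltW.
have : `|a' - b| <= 2 * d by have := ler_normB a' b; lra.
have pn : (pi : R) != 0 by exact: lt0r_neq0.
have -> : eps = 4 * pi * (2 * d).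
  by rewrite /d; move: (pi : R) pn => x xn; field.
by move=> ?; rewrite ler_wpM2l// mulr_ge0// ltW.
Unshelve. all: by end_near. Qed.

End half_lines.

(** * Growth estimates and finite sums *)

Section auxiliary.
Context {R : realType}.
Local Notation mom := (R * R)%type.
Local Notation phase := (R * mom)%type.

Lemma is_derive_fsum (I : finType) (V : normedModType R) (h : I -> V -> R)
    (dh : I -> R) (z v : V) : (forall i, is_derive z v (h i) (dh i)) ->
  is_derive z v (fun z => \sum_i h i z) (\sum_i dh i).
Proof.
move=> D; rewrite (_ : (fun z => _) = \sum_i h i); last first.
  by apply/funext => y; rewrite fct_sumE.
apply: (big_ind2 (fun (g : V -> R) d => is_derive z v g d)).
- exact: is_derive_cst.
- by move=> g1 d1 g2 d2 D1 D2; exact: is_deriveD.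
- by move=> i _; exact: D.
Qed.

Lemma continuous_fsum (I : finType) (T : topologicalType) (h : I -> T -> R) (z : T) :
  (forall i, {for z, continuous (h i)}) -> {for z, continuous (fun z => \sum_i h i z)}.
Proof.
move=> ch; rewrite (_ : (fun z => _) = \sum_i h i); last first.
  by apply/funext => y; rewrite fct_sumE.
apply: (big_ind (fun g : T -> R => {for z, continuous g})).
- exact: cvg_cst.
- by move=> g1 g2 c1 c2; apply: cvgD.
- by move=> i _; exact: ch.
Qed.

Lemma is_derive_eq_near (g h : R -> R) (s d r : R) : 0 < r ->
  (forall s', `|s' - s| < r -> g s' = h s') -> is_derive s 1 g d -> is_derive s 1 h d.
Proof.
move=> r0 gh /is_deriveP H; apply/is_deriveP => e e0; have [r1 r10 rP] := H e e0.
exists (Num.min r r1); first by rewrite lt_min r0.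
move=> k; rewrite lt_min => /andP[kr /rP]; rewrite !gh ?subrr ?normr0//.
by rewrite addrAC subrr add0r /GRing.scale/= mulr1.
Qed.

Lemma deriv_growth (g h : R -> R) (a b : R) : a <= b ->
  (forall s : R, a <= s <= b -> {for s, continuous g}) ->
  (forall s : R, a <= s <= b -> {for s, continuous h}) ->
  (forall s : R, a < s < b -> exists d d' : R, [/\ `|d| <= d',
     is_derive s 1 g d & is_derive s 1 h d']) ->
  `|g b - g a| <= h b - h a.
Proof.
move=> ab cg ch D.
have H (sg : R) : `|sg| = 1 -> sg * (g b - g a) <= h b - h a.
  move=> sg1; have : sg * g b - h b <= sg * g a - h a.
    apply: (@le_of_deriv_le0 R (fun s => sg * g s - h s) a b ab).
      move=> s sab; apply: cvgB; last exact: ch.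
      by apply: cvgM; [exact: cvg_cst|exact: cg].
    move=> s sab; have [d [d' [dd Dg Dh]]] := D s sab.
    exists (sg * d - d'); last exact: (is_deriveB (is_deriveZ sg Dg) Dh).
    by rewrite subr_le0; apply: le_trans dd; rewrite (le_trans (ler_norm _))// normrM sg1 mul1r.
  by rewrite mulrBr; lra.
rewrite ler_norml; have := H 1 (normr1 _).
have := H (- 1); rewrite normrN1 => /(_ erefl).
by rewrite mul1r mulN1r => ? ?; apply/andP; split; lra.
Qed.

(** The gain of [1 / l] in this integration is what later makes weighted estimates contract. *)
Lemma exp_growth (g : R -> R) (K l t : R) : 0 <= K -> 0 < l -> 0 <= t ->
  (forall s : R, 0 <= s <= t -> {for s, continuous g}) ->
  (forall s : R, 0 < s < t -> exists2 d : R, `|d| <= K * expR (l * s) &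
     is_derive s 1 g d) ->
  `|g t - g 0| <= K / l * expR (l * t).
Proof.
move=> K0 l0 t0 cg D.
apply: (@le_trans _ _ (K / l * expR (l * t) - K / l * expR (l * 0))); last first.
  by rewrite lerBlDr lerDl mulr_ge0 ?expR_ge0// divr_ge0// ltW.
apply: (@deriv_growth g (fun s => K / l * expR (l * s)) 0 t t0 cg).
  by move=> s _; apply: cvgM; [exact: cvg_cst|exact: cont_expRM].
move=> s st; have [d dd Dd] := D s st; exists d, (K * expR (l * s)); split => //.
have := is_deriveZ (K / l) (is_derive_expRM l s).
by rewrite /GRing.scale/= mulrA divfK// lt0r_neq0.
Qed.

Lemma uniform_bound (I : finType) (Q : I -> R -> Prop) :
  (forall i M M', M <= M' -> Q i M -> Q i M') ->
  (forall i, exists2 M, 0 <= M & Q i M) -> exists2 M, 0 <= M & forall i, Q i M.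
Proof.
move=> Qle H; have /choice[M HM] : forall i, exists M, 0 <= M /\ Q i M.
  by move=> i; have [M] := H i; exists M.
exists (\sum_i M i); first by apply: sumr_ge0 => i _; exact: (HM i).1.
move=> i; apply: Qle (HM i).2.
by rewrite (bigD1 i)//= lerDl sumr_ge0// => j _; exact: (HM j).1.
Qed.

Lemma Rintegral_zero d (T : measurableType d) (mu : {measure set T -> \bar R}) (D : set T) :
  \int[mu]_(x in D) (0 : R) = 0.
Proof. by rewrite /Rintegral integral0. Qed.

Lemma le_sum3 (a b c s : R) : 0 <= a -> 0 <= b -> 0 <= c -> a + b + c <= s ->
  [/\ a <= s, b <= s & c <= s].
Proof. by move=> *; split; lra. Qed.

Lemma const_of_derive0 (g : R -> R) (L x y : R) :
  (forall z : R, `|z| < L -> is_derive z 1 g 0) -> `|x| < L -> `|y| < L -> g x = g y.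
Proof.
move=> D xL yL.
have H z : `|z| < L -> g z = g 0.
  move=> zL; have D1 (s : R) : `|s - 0| < L -> is_derive s 1 g 0 by rewrite subr0; exact: D.
  have D2 (s : R) : `|s - 0| < L -> `|(0 : R) - 0| <= 0 by rewrite subrr normr0.
  have := @mvt_remainder R g (fun _ => 0) 0 L 0 0 D1 D2 z zL.
  by rewrite add0r mulr0 subr0 mul0r normr_le0 subr_eq0 => /eqP.
by rewrite !H.
Qed.

End auxiliary.

(** * Charge and current summed over species *)

Section currents.
Context {R : realType} {A : finType}.
Local Notation mom := (R * R)%type.
Local Notation phase := (R * mom)%type.
Implicit Types (f : A -> R -> phase -> R) (v : A -> mom -> R).
Variable e : A -> R.

Definition jj v f (t x : R) := \sum_a e a * cur (v a) (f a) t x.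
Definition rr f (t x : R) := \sum_a e a * dens (f a) t x.

Lemma qsum_ge (a : A) : `|e a| <= \sum_b `|e b|.
Proof. by rewrite (bigD1 a)//= lerDl sumr_ge0. Qed.

Lemma qsum_ge0 : 0 <= \sum_b `|e b|.
Proof. exact: sumr_ge0. Qed.

Lemma current_diff (u u' : A -> mom -> R) (P d : R) : 0 <= P ->
  (forall a, cbox P (u a)) -> (forall a, cbox P (u' a)) ->
  (forall a p, box P p -> `|u a p - u' a p| <= d) ->
  `|\sum_a e a * momI (u a) - \sum_a e a * momI (u' a)| <=
  (\sum_a `|e a|) * (2 * P) ^+ 2 * d.
Proof.
move=> P0 B B' H; rewrite -sumrB mulr_suml mulr_suml.
apply: (le_trans (ler_norm_sum _ _ _)); apply: ler_sum => a _.
rewrite -mulrBr -(momIB P0 (B a) (B' a)) normrM -mulrA ler_wpM2l//.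
by apply: momI_bound => //; [exact: cboxB|move=> p; exact: H].
Qed.

End currents.

(** * The limit system: support, far region, derivative bounds, uniqueness *)

Section vlasov_poisson.
Context {R : realType} {A : finType}.
Local Notation mom := (R * R)%type.
Local Notation phase := (R * mom)%type.
Variables (e m : A -> R) (f0 : A -> phase -> R) (F : A -> mom -> R) (R0 Q0 : R).
Hypothesis m_gt0 : forall a, 0 < m a.
Hypothesis data : data_assumptions e m f0 (fun=> 0) (fun=> 0) F R0 Q0.
(** This sum and the next dominate every [|e a|] and every [(m a)^-1], so that one constant serves
    all species. *)
Let qs := \sum_a `|e a|.
Let im := \sum_a (m a)^-1.

Lemma im_ge a : (m a)^-1 <= im.
Proof. by rewrite /im (bigD1 a)//= lerDl sumr_ge0// => b _; rewrite invr_ge0 ltW. Qed.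

Lemma im_ge0 : 0 <= im.
Proof. by apply: sumr_ge0 => b _; rewrite invr_ge0 ltW. Qed.

Lemma over_gam_bound k (y P : R) a (p : mom) : 0 <= k -> `|y| <= P ->
  `|y / gam k (m a) p| <= P * im.
Proof.
move=> k0 yP; apply: (le_trans (over_gam_le _ _ k0 (m_gt0 a))).
by rewrite ler_pM ?invr_ge0 ?(ltW (m_gt0 a))// im_ge.
Qed.

Section initial.
Variable f : A -> R -> phase -> R.
Hypotheses (Cf : forall a, C1_time (f a)) (ini : forall a x p, f a 0 (x, p) = f0 a (x, p)).

Lemma init_support a (x : R) (p : mom) : Q0 <= enorm p -> f a 0 (x, p) = 0.
Proof. by move=> Qp; rewrite ini; exact: ((da_momentum data a Qp).1 x). Qed.

Lemma cbox_init a (x : R) : cbox Q0 (fun p => f a 0 (x, p)).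
Proof.
split; last by move=> p Qp; apply: init_support; apply: le_trans (norm_le_enorm p); exact: ltW.
have := cont_slice_mom (t := 0) (x := x) (ext_continuous (Cf a)).
by rewrite extE.
Qed.

End initial.

Section solution.
Variables (f : A -> R -> phase -> R) (E : R -> R -> R).
Hypothesis sol : VP_solution e m f E.
Hypothesis ini : forall a x p, f a 0 (x, p) = f0 a (x, p).

Lemma material_no_magnetic (d v w x y z q a : R) : d + v * x + q * a * y = 0 ->
  d + v * x + q * (a + w * 0) * y + q * (0 - v * 0) * z = 0.
Proof. by move=> E0; lra. Qed.

Lemma vp_material a (t : R) (z : phase) : 0 < t ->
  material 0 (m a) (e a) E (fun _ _ => 0) (fun _ _ => 0) (f a) t z = 0.
Proof.
move=> t0; case: z => x p; have H := vp_vlasov sol a x p (ltW t0).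
by rewrite (V1ooE p (m_gt0 a)) in H; exact: material_no_magnetic H.
Qed.

Lemma vp_field_bound (T : R) : exists2 M : R, 0 <= M &
  forall t x : R, 0 <= t <= T -> `|E t x| <= M.
Proof.
have [M HM] := vp_E1_bounded sol T; exists `|M| => // t x tT.
by apply: (le_trans (HM t x tT)); exact: ler_norm.
Qed.

Lemma vp_slow (T : R) : 0 <= T -> exists2 K : R, 0 < K &
  forall a (t w : R) (z : phase), 0 <= t <= T -> (`|z.2| + K * expR T) / m a <= w ->
  slow 0 (m a) (e a) E (fun _ _ => 0) (fun _ _ => 0) 1 K w t z.
Proof.
move=> T0; have [M M0 HM] := vp_field_bound T.
exists (qs * M + 1); first by rewrite ltr_wpDl// mulr_ge0// qsum_ge0.
move=> a t w z /andP[t0 tT] zw; apply: (@slow_VP _ (m a) (e a) M) => //.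
- by rewrite addr_ge0// mulr_ge0// qsum_ge0.
- apply: le_trans zw; rewrite ler_wpM2r ?invr_ge0 ?(ltW (m_gt0 a))// lerD2l divr1 mul1r.
  by rewrite ler_wpM2l ?ler_expR// addr_ge0// mulr_ge0// qsum_ge0.
- by move=> s x /andP[s0 st]; apply: HM; rewrite s0 (le_trans st).
- by rewrite (@le_lt_trans _ _ (qs * M))// ?ltrDl// ler_wpM2r// qsum_ge.
Qed.

Lemma vp_support (T : R) : 0 <= T -> exists2 P : R, Q0 <= P &
  forall a (t x : R) (p : mom), 0 <= t <= T -> P < `|p| -> f a t (x, p) = 0.
Proof.
move=> T0; have [K K0 HK] := vp_slow T0.
exists (Q0 + K * expR T); first by rewrite lerDl mulr_ge0 ?expR_ge0// ltW.
move=> a t x p tT pP; have /andP[t0 tT'] := tT.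
have w0 : 0 <= (`|p| + K * expR T) / m a.
  by rewrite divr_ge0 ?(ltW (m_gt0 a))// addr_ge0// mulr_ge0 ?expR_ge0// ltW.
apply: (vlasov_support (vp_f_C1 sol a) (@vp_material a) ltr01 K0 w0 t0 (HK a t _ (x, p) tT (lexx _)) (init_support ini a)).
rewrite divr1 mul1r /=; apply/ltW/(le_lt_trans _ pP).
by rewrite lerD2l ler_wpM2l ?(ltW K0)// ler_expR.
Qed.

Lemma vp_lucs a : lucs (f a).
Proof.
move=> T L; have T0 : 0 <= Num.max 0 T by rewrite le_max lexx.
have [P QP HP] := vp_support T0; exists P.
  by apply: le_trans QP; exact: ltW (da_Q0_gt0 data).
move=> t x p /andP[t0 tT] _; apply: HP; rewrite t0/=.
by rewrite (le_trans tT)// le_max lexx orbT.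
Qed.

(** Beyond [R0] the datum equals [F], which is its value at [x = R0]; a maximum over a compact set
    therefore bounds it everywhere. *)
Lemma f0_bounded : exists2 M0 : R, 0 <= M0 & forall a z, 0 <= f0 a z <= M0.
Proof.
suff [M M0 HM] : exists2 M, 0 <= M & forall a z, f0 a z <= M.
  by exists M => // a z; rewrite (da_f0_ge0 data)/=.
apply: (@uniform_bound R A (fun a M => forall z, f0 a z <= M)) => [a M M' MM H z|a].
  exact: le_trans (H z) MM.
have cK : compact (`[- R0, R0] `*` @box R Q0).
  by apply: compact_setX; [exact: segment_compact|exact: compact_box].
have cf : continuous (f a 0).
  have := @cont_slice _ _ (ext (f a)) 0 (ext_continuous (vp_f_C1 sol a)).
  by rewrite extE.
have [M M0 HM] := cont_bounded cK cf; exists M => // -[x p].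
have [pQ|Qp] := leP `|p| Q0; last first.
  by rewrite ((da_momentum data a (le_trans (ltW Qp) (norm_le_enorm p))).1 x).
have K x' : `|x'| <= R0 -> f0 a (x', p) <= M.
  move=> xR; rewrite -ini; apply: (le_trans (ler_norm _)); apply: HM.
  by split => /=; [rewrite in_itv/= -ler_norml|exact/boxE].
have [|/ltW Rx] := leP `|x| R0; first exact: K.
have Rp := ltW (da_R0_gt0 data).
have [E1 _ _] := da_space data Rx.
have [|E2 _ _] := @da_space _ _ _ _ _ _ _ _ _ _ data R0; first by rewrite ger0_norm.
have /eqP := E1 a p; have /eqP := E2 a p; rewrite !subr_eq0 => /eqP EE /eqP ->.
by rewrite -EE; apply: K; rewrite ger0_norm.
Qed.

Lemma vp_range (M0 : R) a (t : R) z : (forall a z, 0 <= f0 a z <= M0) ->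
  0 <= t -> 0 <= f a t z <= M0.
Proof.
move=> H t0; have [K K0 HK] := vp_slow t0.
have w0 : 0 <= (`|z.2| + K * expR t) / m a.
  by rewrite divr_ge0 ?(ltW (m_gt0 a))// addr_ge0// mulr_ge0 ?expR_ge0// ltW.
apply: (vlasov_range (vp_f_C1 sol a) (@vp_material a) ltr01 K0 w0 t0 (HK a t _ z _ (lexx _))).
  by rewrite t0 lexx.
by move=> [x p]; rewrite ini; exact: H.
Qed.

Let vc a := vel1 0 (m a).

Lemma charge_rr (t : R) : 0 <= t -> charge_density e (f ^~ t) = rr e f t.
Proof.
move=> t0; apply/funext => x; apply: eq_bigr => a _.
by rewrite /dens extE.
Qed.

Lemma rr_continuous (t : R) : continuous (rr e f t).
Proof.
move=> x; apply: continuous_fsum => a; apply: cvgM; first exact: cvg_cst.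
exact: (@cont_slice _ _ (dens (f a)) t (dens_continuous (vp_f_C1 sol a) (@vp_lucs a))).
Qed.

Lemma vp_E_poisson0 (t : R) : 0 <= t -> E t = poisson0 (rr e f t).
Proof.
by move=> t0; apply/funext => x; rewrite (vp_field sol x t0) (charge_rr t0).
Qed.

Lemma vp_rr_integrable (t : R) : 0 <= t ->
  (@lebesgue_measure R).-integrable setT (EFin \o rr e f t).
Proof. by move=> t0; have := vp_charge_integrable sol t0; rewrite charge_rr. Qed.

Lemma vp_gauss (t x : R) : 0 <= t -> is_derive x 1 (E t) (4 * pi * rr e f t x).
Proof.
move=> t0; rewrite (vp_E_poisson0 t0).
exact: (poisson0_derive (@rr_continuous t) (vp_rr_integrable t0)).
Qed.

(** The Poisson integral is not differentiated in time. Gauss's law shows that [E] and [4 * pi]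
    times the charge potential differ by a function of time alone, which cancels between two
    points. *)
Lemma vp_E_pair (x X s : R) : 0 < s ->
  is_derive s 1 (fun s => ext E s x - ext E s X)
    (- (4 * pi) * (jj e vc f s x - jj e vc f s X)).
Proof.
move=> s0; pose L := `|x| + `|X| + 1.
have xL : `|x| < L by rewrite /L; have := normr_ge0 X; lra.
have XL : `|X| < L by rewrite /L; have := normr_ge0 x; lra.
have H a := @mass_potential _ _ (vp_f_C1 sol a) (@vp_lucs a) 0 (m a) (e a) _ _ _ L (lexx _) (m_gt0 a) (@vp_material a).
have [N HN] := choice H.
have EN s' : 0 <= s' -> (4 * pi) * (\sum_a e a * (N a s' x - N a s' X)) = ext E s' x - ext E s' X.
  move=> s'0; rewrite extE//.
  have : E s' x - (4 * pi) * (\sum_a e a * N a s' x) = E s' X - (4 * pi) * (\sum_a e a * N a s' X).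
    apply: (@const_of_derive0 R (fun x => E s' x - (4 * pi) * (\sum_a e a * N a s' x)) L) => // z zL.
    have D1 := vp_gauss z s'0.
    have D2 : is_derive z 1 (fun z => \sum_a e a * N a s' z) (rr e f s' z).
      apply: is_derive_fsum => a; have [_ D _] := HN a.
      exact: (is_deriveZ (e a) (D s' z zL)).
    have := is_deriveB D1 (is_deriveZ (4 * pi) D2).
    by rewrite /GRing.scale/= subrr.
  have -> : \sum_a e a * (N a s' x - N a s' X) =
      \sum_a e a * N a s' x - \sum_a e a * N a s' X.
    by rewrite -sumrB; apply: eq_bigr => a _; rewrite mulrBr.
  by rewrite mulrBr; lra.
have EN' s' : `|s' - s| < s ->
    (4 * pi) * (\sum_a e a * (N a s' x - N a s' X)) = ext E s' x - ext E s' X.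
  by move=> /ltr_normlP[s's _]; apply: EN; lra.
apply: (is_derive_eq_near s0 EN').
have -> : - (4 * pi) * (jj e vc f s x - jj e vc f s X) =
    (4 * pi) * \sum_a e a * (- cur (vc a) (f a) s x - (- cur (vc a) (f a) s X)).
  rewrite mulNr -mulrN /jj -sumrB -sumrN; congr (_ * _); apply: eq_bigr => a _.
  by ring.
apply: is_deriveZ; apply: is_derive_fsum => a; apply: is_deriveZ.
have [_ _ D] := HN a.
have D0 y : `|y| < L -> is_derive s 1 (N a ^~ y) (- cur (vc a) (f a) s y).
  move=> yL; have := D s y 0 s0 yL; rewrite mul0r sub0r.
  by under eq_fun do rewrite mulr0 addr0.
exact: (is_deriveB (D0 x xL) (D0 X XL)).
Qed.

Lemma init_far a (x : R) (p : mom) : R0 <= `|x| -> f a 0 (x, p) = F a p.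
Proof.
move=> Rx; have [H _ _] := da_space data Rx.
by rewrite ini; apply/eqP; rewrite -subr_eq0 H.
Qed.

Lemma R0_far : R0 <= `|R0|.
Proof. by rewrite ger0_norm// ltW// (da_R0_gt0 data). Qed.

Lemma cbox_F a : cbox Q0 (F a).
Proof.
have := cbox_init (vp_f_C1 sol) ini a R0; congr cbox; apply/funext => p; exact: init_far R0_far.
Qed.

Lemma F_lip : exists2 LF : R, 0 <= LF & forall a p, `|'D_((1, 0) : mom) (F a) p| <= LF.
Proof.
apply: (@uniform_bound R A (fun a M => forall p, `|'D_((1, 0) : mom) (F a) p| <= M)) => [a M M' MM H p|a].
  exact: le_trans (H p) MM.
have [_ cD] := da_F_C1 data a.
have [M M0 HM] := cont_bounded (@compact_box R (Q0 + 1)) (cD (1, 0)).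
exists M => // p; have [pQ|Qp] := leP `|p| (Q0 + 1); first by apply: HM; exact/boxE.
have D : is_derive p ((1, 0) : mom) (F a) 0.
  apply: (derive_zero _ ltr01) => q qp; apply: (cbox_F a).2.
  have := ler_norm (`|p| - `|q|); have := ler_dist_dist p q.
  by rewrite (distrC p q); lra.
by rewrite (@derive_val _ _ _ _ _ _ _ D) normr0.
Qed.

Lemma Q0_ge0 : 0 <= Q0. Proof. exact: ltW (da_Q0_gt0 data). Qed.

Lemma neutral_F : \sum_a e a * momI (F a) = 0.
Proof. exact: (da_neutral data). Qed.

Lemma current_F1 : \sum_a e a * momI (fun p => vel1 0 (m a) p * F a p) = 0.
Proof.
rewrite -[RHS](da_current1 data); apply: eq_bigr => a _; congr (_ * momI _).
by apply/funext => p; rewrite mulrC V1ooE.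
Qed.

Lemma current_F2 : \sum_a e a * momI (fun p => vel2 0 (m a) p * F a p) = 0.
Proof.
rewrite -[RHS](da_current2 data); apply: eq_bigr => a _; congr (_ * momI _).
by apply/funext => p; rewrite mulrC V2ooE.
Qed.

Local Notation leb := (@lebesgue_measure R).

Lemma Rintegral_fsum (h : A -> R -> R) :
  (forall a, leb.-integrable setT (EFin \o h a)) ->
  \int[leb]_x (\sum_a h a x) = \sum_a \int[leb]_x h a x.
Proof.
move=> ih; rewrite (_ : (fun x => \sum_a h a x) = \sum_a h a); last first.
  by apply/funext => y; rewrite fct_sumE.
suff [] : leb.-integrable setT (EFin \o (\sum_a h a)) /\
  \int[leb]_x (\sum_a h a) x = \sum_a \int[leb]_x h a x by [].
apply: (big_ind2 (fun (g : R -> R) v => leb.-integrable setT (EFin \o g) /\ \int[leb]_x g x = v)).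
- split; first exact: integrable0.
  by rewrite /Rintegral integral0.
- move=> g1 d1 g2 d2 [i1 <-] [i2 <-]; split; last by rewrite RintegralD.
  have := integrableD measurableT i1 i2; congr (integrable _ _ _).
- by move=> a _.
Qed.

(** Taken alone, the density of a species need not be integrable, since the background fills the
    line. Neutrality of [F] allows [f0] to be replaced by [f0 - F], supported over [[- R0, R0]],
    before integrating species by species. *)
Lemma init_charge : \int[leb]_x rr e f 0 x = 0.
Proof.
pose u a (x : R) := momI (fun p => f0 a (x, p) - F a p).
have uE a x : u a x = dens (f a) 0 x - momI (F a).
  rewrite /dens extE//; rewrite -(momIB Q0_ge0 (cbox_init (vp_f_C1 sol) ini a x) (cbox_F a)).
  by congr momI; apply/funext => p; rewrite ini.
have -> : rr e f 0 = fun x => \sum_a e a * u a x.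
  apply/funext => x; transitivity (rr e f 0 x - \sum_a e a * momI (F a)).
    by rewrite neutral_F subr0.
  by rewrite /rr -sumrB; apply: eq_bigr => a _; rewrite uE mulrBr.
have cu a : continuous (u a).
  rewrite (_ : u a = fun x => dens (f a) 0 x - momI (F a)); last exact/funext/uE.
  move=> x; apply: cvgB; last exact: cvg_cst.
  exact: (@cont_slice _ _ (dens (f a)) 0 (dens_continuous (vp_f_C1 sol a) (@vp_lucs a))).
have iu a : leb.-integrable setT (EFin \o u a).
  have := @segment_integrable _ (u a) (- R0) R0 (cu a).
  have mI : measurable (`[- R0, R0]%classic : set (measurableTypeR R)).
    exact: measurable_itv.
  move/(iffLR (integrable_mkcond _ mI)); rewrite restrict_EFin.
  suff <- : u a = u a \_ `[- R0, R0] by [].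
  apply/funext => x; rewrite patchE; case: ifPn => //.
  rewrite notin_setE /= in_itv/= => /negP; rewrite -ler_norml -ltNge => /ltW Rx.
  rewrite /u (_ : (fun p => f0 a (x, p) - F a p) = (fun _ => 0 * F a 0)).
    by rewrite /momI mul0r; exact: Rintegral_zero.
  by apply/funext => p; rewrite -ini (init_far a p Rx) subrr mul0r.
rewrite Rintegral_fsum; last first.
  move=> a; have := integrableZl measurableT (e a) (iu a).
  by congr (integrable _ _ _).
rewrite -[RHS](da_total_charge data); apply: eq_bigr => a _.
by rewrite RintegralZl//.
Qed.

(** Beyond [R0] one of the two half lines carries no charge density, and the other then carries the
    total charge, which is zero. *)
Lemma vp_init_field (x : R) : R0 <= `|x| -> E 0 x = 0.
Proof.
move=> Rx; rewrite (vp_E_poisson0 (lexx 0)) /poisson0.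
have r0 y : R0 <= `|y| -> rr e f 0 y = 0.
  move=> Ry; rewrite -[RHS]neutral_F; apply: eq_bigr => a _; congr (_ * momI _).
  by apply/funext => p; rewrite extE// init_far.
have S := split_half_lines (vp_rr_integrable (lexx 0)) x.
rewrite init_charge in S.
have Z (D : set R) : (forall y, D y -> R0 <= `|y|) -> \int[leb]_(y in D) rr e f 0 y = 0.
  move=> DR; transitivity (\int[leb]_(y in D) (0 : R)); last exact: Rintegral_zero.
  by apply: eq_Rintegral => y; rewrite inE => /DR/r0.
have Rp := da_R0_gt0 data.
have [x0|x0] := leP 0 x.
  have E0 : \int[leb]_(y in `[x, +oo[) rr e f 0 y = 0.
    apply: Z => y /=; rewrite in_itv/= andbT => xy.
    by rewrite (le_trans Rx)// !ger0_norm// (le_trans x0).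
  by move: S; rewrite E0 addr0 => ->; rewrite mulr0 subrr.
have E0 : \int[leb]_(y in `]-oo, x]) rr e f 0 y = 0.
  apply: Z => y /=; rewrite in_itv/= => xy.
  by rewrite (le_trans Rx)// !ltr0_norm ?lerN2// (le_lt_trans xy).
by move: S; rewrite E0 add0r => ->; rewrite mulr0 subrr.
Qed.

(* Beyond the reach [R0 + W t] of the initial inhomogeneity the total charge
   is not seen: the field satisfies a homogeneous linear integral inequality. *)
Lemma vp_far (T : R) : 0 <= T -> exists2 W : R, 0 < W &
  forall t x : R, 0 <= t <= T -> R0 + W * t <= `|x| ->
    E t x = 0 /\ forall a p, f a t (x, p) = F a p.
Proof.
move=> T0; have [P QP HP] := vp_support T0; have [K K0 HK] := vp_slow T0.
have [M M0 HM] := vp_field_bound T.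
have [LF LF0 HLF] := F_lip.
have P0 : 0 <= P by exact: le_trans Q0_ge0 QP.
have qs0 : 0 <= qs := qsum_ge0 e.
(* Velocities met on backward domains that start in the momentum support; the sum covers all species
   at once. *)
pose W0 := \sum_a (P + K * expR T) / m a.
have Wa a : 0 <= (P + K * expR T) / m a.
  by rewrite divr_ge0 ?(ltW (m_gt0 a))// addr_ge0// mulr_ge0 ?expR_ge0// ltW.
have Wle a : (P + K * expR T) / m a <= W0 by rewrite /W0 (bigD1 a)//= lerDl sumr_ge0.
pose W := W0 + 1.
have W0' : 0 <= W0 by exact: sumr_ge0.
have Wp : 0 < W by rewrite /W; lra.
have ima := im_ge; have im0 := im_ge0.
pose C1 := qs * LF.
have C10 : 0 <= C1 by exact: mulr_ge0.
pose C2 := qs * (2 * P) ^+ 2 * (P * im * C1).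
have C20 : 0 <= C2 by rewrite !mulr_ge0// sqr_ge0.
have p0 := pi_gt0 R.
(* Chosen from the coefficient [8 * pi * C2] of the field estimate below, so that the contraction
   factor is at most [1 / 2]. *)
pose l := 16 * pi * C2 + 1.
have l1 : 1 <= l by rewrite /l lerDr !mulr_ge0// ltW.
have l0 : 0 < l by lra.
pose S : set (R * R) := [set w | 0 <= w.1 <= T /\ R0 + W * w.1 <= `|w.2|].
have Rp := da_R0_gt0 data.
have S0 w : S w -> R0 <= `|w.2|.
  move=> [/andP[w0 _]]; apply: le_trans; rewrite lerDl mulr_ge0// ltW//.
have Sdown w s y : S w -> 0 <= s <= w.1 -> `|y - w.2| <= W * (w.1 - s) -> S (s, y).
  move=> [/andP[w0 wT] wx] /andP[s0 sw] yw; split => /=.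
    by rewrite s0 (le_trans sw).
  have := ler_normD (w.2 - y) y; rewrite subrK distrC mulrBr in yw *.
  by move=> H; lra.
have transport (B : R) : 0 <= B ->
    (forall w, S w -> `|E w.1 w.2| <= B * expR (l * w.1)) ->
    forall w a p, S w -> `|f a w.1 (w.2, p) - F a p| <= C1 * B / l * expR (l * w.1).
  move=> B0 HB [t x] a p Sw /=.
  have rhs0 : 0 <= C1 * B / l * expR (l * t).
    by rewrite mulr_ge0 ?expR_ge0// divr_ge0 ?(ltW l0)// mulr_ge0.
  have [tT /= _] := Sw; have /andP[t0 tT'] := tT.
  have [pP|Pp] := leP `|p| P; last first.
    rewrite HP// ((cbox_F a).2) ?subrr ?normr0//; exact: le_lt_trans Pp.
  have sl : slow 0 (m a) (e a) E (fun _ _ => 0) (fun _ _ => 0) 1 K W t (x, p).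
    apply: HK => //; apply: (@le_trans _ _ W0); last by rewrite /W; lra.
    apply: le_trans (Wle a); rewrite ler_wpM2r ?invr_ge0 ?(ltW (m_gt0 a))//.
    by rewrite lerD2r.
  apply: (@vlasov_compare _ _ _ _ _ _ _ (f a) (fun w => F a w.2.2)
    (fun s => C1 * B / l * expR (l * s)) (fun s => C1 * B * expR (l * s))
    1 K W t (x, p) (vp_f_C1 sol a) ltr01 K0 (ltW Wp) t0 sl (@vp_material a)).
  - move=> y; apply: (@continuous_comp _ _ _ (fun w : R * phase => w.2.2) (F a)).
      by apply: (@continuous_comp _ _ _ snd snd); exact: cvg_snd.
    exact: (cbox_F a).1.
  - by move=> s; apply: cvgM; [exact: cvg_cst|exact: cont_expRM].
  - move=> s _; have := is_deriveZ (C1 * B / l) (is_derive_expRM l s).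
    by rewrite /GRing.scale/= mulrA divfK// lt0r_neq0.
  - move=> y Dy y0.
    have Sy : S (y.1, y.2.1).
      have [/andP[y0' yt] yx _ _] := Dy.
      by apply: (Sdown (t, x)) => //; rewrite y0'.
    (* Along a characteristic, [F] changes only through the electric force; a small field in [S]
       therefore keeps [f] close to [F]. *)
    exists (e a * E y.1 y.2.1 * 'D_((1, 0) : mom) (F a) y.2.2).
      rewrite !normrM /C1 -!mulrA; apply: ler_pM => //; first exact: qsum_ge.
      by rewrite mulrC; apply: ler_pM => //; exact: (HB _ Sy).
    have [DF _] := da_F_C1 data a.
    have /derivableP/(is_deriveZdir (e a * E y.1 y.2.1)) D := DF y.2.2 (1, 0).
    apply: (is_derive_transfer _ D) => h.
    rewrite /along /force1 /force2 !mulr0 !addr0 subr0 !mulr0 !addr0 !add0r.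
    by congr (F a (_, _)); rewrite /= /GRing.scale/= ?mulr1 ?mulr0 ?mulr0 ?addr0.
  - move=> y Dy y0; rewrite (surjective_pairing y.2) init_far ?subrr ?normr0.
      by rewrite mulr_ge0 ?expR_ge0// divr_ge0 ?(ltW l0)// mulr_ge0.
    have [_ yx _ _] := Dy; apply: (S0 (y.1, y.2.1)); apply: (Sdown (t, x)) => //.
    by rewrite y0 lexx.
have current (B : R) : 0 <= B ->
    (forall w, S w -> `|E w.1 w.2| <= B * expR (l * w.1)) ->
    forall w, S w -> `|jj e vc f w.1 w.2| <= C2 * B / l * expR (l * w.1).
  move=> B0 HB w Sw.
  have [/andP[w0 wT] _] := Sw.
  (* The background carries no current, so the current is that of [f - F]. *)
  rewrite -[jj _ _ _ _ _]subr0 -current_F1 /jj.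
  have -> : C2 * B / l * expR (l * w.1) =
      qs * (2 * P) ^+ 2 * (P * im * (C1 * B / l * expR (l * w.1))).
    by rewrite /C2; ring.
  have cv a := @continuous_vel1 R 0 (m a) (lexx 0) (m_gt0 a).
  have Bf a : cbox P (fun p => f a w.1 (w.2, p)).
    split; last by move=> p; apply: HP; rewrite w0.
    have := cont_slice_mom (t := w.1) (x := w.2) (ext_continuous (vp_f_C1 sol a)).
    by rewrite extE.
  rewrite (eq_bigr (fun a => e a * momI (fun p => vc a p * f a w.1 (w.2, p)))); last first.
    by move=> a _; rewrite /cur extE.
  apply: (@current_diff R A e _ _ P _ P0).
  - by move=> a; exact: cboxM (cv a) (Bf a).
  - by move=> a; apply: cboxM (cv a) _; exact: cboxW QP (cbox_F a).
  - move=> a p /boxE pP; rewrite -mulrBr normrM; apply: ler_pM => //.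
      by apply: over_gam_bound => //; apply: le_trans pP; rewrite prod_normE le_max lexx.
    exact: transport.
(* The integral inequality is homogeneous, so the contraction lemma applies with [a = 0] and forces
   the field to vanish on [S]. *)
have claim w : S w -> `|E w.1 w.2| <= 2 * 0 * expR (l * w.1).
  apply: (@contraction_bound _ _ S (fun w => `|E w.1 w.2|) (fun w => expR (l * w.1)) M 0) => //.
  - by move=> y _; exact: expR_gt0.
  - move=> y [yT _]; apply: (le_trans (HM _ _ yT)).
    have /andP[y0 _] := yT.
    by rewrite ler_peMr// (expRM_ge1 (ltW l0) y0).
  move=> B B0 HB [t x] Sw /=; rewrite addr0.
  have [/andP[/= t0 tT] xS] := Sw.
  have fieldbound : `|E t x| <= 8 * pi * C2 * B / l / l * expR (l * t).
    apply/ler_addgt0Pr => eps eps0.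
    have near_n := poisson0_sym (vp_rr_integrable t0) eps0.
    have near_n' : \forall n \near \oo, R0 + W * t <= n%:R.
      exact: nbhs_infty_ger.
    (* The points [n] and [- n] lie in [S] too, and the fields there nearly cancel: [2 * E t x] is
       the sum of its two differences to these values, each integrated in time from 0, and of their
       small sum. *)
    have [n [Xn nX]] : exists n : nat, `|E t n%:R + E t (- n%:R)| <= eps /\ R0 + W * t <= n%:R.
      have [n H] := filter_ex (filterI near_n near_n').
      by exists n; rewrite (vp_E_poisson0 t0).
    have pair (X : R) : S (t, X) -> `|ext E t x - ext E t X| <= 8 * pi * C2 * B / l / l * expR (l * t).
      move=> SX.
      have e0 y : S (t, y) -> ext E 0 y = 0.
        by move=> Sy; rewrite extE//; apply: vp_init_field; exact: (S0 (t, y)).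
      have -> : ext E t x - ext E t X = (ext E t x - ext E t X) - (ext E 0 x - ext E 0 X).
        by rewrite !e0// !subr0.
      apply: (@exp_growth R (fun s => ext E s x - ext E s X) (8 * pi * C2 * B / l) l t) => //.
      - by rewrite divr_ge0 ?(ltW l0)// !mulr_ge0// ltW.
      - by move=> s _; apply: cvgB; apply: (cont_slicel (ext_continuous (vp_E1_C1 sol))).
      move=> s /andP[s0 st]; exists (- (4 * pi) * (jj e vc f s x - jj e vc f s X)).
        have Ss y : S (t, y) -> S (s, y).
          move=> Sy; apply: (Sdown (t, y)) => //=; first by rewrite !ltW.
          by rewrite subrr normr0 mulr_ge0 ?(ltW Wp)// subr_ge0 ltW.
        rewrite normrM normrN (ger0_norm (_ : 0 <= 4 * pi)) ?mulr_ge0 ?(ltW p0)//.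
        have j1 := current _ B0 HB _ (Ss _ Sw); have j2 := current _ B0 HB _ (Ss _ SX).
        rewrite (_ : _ * expR _ = 4 * pi * (2 * (C2 * B / l * expR (l * s)))); last by ring.
        rewrite ler_wpM2l ?mulr_ge0 ?(ltW p0)//; have := ler_normB (jj e vc f s x) (jj e vc f s X).
        by move: j1 j2 => /=; lra.
      exact: vp_E_pair.
    have n0 : 0 <= n%:R :> R by [].
    have h1 := pair n%:R; have h2 := pair (- n%:R).
    have {}h1 := h1 (conj (introT andP (conj t0 tT)) (le_trans nX (ler_norm _))).
    have {}h2 := h2 (conj (introT andP (conj t0 tT)) _).
    have {}h2 : `|ext E t x - ext E t (- n%:R)| <= 8 * pi * C2 * B / l / l * expR (l * t).
      by apply: h2; rewrite /= normrN (le_trans nX)// ler_norm.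
    rewrite !extE// in h1 h2.
    have : `|2 * E t x| <= `|E t x - E t n%:R| + `|E t x - E t (- n%:R)| + `|E t n%:R + E t (- n%:R)|.
      rewrite (_ : 2 * E t x = (E t x - E t n%:R) + (E t x - E t (- n%:R)) + (E t n%:R + E t (- n%:R))); last by ring.
      by apply: (le_trans (ler_normD _ _)); rewrite lerD2r ler_normD.
    by rewrite normrM ger0_norm//; lra.
  apply: (le_trans fieldbound); rewrite ler_wpM2r ?expR_ge0//.
  rewrite ler_pdivrMr// ler_pdivrMr//.
  have : 8 * pi * C2 * B <= B / 2 * l by rewrite /l; have : 0 <= B by []; lra.
  move/le_trans; apply; rewrite ler_peMr// mulr_ge0 ?(ltW l0)//; lra.
exists W => // t x tT xW.
have Sw : S (t, x) by [].
split; first by have := claim _ Sw; rewrite mulr0 mul0r normr_le0 => /eqP.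
move=> a p.
have H0 w : S w -> `|E w.1 w.2| <= 0 * expR (l * w.1).
  by move=> Sy; have := claim _ Sy; rewrite mulr0.
have := transport _ (lexx 0) H0 (t, x) a p Sw; rewrite mulr0 mul0r mul0r normr_le0 subr_eq0.
by move/eqP.
Qed.

Lemma vp_initial_E (x : R) : E 0 x = poisson_field (charge_density e f0) x.
Proof.
rewrite (vp_field sol x (lexx 0)).
by rewrite (_ : f ^~ 0 = f0)//; apply/funext => a; apply/funext => -[y p]; exact: ini.
Qed.

(** The weight [v] is general so that the longitudinal current in Ampere's law and the transverse
    one met by light lines are both covered. *)
Lemma vp_current_far (v : A -> mom -> R) (T : R) : 0 <= T ->
  \sum_a e a * momI (fun p => v a p * F a p) = 0 -> exists2 Rf : R, 0 < Rf &
  forall t x : R, 0 <= t <= T -> Rf <= `|x| -> E t x = 0 /\ jj e v f t x = 0.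
Proof.
move=> T0 v0; have [W W0 HW] := vp_far T0.
have Rp := da_R0_gt0 data.
exists (R0 + W * T); first by rewrite ltr_wpDr// mulr_ge0// ltW.
move=> t x /andP[t0 tT] Rx.
have tT01 : 0 <= t <= T by rewrite t0.
have Rt : R0 + W * t <= `|x| by apply: le_trans Rx; rewrite lerD2l ler_wpM2l// ltW.
have [Ex fx] := HW t x tT01 Rt.
split => //; rewrite -[RHS]v0; apply: eq_bigr => a _; congr (_ * momI _).
by apply/funext => p; rewrite extE// fx.
Qed.

(** At a point [X] beyond the reach of the perturbation field and current vanish, which turns the
    two-point identity [vp_E_pair] into Ampere's law at [x]. *)
Lemma vp_ampere (T : R) : 0 <= T -> exists X : R,
  (forall s, 0 <= s <= T -> E s X = 0) /\
  (forall x s, 0 < s <= T -> is_derive s 1 (fun s => ext E s x - ext E s X)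
     (- (4 * pi) * jj e vc f s x)).
Proof.
move=> T0; have [Rf Rf0 HR] := vp_current_far T0 current_F1.
have RR : Rf <= `|Rf| by exact: ler_norm.
exists Rf; split; first by move=> s sT; have [] := HR s Rf sT RR.
move=> x s /andP[s0 sT]; have [|_ j0] := HR s Rf _ RR; first by rewrite ltW.
by have := vp_E_pair x Rf s0; rewrite j0 subr0.
Qed.

(** The bound is uniform over unbounded phase space: for large momentum [f] vanishes, for large
    [|x|] it equals [F], and only a compact region is left to continuity. *)
Lemma vp_lip (T : R) : 0 <= T -> exists2 L : R, 0 <= L & forall a (t : R) z, 0 <= t <= T ->
  [/\ `|dx (f a t) z| <= L, `|dp1 (f a t) z| <= L & `|dp2 (f a t) z| <= L].
Proof.
move=> T0; have [W W0 HW] := vp_far T0; have [P QP HP] := vp_support T0.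
have P0 : 0 <= P by exact: le_trans Q0_ge0 QP.
have Rp := da_R0_gt0 data.
pose Y := R0 + W * T + 1.
have Y0 : R0 + W * T < Y by rewrite /Y; lra.
have WT : 0 <= W * T by rewrite mulr_ge0// ltW.
have H a (v : phase) : exists M, 0 <= M /\ forall t z, 0 <= t <= T -> `|'D_v (f a t) z| <= M.
  have cK : compact (`[0, T] `*` (`[- Y, Y] `*` @box R (P + 1))).
    by do 2?[apply: compact_setX]; try exact: segment_compact; exact: compact_box.
  have [M M0 HM] := cont_bounded cK (@ext_dir_cont _ _ (f a) v (vp_f_C1 sol a)).
  exists M; split => // t [x p] tT; have /andP[t0 tT'] := tT.
  have in_box (y : R) : `|y| <= Y -> `|p| <= P + 1 -> `|'D_v (f a t) (y, p)| <= M.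
    move=> yY pP; have := HM (t, (y, p)); rewrite /= extE//; apply.
    by split => /=; [rewrite in_itv/= t0|split => /=; [rewrite in_itv/= -ler_norml|exact/boxE]].
  have [pP|Pp] := leP `|p| (P + 1); last first.
    have D : is_derive (x, p) v (f a t) 0.
      apply: (derive_zero _ ltr01) => -[x' p']; rewrite prod_norm_lt/= => /andP[_ pp].
      apply: HP => //; have := ler_norm (`|p| - `|p'|); have := ler_dist_dist p p'.
      by rewrite (distrC p p'); lra.
    by rewrite (@derive_val _ _ _ _ _ _ _ D) normr0.
  have [xY|Yx] := leP `|x| Y; first exact: in_box.
  have Fnear (y y' : R) q : Y <= `|y| -> `|y' - y| < 1 -> f a t (y', q) = F a q.
    move=> Yy yy; have [||_ ->//] := HW t y' => //.
    have : `|y| <= `|y'| + `|y' - y| by rewrite distrC -[X in `|X| <= _](subrK y') addrC ler_normD.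
    have : W * t <= W * T by rewrite ler_wpM2l// ltW.
    by rewrite /Y in Yy; lra.
  have YY : Y <= `|Y| by exact: ler_norm.
  (* Beyond [Y] the solution does not depend on [x] as long as the sign of [x] plays no part, [F]
     being the value on both sides; the [1] in [Y] leaves room for a neighbourhood. *)
  suff -> : 'D_v (f a t) (x, p) = 'D_v (f a t) (Y, p).
    by apply: in_box => //; rewrite ger0_norm// /Y; lra.
  have [_ Dv _ _ _] := vp_f_C1 sol a.
  have /derivableP/is_deriveP D := Dv t (Y, p) v t0.
  suff D' : is_derive (x, p) v (f a t) ('D_v (f a t) (Y, p)).
    exact: (@derive_val _ _ _ _ _ _ _ D').
  apply/is_deriveP => eps eps0; have [r r0 rP] := D eps eps0.
  have k0 : 0 < `|v.1| + 1 by rewrite ltr_wpDl.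
  exists (Num.min r (`|v.1| + 1)^-1); first by rewrite lt_min r0 invr_gt0.
  move=> h; rewrite lt_min => /andP[/rP + hv].
  have small : `|h * v.1| < 1.
    move: hv; rewrite -[X in _ < X]mul1r ltr_pdivlMr// => hv.
    by rewrite normrM; apply: le_lt_trans hv; rewrite ler_wpM2l// lerDl.
  have E1 (y : R) : Y <= `|y| -> f a t ((y, p) + h *: v) = F a (p + h *: v.2).
    move=> Yy; rewrite (surjective_pairing ((y, p) + h *: v)).
    by apply: (Fnear y) => //=; rewrite addrAC subrr add0r.
  have E0 (y : R) : Y <= `|y| -> f a t (y, p) = F a p.
    by move=> Yy; apply: (Fnear y) => //; rewrite subrr normr0.
  by rewrite !E1 ?E0// ltW.
apply: (@uniform_bound R A (fun a M => forall t z, 0 <= t <= T ->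
  [/\ `|dx (f a t) z| <= M, `|dp1 (f a t) z| <= M & `|dp2 (f a t) z| <= M])) => [a M M' MM Q t z|a].
  by move=> /(Q t z)[q1 q2 q3]; split; [exact: le_trans q1 MM|exact: le_trans q2 MM|exact: le_trans q3 MM].
have [M1 [m1 H1]] := H a (1, (0, 0)); have [M2 [m2 H2]] := H a (0, (1, 0)).
have [M3 [m3 H3]] := H a (0, (0, 1)).
have [s1 s2 s3] := le_sum3 m1 m2 m3 (lexx _).
exists (M1 + M2 + M3); first by rewrite !addr_ge0.
by move=> t z tT; split; [exact: le_trans (H1 t z tT) s1|exact: le_trans (H2 t z tT) s2|
  exact: le_trans (H3 t z tT) s3].
Qed.

End solution.

(** One solution serves as comparison function along the characteristics of the other. The defect is
    [Eg - E] times a momentum derivative of [f], which [vp_lip] bounds. *)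
Lemma vp_unique (f g : A -> R -> phase -> R) (E Eg : R -> R -> R) (T : R) :
  VP_solution e m f E -> (forall a x p, f a 0 (x, p) = f0 a (x, p)) ->
  VP_solution e m g Eg -> (forall a x p, g a 0 (x, p) = f0 a (x, p)) ->
  0 <= T -> forall t x : R, 0 <= t <= T ->
  Eg t x = E t x /\ forall a p, g a t (x, p) = f a t (x, p).
Proof.
move=> sf inf sg ing T0.
have [Pf QPf HPf] := vp_support sf inf T0; have [Pg QPg HPg] := vp_support sg ing T0.
have [K K0 HK] := vp_slow sg T0.
have [Mf Mf0 HMf] := vp_field_bound sf T; have [Mg Mg0 HMg] := vp_field_bound sg T.
have [L L0 HL] := vp_lip sf inf T0.
(* The two solutions may have different reach, hence a normalising point for each; every field
   vanishes at its own. *)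
have [Xf [Xf0 DXf]] := vp_ampere sf inf T0; have [Xg [Xg0 DXg]] := vp_ampere sg ing T0.
pose P := Num.max Pf Pg.
have PfP : Pf <= P by rewrite le_max lexx.
have PgP : Pg <= P by rewrite le_max lexx orbT.
have Q00 := Q0_ge0.
have P0 : 0 <= P by exact: le_trans Q00 (le_trans QPf PfP).
have qs0 : 0 <= qs := qsum_ge0 e.
have ima := im_ge; have im0 := im_ge0.
pose C1 := qs * L.
have C10 : 0 <= C1 by exact: mulr_ge0.
pose C2 := qs * (2 * P) ^+ 2 * (P * im * C1).
have C20 : 0 <= C2 by rewrite !mulr_ge0// sqr_ge0.
have p0 := pi_gt0 R.
pose l := 8 * pi * C2 + 1.
have l1 : 1 <= l by rewrite /l lerDr !mulr_ge0// ltW.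
have l0 : 0 < l by lra.
pose S : set (R * R) := [set w | 0 <= w.1 <= T].
pose D (w : R * R) := `|Eg w.1 w.2 - E w.1 w.2|.
have transport (B : R) : 0 <= B -> (forall w, S w -> D w <= B * expR (l * w.1)) ->
    forall t x a p, 0 <= t <= T -> `|g a t (x, p) - f a t (x, p)| <= C1 * B / l * expR (l * t).
  move=> B0 HB t x a p tT; have /andP[t0 tT'] := tT.
  pose w := (`|p| + K * expR T) / m a.
  have w0 : 0 <= w.
    by rewrite divr_ge0 ?(ltW (m_gt0 a))// addr_ge0// mulr_ge0 ?expR_ge0// ltW.
  have sl := HK a t w (x, p) tT (lexx _).
  have -> : f a t (x, p) = ext (f a) t (x, p) by rewrite extE.
  apply: (@vlasov_compare _ _ _ _ _ _ _ (g a) (fun w => ext (f a) w.1 w.2)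
    (fun s => C1 * B / l * expR (l * s)) (fun s => C1 * B * expR (l * s))
    1 K w t (x, p) (vp_f_C1 sg a) ltr01 K0 w0 t0 sl (@vp_material _ _ sg a)).
  - exact: ext_continuous (vp_f_C1 sf a).
  - by move=> s; apply: cvgM; [exact: cvg_cst|exact: cont_expRM].
  - move=> s _; have := is_deriveZ (C1 * B / l) (is_derive_expRM l s).
    by rewrite /GRing.scale/= mulrA divfK// lt0r_neq0.
  - move=> y [/andP[y0' yt] _ _ _] y0.
    have yT : 0 <= y.1 <= T by rewrite y0' (le_trans yt).
    exists (e a * (Eg y.1 y.2.1 - E y.1 y.2.1) * dp1 (f a y.1) y.2).
      rewrite !normrM /C1 -!mulrA; apply: ler_pM => //; first exact: qsum_ge.
      rewrite mulrC; apply: ler_pM => //; last exact: (HB (y.1, y.2.1) yT).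
      by have [_ H _] := HL a y.1 y.2 yT; exact: H.
    have := material_along 0 (m a) (e a) Eg (fun _ _ => 0) (fun _ _ => 0) (vp_f_C1 sf a) y0.
    have := vp_material sf a y.2 y0; rewrite /material /force1 /force2 => M0 D1.
    by apply: (is_derive_eq D1); move: M0; lra.
  - move=> y _ y0; rewrite (surjective_pairing y.2) y0 extE// inf ing subrr normr0.
    by rewrite mulr_ge0 ?expR_ge0// divr_ge0 ?(ltW l0)// mulr_ge0.
have current (B : R) : 0 <= B -> (forall w, S w -> D w <= B * expR (l * w.1)) ->
    forall t x, 0 <= t <= T ->
    `|jj e (fun a => vel1 0 (m a)) g t x - jj e (fun a => vel1 0 (m a)) f t x| <= C2 * B / l * expR (l * t).
  move=> B0 HB t x tT; have /andP[t0 tT'] := tT.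
  have -> : C2 * B / l * expR (l * t) =
      qs * (2 * P) ^+ 2 * (P * im * (C1 * B / l * expR (l * t))).
    by rewrite /C2; ring.
  have cv a := @continuous_vel1 R 0 (m a) (lexx 0) (m_gt0 a).
  have Bb (h : A -> R -> phase -> R) Eh (sh : VP_solution e m h Eh) Ph a : Ph <= P ->
      (forall a (t x : R) (p : mom), 0 <= t <= T -> Ph < `|p| -> h a t (x, p) = 0) ->
      cbox P (fun p => vel1 0 (m a) p * ext (h a) t (x, p)).
    move=> PP HPh; apply: cboxM (cv a) _; apply: cboxW PP _.
    by apply: (cbox_ext (vp_f_C1 sh a)) => // p; exact: HPh.
  apply: (@current_diff R A e _ _ P _ P0).
  - by move=> a; exact: (Bb _ _ sg Pg).
  - by move=> a; exact: (Bb _ _ sf Pf).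
  - move=> a p /boxE pP; rewrite -mulrBr normrM !extE//; apply: ler_pM => //.
      by apply: over_gam_bound => //; apply: le_trans pP; rewrite prod_normE le_max lexx.
    exact: transport.
have claim w : S w -> D w <= 2 * 0 * expR (l * w.1).
  apply: (@contraction_bound _ _ S D (fun w => expR (l * w.1)) (Mg + Mf) 0) => //.
  - by move=> y _; exact: expR_gt0.
  - move=> y yT; apply: (@le_trans _ _ (Mg + Mf)).
      by apply: (le_trans (ler_normB _ _)); apply: lerD; [exact: HMg|exact: HMf].
    have /andP[y0 _] := yT.
    have e1 := expRM_ge1 (ltW l0) y0.
    by rewrite ler_peMr// addr_ge0.
  move=> B B0 HB [t x] tT; rewrite addr0 /D /=.
  have /andP[/= t0 tT'] := tT.
  have : `|(ext Eg t x - ext Eg t Xg) - (ext E t x - ext E t Xf)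
         - ((ext Eg 0 x - ext Eg 0 Xg) - (ext E 0 x - ext E 0 Xf))| <=
      4 * pi * C2 * B / l / l * expR (l * t).
    apply: (@exp_growth R (fun s => (ext Eg s x - ext Eg s Xg) - (ext E s x - ext E s Xf))
      (4 * pi * C2 * B / l) l t) => //.
    - by rewrite divr_ge0 ?(ltW l0)// !mulr_ge0// ltW.
    - move=> s _; apply: cvgB; apply: cvgB.
      + exact: (cont_slicel (ext_continuous (vp_E1_C1 sg))).
      + exact: (cont_slicel (ext_continuous (vp_E1_C1 sg))).
      + exact: (cont_slicel (ext_continuous (vp_E1_C1 sf))).
      + exact: (cont_slicel (ext_continuous (vp_E1_C1 sf))).
    move=> s /andP[s0 st].
    have sT : 0 < s <= T by rewrite s0 ltW// (lt_le_trans st).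
    have sT' : 0 <= s <= T by case/andP: sT => [/ltW -> ->].
    exists (- (4 * pi) * jj e (fun a => vel1 0 (m a)) g s x
        - (- (4 * pi) * jj e (fun a => vel1 0 (m a)) f s x)).
      rewrite -mulrBr normrM normrN (ger0_norm (_ : 0 <= 4 * pi)) ?mulr_ge0 ?(ltW p0)//.
      rewrite (_ : _ * expR _ = 4 * pi * (C2 * B / l * expR (l * s))); last by ring.
      by rewrite ler_wpM2l ?mulr_ge0 ?(ltW p0)//; exact: current.
    exact: (is_deriveB (DXg x s sT) (DXf x s sT)).
  rewrite !extE// !Xg0 ?Xf0 ?lexx//.
  have -> : Eg 0 x = E 0 x.
    by rewrite (vp_initial_E sg ing) (vp_initial_E sf inf).
  rewrite !subr0 subrr subr0 => H; apply: (le_trans H).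
  rewrite ler_wpM2r ?expR_ge0//.
  rewrite ler_pdivrMr// ler_pdivrMr//.
  have : 4 * pi * C2 * B <= B / 2 * l by rewrite /l; have : 0 <= B by []; lra.
  move/le_trans; apply; rewrite ler_peMr// mulr_ge0 ?(ltW l0)//; lra.
have H0 w : S w -> D w <= 0 * expR (l * w.1).
  by move=> Sy; have := claim _ Sy; rewrite mulr0.
move=> t x tT; split.
  by have := H0 (t, x) tT; rewrite mul0r normr_le0 subr_eq0 => /eqP.
move=> a p; have := transport 0 (lexx 0) H0 t x a p tT.
by rewrite mulr0 mul0r mul0r normr_le0 subr_eq0 => /eqP.
Qed.

End vlasov_poisson.

(** * Fields and mass along light lines *)

Section light_lines.
Context {R : realType}.
Local Notation mom := (R * R)%type.
Local Notation phase := (R * mom)%type.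

Lemma lineE (x a s t s' : R) : x + (s' - t) * a = (x + (s - t) * a) + (s' - s) * a.
Proof. by ring. Qed.

Lemma line_derive (u : R -> R -> R) (t x a s : R) : C1_time u -> 0 < s ->
  is_derive s 1 (fun s => ext u s (x + (s - t) * a))
    (dt (u ^~ (x + (s - t) * a)) s + a * derive1 (u s) (x + (s - t) * a)).
Proof.
move=> Cu s0; have D := ext_chain_field (x + (s - t) * a) a Cu s0.
rewrite (_ : (fun s' => ext u s' (x + (s' - t) * a)) =
  (fun s' => ext u s' (x + (s - t) * a + (s' - s) * a)))//.
by apply/funext => s'; rewrite (lineE x a s t s').
Qed.

Lemma line_cont (G : R * R -> R) (t x a s : R) :
  {for (s, x + (s - t) * a), continuous G} ->
  {for s, continuous (fun s => G (s, x + (s - t) * a))}.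
Proof.
move=> /contP cG; apply/contP => e e0; have [r r0 rP] := cG e e0.
have k0 : 0 < `|a| + 1 by rewrite ltr_wpDl.
exists (Num.min r (r / (`|a| + 1))); first by rewrite lt_min r0 divr_gt0.
move=> s'; rewrite lt_min ltr_pdivlMr// => /andP[h1 h2]; apply: rP.
rewrite prod_norm_lt/= h1/= (_ : _ - _ = (s' - s) * a); last by ring.
by rewrite normrM; apply: le_lt_trans h2; rewrite ler_wpM2l// lerDl.
Qed.

Lemma line_ext_cont (u : R -> R -> R) (t x a s : R) : C1_time u ->
  {for s, continuous (fun s => ext u s (x + (s - t) * a))}.
Proof.
move=> Cu; apply: (@line_cont (fun w : R * R => ext u w.1 w.2) t x a s).
exact: ext_continuous.
Qed.

(** The derivative [c * n - sg * j] is the rate at which mass crosses the light line, and the mass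
    potential is its primitive up to the sign [sg]. What crosses up to time [t] is at most the
    initial mass on the base of the cone, of length [2 * c * t]. *)
Lemma line_mass (c m q nb sg t x : R) (E1 E2 H : R -> R -> R) (f : R -> phase -> R) :
  0 < c -> 0 < m -> sg * sg = 1 -> 0 <= t -> C1_time f -> lucs f ->
  (forall (t : R) (z : phase), 0 < t -> material (c ^- 2) m q E1 E2 H f t z = 0) ->
  (forall (t : R) z, 0 <= t -> 0 <= f t z) ->
  (forall y, `|dens f 0 y| <= nb) ->
  exists N : R -> R, [/\ forall s, 0 <= s <= t -> {for s, continuous N},
    forall s, 0 < s < t -> is_derive s 1 N
      (c * dens f s (x + (s - t) * (sg * c)) -
       sg * cur (vel1 (c ^- 2) m) f s (x + (s - t) * (sg * c))) &
    N t - N 0 <= 2 * c * t * nb].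
Proof.
move=> c0 m0 sg2 t0 Cf Lf vf f0 nbd.
have sg1 := unit_sign sg2.
have k0 : 0 <= c ^- 2 by rewrite invr_ge0 sqr_ge0.
have ct0 : 0 <= c * t by rewrite mulr_ge0// ltW.
(* One [c * t] reaches an end of the base, two more cross it; the [1] leaves room for a
   neighbourhood. *)
pose L := `|x| + 3 * (c * t) + 1.
have [M [cM Mx Ml]] := mass_potential Cf Lf L k0 m0 vf.
have inL s (b : R) : 0 <= s <= t -> `|b| = 1 -> `|x + (s - t) * (b * c)| < L.
  move=> /andP[s0 st] b1; have := ler_normD x ((s - t) * (b * c)).
  rewrite !normrM b1 mul1r (gtr0_norm c0) (ler0_norm (_ : s - t <= 0)) ?subr_le0//.
  have : - (s - t) * c <= c * t by rewrite mulrC ler_wpM2l ?(ltW c0)//; lra.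
  by rewrite /L; lra.
have D (b s : R) : `|b| = 1 -> 0 < s <= t -> is_derive s 1 (fun s => M s (x + (s - t) * (b * c)))
    (b * c * dens f s (x + (s - t) * (b * c)) - cur (vel1 (c ^- 2) m) f s (x + (s - t) * (b * c))).
  move=> b1 /andP[s0 st]; have sL : `|x + (s - t) * (b * c)| < L by rewrite inL// ltW.
  have := Ml s _ (b * c) s0 sL.
  rewrite (_ : (fun s' => M s' (x + (s - t) * (b * c) + (s' - s) * (b * c))) =
    (fun s' => M s' (x + (s' - t) * (b * c))))//.
  by apply/funext => s'; rewrite (lineE x (b * c) s t s').
have cl (b s : R) : `|b| = 1 -> 0 <= s <= t -> {for s, continuous (fun s => M s (x + (s - t) * (b * c)))}.
  move=> b1 st; apply: (@line_cont (fun w => M w.1 w.2)); apply: cM; last exact: inL.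
  by case/andP: st.
exists (fun s => sg * M s (x + (s - t) * (sg * c))); split.
- by move=> s st; apply: cvgM; [exact: cvg_cst|exact: cl].
- move=> s /andP[s0 st]; have := is_deriveZ sg (D sg s sg1 _).
  rewrite s0 (ltW st) => /(_ isT); rewrite /GRing.scale/= mulrBr !mulrA.
  by rewrite sg2 mul1r.
(* mass is also conserved along the opposite light line *)
have up : sg * M t (x + (t - t) * (- sg * c)) <= sg * M 0 (x + (0 - t) * (- sg * c)).
  have nsg : `|- sg| = 1 by rewrite normrN.
  apply: (@le_of_deriv_le0 R (fun s => sg * M s (x + (s - t) * (- sg * c))) 0 t t0).
    by move=> s st; apply: cvgM; [exact: cvg_cst|exact: cl].
  move=> s /andP[s0 st].
  have D1 := is_deriveZ sg (D (- sg) s nsg (introT andP (conj s0 (ltW st)))).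
  eexists; last exact: D1.
  rewrite /GRing.scale/= mulrBr !mulrA mulrN sg2 mulN1r mulNr -opprD oppr_le0.
  set y := x + _.
  have [P P0 HP] := cbox_local Cf Lf s y.
  have ss : `|s - s| < 1 by rewrite subrr normr0.
  have yy : `|y - y| < 1 by rewrite subrr normr0.
  have Bf := HP s y ss yy.
  have Bv := cboxM (@continuous_vel1 R _ m k0 m0) Bf.
  rewrite -(momIZ c P0 Bf) -(momIZ sg P0 Bv) -(momID P0 (cboxZ c Bf) (cboxZ sg Bv)).
  apply: Rintegral_ge0 => p _; rewrite mulrA -mulrDl mulr_ge0//.
    by have := @flux_ge0 R c m (- sg) p c0 m0 nsg; rewrite mulNr opprK.
  by rewrite (extE f (ltW s0)); exact: (f0 s _ (ltW s0)).
have tt z : x + (t - t) * z = x by rewrite subrr mul0r addr0.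
rewrite !tt in up *.
have base : `|M 0 (x + (0 - t) * (sg * c) + 2 * (sg * (c * t))) - M 0 (x + (0 - t) * (sg * c))
    - 2 * (sg * (c * t)) * 0| <= nb * `|2 * (sg * (c * t))|.
  have hN : `|2 * (sg * (c * t))| = 2 * (c * t).
    by rewrite !normrM sg1 mul1r (gtr0_norm c0) (ger0_norm t0) ger0_norm.
  have inL' s : `|s - (x + (0 - t) * (sg * c))| < 2 * (c * t) + 2^-1 -> `|s| < L.
    move=> ss; have h0 : 0 <= (0 : R) <= t by rewrite lexx.
    have := ler_normD (s - (x + (0 - t) * (sg * c))) (x + (0 - t) * (sg * c)).
    rewrite subrK; have := ler_normD x ((0 - t) * (sg * c)).
    rewrite (_ : `|(0 - t) * (sg * c)| = c * t); last first.
      by rewrite sub0r !normrM normrN sg1 mul1r (gtr0_norm c0) (ger0_norm t0) mulrC.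
    by rewrite /L; lra.
  apply: (@mvt_remainder R (M 0) (dens f 0) _ (2 * (c * t) + 2^-1) 0 nb).
  - by move=> s /inL'; exact: Mx.
  - by move=> s _; rewrite subr0.
  - by rewrite hN; lra.
move: base; rewrite mulr0 subr0.
rewrite (_ : x + (0 - t) * (sg * c) + 2 * (sg * (c * t)) = x + (0 - t) * (- sg * c)); last by ring.
rewrite !normrM sg1 mul1r (gtr0_norm c0) (ger0_norm t0) (ger0_norm (ler0n _ 2)) => base.
have : sg * M 0 (x + (0 - t) * (- sg * c)) - sg * M 0 (x + (0 - t) * (sg * c)) <= nb * (2 * (c * t)).
  apply: le_trans base; rewrite -mulrBr (le_trans (ler_norm _))//.
  by rewrite normrM sg1 mul1r.
by move: up; lra.
Qed.

End light_lines.

(** * The relativistic system on a backward light cone *)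

Section relativistic.
Context {R : realType} {A : finType}.
Local Notation mom := (R * R)%type.
Local Notation phase := (R * mom)%type.

Lemma momI_abs_le P (g h : mom -> R) : 0 <= P -> cbox P g -> cbox P h ->
  (forall p, `|g p| <= h p) -> `|momI g| <= momI h.
Proof.
move=> P0 Bg Bh gh; rewrite ler_norml; apply/andP; split.
  rewrite -mulN1r -(momIZ (- 1) P0 Bh); apply: momI_le P0 (cboxZ (- 1) Bh) Bg _ => p.
  by rewrite mulN1r; have := gh p; rewrite ler_norml => /andP[].
apply: momI_le P0 Bg Bh _ => p; exact: le_trans (ler_norm _) (gh p).
Qed.

Definition cone (c t x : R) : set (R * R) :=
  [set w | 0 <= w.1 <= t /\ `|w.2 - x| <= c * (t - w.1)].

Lemma compact_cone (c t x : R) : 0 <= c -> compact (cone c t x).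
Proof.
move=> c0; apply: (@subclosed_compact _ _ (`[0, t] `*` `[x - c * t, x + c * t])).
- have -> : cone c t x = [set y | 0 <= y.1] `&` [set y | y.1 <= t] `&`
    [set y | `|y.2 - x| <= c * (t - y.1)].
    apply/seteqP; split=> y /=; first by move=> [/andP[]].
    by move=> [[h1 h2]] ?; split => //; rewrite h1.
  have c1 : continuous (fun y : R * R => y.1) by move=> y; exact: cvg_fst.
  do 2?[apply: closedI]; apply: closed_le_cont => //; try (by move=> y; exact: cvg_cst).
    move=> y; apply: cvg_norm; apply: cvgB; [exact: cvg_snd|exact: cvg_cst].
  move=> y; apply: cvgM; first exact: cvg_cst.
  by apply: cvgB; [exact: cvg_cst|exact: cvg_fst].
- by apply: compact_setX; exact: segment_compact.
- move=> [s y] [/= /andP[s0 st] yx].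
  have cts : c * (t - s) <= c * t by rewrite ler_wpM2l//; lra.
  have := le_trans yx cts; move=> /ler_normlP[? ?].
  by rewrite !in_itv/= s0 st; split=> //; apply/andP; split; lra.
Qed.

Lemma cone_apex (c t x : R) : 0 <= t -> cone c t x (t, x).
Proof. by move=> t0; split; rewrite /= ?t0 ?lexx// !subrr normr0 mulr0. Qed.

Lemma cone_sub (c t x : R) w : cone c t x w -> cone c w.1 w.2 `<=` cone c t x.
Proof.
move=> [/andP[w0 wt] wx] v [/andP[v0 vw] vx]; split; first by rewrite v0 (le_trans vw).
rewrite (_ : v.2 - x = (v.2 - w.2) + (w.2 - x)); last by ring.
by apply: (le_trans (ler_normD _ _)); move: wx vx; rewrite !mulrBr; lra.
Qed.

Lemma cone_line (c t x sg s : R) : 0 <= c -> `|sg| = 1 -> 0 <= s <= t ->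
  cone c t x (s, x + (s - t) * (sg * c)).
Proof.
move=> c0 sg1 /andP[s0 st]; split => /=; first by rewrite s0.
rewrite addrAC subrr add0r !normrM sg1 mul1r (ger0_norm c0) ler0_norm ?subr_le0//.
by rewrite mulrC opprB.
Qed.

Lemma domain_cone (l K c t : R) (z : phase) y : domain l K c t z y ->
  cone c t z.1 (y.1, y.2.1).
Proof. by move=> [y0 yx _ _]; split. Qed.

Variables (e m : A -> R) (f0 : A -> phase -> R) (F : A -> mom -> R) (R0 Q0 : R).
Hypothesis m_gt0 : forall a, 0 < m a.
Hypothesis data : data_assumptions e m f0 (fun=> 0) (fun=> 0) F R0 Q0.
Variable M0 : R.
Hypothesis f0M : forall a z, 0 <= f0 a z <= M0.
Let qs := \sum_a `|e a|.
Let im := \sum_a (m a)^-1.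

(** Makes the factor [gam / m] of [vel2_le_flux] at most [1 + 2 * P * im], for all species alike.
    Linearity in the support radius [P] lets the field estimate close by Gronwall. *)
Lemma mass_scale (a q P i : R) : 0 < a -> q <= P -> 0 <= P -> a^-1 <= i ->
  a + 2 * q <= (1 + 2 * P * i) * a.
Proof.
move=> a0 qP P0 ai; have h : 1 <= i * a by rewrite -(mulVf (lt0r_neq0 a0)) ler_wpM2r// ltW.
have := ler_wpM2l P0 h; rewrite mulr1 => h2.
have -> : (1 + 2 * P * i) * a = a + 2 * (P * (i * a)) by ring.
lra.
Qed.

(** Recovers [E2] and [B] from [E2 + B] and [E2 - B], the combinations that light lines control. *)
Lemma le_light (a b : R) : `|a| + `|b| <= `|a + b| + `|a - b|.
Proof.
have := ler_normD (a + b) (a - b); have := ler_normB (a + b) (a - b).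
rewrite (_ : a + b - (a - b) = 2 * b); last by ring.
rewrite (_ : a + b + (a - b) = 2 * a); last by ring.
by rewrite !normrM (ger0_norm (ler0n _ 2)); lra.
Qed.

Lemma three_fields (a b d M X Y Z : R) : a <= M + X -> b + d <= Y ->
  M + X + Y = Z -> a + b + d <= Z.
Proof. by move=> *; lra. Qed.

Lemma kinetic_gauge (d v x y z q a b h k w : R) :
  d + v * x + q * (a + k * w * h) * y + q * (b - k * v * h) * z = 0 ->
  d + v * x + q * (a + w * (k * h)) * y + q * (b - v * (k * h)) * z = 0.
Proof. by move=> E0; lra. Qed.

Section rvm_solution.
Variables (c : R) (f : A -> R -> phase -> R) (E1 E2 B : R -> R -> R).
Hypotheses (c1 : 1 <= c) (sol : RVM_solution e m c f E1 E2 B).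
Hypothesis ini : forall a x p, f a 0 (x, p) = f0 a (x, p).
Let kp := c ^- 2.
Let H (t x : R) := c^-1 * B t x.

Lemma c_gt0 : 0 < c. Proof. by apply: lt_le_trans c1. Qed.

Lemma kp_ge0 : 0 <= kp. Proof. by rewrite invr_ge0 sqr_ge0. Qed.

Lemma kp_le : kp <= c^-1.
Proof.
have c0 := c_gt0; rewrite /kp lef_pV2 ?posrE ?exprn_gt0//.
by rewrite expr2 ler_peMr// ltW.
Qed.

Lemma cV_le1 : c^-1 <= 1. Proof. by rewrite invf_le1 ?c_gt0. Qed.

Lemma rvm_material a (t : R) (z : phase) : 0 < t ->
  material kp (m a) (e a) E1 E2 H (f a) t z = 0.
Proof.
move=> t0; case: z => x p; have W := rvm_vlasov sol a x p (ltW t0).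
by rewrite V1E V2E in W; exact: kinetic_gauge W.
Qed.

Lemma rvm_lucs a : lucs (f a).
Proof.
apply: (lucs_RVM c_gt0 (m_gt0 a) (ltW (da_Q0_gt0 data)) (rvm_f_C1 sol a)
  (rvm_E1_C1 sol) (rvm_E2_C1 sol) (rvm_B_C1 sol) (@rvm_material a)).
exact: (init_support data ini).
Qed.

Lemma rvm_range a (t : R) z : 0 <= t -> 0 <= f a t z <= M0.
Proof.
move=> t0; case: z => x p.
have [K K0 HK] := slow_RVM_exists (e a) t `|x| c_gt0 (m_gt0 a) (rvm_E1_C1 sol) (rvm_E2_C1 sol) (rvm_B_C1 sol).
have tt : 0 <= t <= t by rewrite t0 lexx.
apply: (vlasov_range (rvm_f_C1 sol a) (@rvm_material a) ltr01 K0 (ltW c_gt0) t0 (HK t x p tt (lexx _))).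
by move=> [y q]; rewrite ini.
Qed.

Lemma rvm_dens0 a (x : R) : `|dens (f a) 0 x| <= (2 * Q0) ^+ 2 * M0.
Proof.
rewrite /dens extE//; apply: momI_bound (ltW (da_Q0_gt0 data)) (cbox_init data (rvm_f_C1 sol) ini a x) _ => p _.
by have /andP[h0 hM] := f0M a (x, p); rewrite ini ger0_norm.
Qed.

Let v1 a := vel1 kp (m a).
Let v2 a := vel2 kp (m a).

Lemma current1_jj (t x : R) : 0 <= t -> current1 e m c (f ^~ t) x = jj e v1 f t x.
Proof.
move=> t0; apply: eq_bigr => a _; congr (_ * momI _).
by apply/funext => p; rewrite V1E extE.
Qed.

Lemma current2_jj (t x : R) : 0 <= t -> current2 e m c (f ^~ t) x = jj e v2 f t x.
Proof.
move=> t0; apply: eq_bigr => a _; congr (_ * momI _).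
by apply/funext => p; rewrite V2E extE.
Qed.

Lemma charge_rvm (t x : R) : 0 <= t -> charge_density e (f ^~ t) x = rr e f t x.
Proof. by move=> t0; apply: eq_bigr => a _; rewrite /dens extE. Qed.

(** Ampere's law plus [sg] times Faraday's: as [sg * sg = 1], the space derivatives combine into
    transport of [E2 + sg * B] at velocity [sg * c]. *)
Lemma light_sum (sg d2 b2 d b j : R) : sg * sg = 1 -> d2 + c * b = - (4 * pi * j) ->
  b2 + c * d = 0 -> d2 + sg * c * d + sg * (b2 + sg * c * b) = - (4 * pi) * j.
Proof.
move=> sg2 e1 e2.
have -> : d2 + sg * c * d + sg * (b2 + sg * c * b) = (d2 + (sg * sg) * (c * b)) + sg * (b2 + c * d).
  by ring.
by rewrite sg2 e2 mul1r e1 mulr0 addr0 mulNr.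
Qed.

Lemma rvm_light (sg t x s : R) : sg * sg = 1 -> 0 < s ->
  is_derive s 1 (fun s => ext E2 s (x + (s - t) * (sg * c)) + sg * ext B s (x + (s - t) * (sg * c)))
    (- (4 * pi) * jj e v2 f s (x + (s - t) * (sg * c))).
Proof.
move=> sg2 s0.
have D2 := line_derive t x (sg * c) (rvm_E2_C1 sol) s0.
have DB := line_derive t x (sg * c) (rvm_B_C1 sol) s0.
have := is_deriveD D2 (is_deriveZ sg DB).
have a2 := rvm_ampere2 sol (x + (s - t) * (sg * c)) (ltW s0).
have fa := rvm_faraday sol (x + (s - t) * (sg * c)) (ltW s0).
rewrite (current2_jj _ (ltW s0)) in a2.
move=> D; have := light_sum sg2 a2 fa => E; rewrite -E; exact: D.
Qed.

(** [E1] is integrated along a light line too: Gauss and Ampere together give the source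
    [c * rho - j1], in which each species contributes its charge times a nonnegative flux bounded by
    mass. At fixed [x] no such bound on [j1] is at hand. *)
Lemma rvm_light_E1 (t x s : R) : 0 < s ->
  is_derive s 1 (fun s => ext E1 s (x + (s - t) * (1 * c)))
    (4 * pi * (c * rr e f s (x + (s - t) * (1 * c)) - jj e v1 f s (x + (s - t) * (1 * c)))).
Proof.
move=> s0; have D := line_derive t x (1 * c) (rvm_E1_C1 sol) s0.
have a1 := rvm_ampere1 sol (x + (s - t) * (1 * c)) (ltW s0).
have ga := rvm_gauss sol (x + (s - t) * (1 * c)) (ltW s0).
rewrite (current1_jj _ (ltW s0)) in a1; rewrite (charge_rvm _ (ltW s0)) in ga.
rewrite a1 ga in D; apply: (is_derive_eq D).
by ring.
Qed.

Lemma rvm_E1_derive (x s : R) : 0 < s ->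
  is_derive s 1 (fun s => ext E1 s x) (- (4 * pi) * jj e v1 f s x).
Proof.
move=> s0; have D := ext_dt x (rvm_E1_C1 sol) s0.
have a1 := rvm_ampere1 sol x (ltW s0); rewrite (current1_jj _ (ltW s0)) in a1.
by rewrite a1 in D; rewrite mulNr.
Qed.

Lemma rvm_slow_cone (Bd l t x : R) a : 0 < l -> 0 <= Bd ->
  (forall w, cone c t x w -> `|E1 w.1 w.2| + `|E2 w.1 w.2| + `|B w.1 w.2| <= Bd * expR (l * w.1)) ->
  forall w (p : mom), cone c t x w -> slow kp (m a) (e a) E1 E2 H l (qs * Bd + 1) c w.1 (w.2, p).
Proof.
move=> l0 Bd0 HB w p cw.
apply: (@slow_RVM R c (m a) (e a) E1 E2 B (fun s => Bd * expR (l * s))) => //.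
- exact: c_gt0.
- by move=> y Dy _; apply: HB (y.1, y.2.1) _; apply: (cone_sub cw); exact: domain_cone Dy.
- move=> s _; rewrite mulrA ltr_pM2r ?expR_gt0//.
  apply: (@le_lt_trans _ _ (qs * Bd)); last by rewrite ltrDl.
  by rewrite ler_wpM2r// qsum_ge.
Qed.

Lemma rvm_supp_cone (Bd l t x : R) a : 0 < l -> 0 <= Bd ->
  (forall w, cone c t x w -> `|E1 w.1 w.2| + `|E2 w.1 w.2| + `|B w.1 w.2| <= Bd * expR (l * w.1)) ->
  forall w (p : mom), cone c t x w -> Q0 + (qs * Bd + 1) / l * expR (l * w.1) <= `|p| ->
  f a w.1 (w.2, p) = 0.
Proof.
move=> l0 Bd0 HB w p cw Qp; have [/andP[w0 _] _] := cw.
have K0 : 0 < qs * Bd + 1 by rewrite ltr_wpDl// mulr_ge0// qsum_ge0.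
have S := vlasov_support (rvm_f_C1 sol a) (@rvm_material a) l0 K0 (ltW c_gt0) w0
  (rvm_slow_cone a l0 Bd0 HB cw) (init_support data ini a).
exact: (S p Qp).
Qed.

(* On the momentum support [|V2| <= Z (c - sg V1)], so that the source of
   [E2 + sg B] along a light line is paid for by the mass crossing that line. *)
Lemma rvm_field_step (T ME Bd l t x : R) : 0 < l -> 0 <= Bd -> 0 <= t <= T -> 0 <= T ->
  (forall x, `|E1 0 x| <= ME) -> (forall x, E2 0 x = 0) -> (forall x, B 0 x = 0) ->
  (forall w, cone c t x w -> `|E1 w.1 w.2| + `|E2 w.1 w.2| + `|B w.1 w.2| <= Bd * expR (l * w.1)) ->
  `|E1 t x| + `|E2 t x| + `|B t x| <=
    ME + 4 * pi * qs * (2 * c * T * ((2 * Q0) ^+ 2 * M0)) *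
      (3 + 4 * im * (Q0 + (qs * Bd + 1) / l * expR (l * t))).
Proof.
move=> l0 Bd0 /andP[t0 tT] T0 iE1 iE2 iB HB.
have c0 := c_gt0; have Q00 := ltW (da_Q0_gt0 data); have p0 := pi_gt0 R.
have qs0 : 0 <= qs := qsum_ge0 e.
have im0 : 0 <= im := im_ge0 m_gt0.
have k01 : 0 <= kp <= 1 by rewrite kp_ge0 (le_trans kp_le)// cV_le1.
set P := Q0 + _.
have P0 : 0 <= P.
  by rewrite addr_ge0// mulr_ge0 ?expR_ge0// divr_ge0 ?(ltW l0)// addr_ge0// mulr_ge0.
pose Z := 1 + 2 * P * im.
have Z0 : 0 <= Z by rewrite addr_ge0// !mulr_ge0.
set nb := (2 * Q0) ^+ 2 * M0.
have nb0 (a : A) : 0 <= nb by exact: le_trans (normr_ge0 _) (rvm_dens0 a 0).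
have fge a (s : R) z : 0 <= s -> 0 <= f a s z by move=> s0; case/andP: (rvm_range a z s0).
have cb a s y : 0 <= s -> s <= t -> cone c t x (s, y) -> cbox P (fun p => ext (f a) s (y, p)).
  move=> s0 st cs; apply: (cbox_ext (rvm_f_C1 sol a) s0) => p Pp; apply: (rvm_supp_cone a l0 Bd0 HB cs) => /=.
  apply: le_trans (ltW Pp); rewrite /P lerD2l ler_wpM2l//.
    by rewrite divr_ge0 ?(ltW l0)// addr_ge0// mulr_ge0.
  by rewrite ler_expR ler_wpM2l// ltW.
have flux a sg s y : `|sg| = 1 -> 0 <= s -> s <= t -> cone c t x (s, y) ->
    c * dens (f a) s y - sg * cur (v1 a) (f a) s y = momI (fun p => (c - sg * v1 a p) * ext (f a) s (y, p)).
  move=> sg1 s0 st cs; have Bf := cb a s y s0 st cs.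
  have Bv := cboxM (@continuous_vel1 R kp (m a) kp_ge0 (m_gt0 a)) Bf.
  rewrite -(momIZ c P0 Bf) -(momIZ sg P0 Bv) -(momIB P0 (cboxZ c Bf) (cboxZ sg Bv)).
  by congr momI; apply/funext => p; rewrite mulrBl mulrA.
have Bflux a sg s y : 0 <= s -> s <= t -> cone c t x (s, y) ->
    cbox P (fun p => (c - sg * v1 a p) * ext (f a) s (y, p)).
  move=> s0 st cs; apply: cboxM (cb a s y s0 st cs) => p.
  apply: cvgB; first exact: cvg_cst.
  by apply: cvgM; [exact: cvg_cst|exact: continuous_vel1 kp_ge0 (m_gt0 a) p].
(* Whatever grows along the line no faster than [k] times the crossing flux, weighted by [|e a|],
   gains at most [k * qs] times the mass bound of [line_mass]. *)
have grow (sg k : R) (g : R -> R) : sg * sg = 1 -> 0 <= k -> (forall s, {for s, continuous g}) ->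
    (forall s, 0 < s < t -> exists2 d, is_derive s 1 g d &
      `|d| <= k * \sum_a `|e a| * (c * dens (f a) s (x + (s - t) * (sg * c)) -
        sg * cur (v1 a) (f a) s (x + (s - t) * (sg * c)))) ->
    `|g t - g 0| <= k * qs * (2 * c * T * nb).
  move=> sg2 k0 cg Dg.
  have /choice[N HN] := fun a => @line_mass R c (m a) (e a) nb sg t x E1 E2 H (f a) c0
    (m_gt0 a) sg2 t0 (rvm_f_C1 sol a) (@rvm_lucs a) (@rvm_material a) (fge a) (rvm_dens0 a).
  have := @deriv_growth R g (fun s => k * \sum_a `|e a| * N a s) 0 t t0 (fun s _ => cg s).
  move=> /(_ _ _)/le_trans; apply.
  - move=> s st; apply: cvgM; first exact: cvg_cst.
    apply: continuous_fsum => a; apply: cvgM; first exact: cvg_cst.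
    by have [cN _ _] := HN a; exact: cN.
  - move=> s st; have [d Dd dle] := Dg s st; eexists; eexists; split; [exact: dle|exact: Dd|].
    apply: is_deriveZ; apply: is_derive_fsum => a; apply: is_deriveZ.
    by have [_ DN _] := HN a; exact: DN.
  rewrite -mulrBr -sumrB -[X in _ <= X]mulrA ler_wpM2l// mulr_suml.
  apply: ler_sum => a _; rewrite -mulrBr ler_wpM2l//.
  have [_ _ Nm] := HN a; apply: (le_trans Nm); rewrite ler_wpM2r ?(nb0 a)// ler_wpM2l//.
  by rewrite mulr_ge0// ltW.
have light (sg : R) : sg * sg = 1 -> `|E2 t x + sg * B t x| <= 4 * pi * Z * qs * (2 * c * T * nb).
  move=> sg2; have sg1 := unit_sign sg2.
  have := grow sg (4 * pi * Z)
    (fun s => ext E2 s (x + (s - t) * (sg * c)) + sg * ext B s (x + (s - t) * (sg * c))) sg2.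
  rewrite !extE// iE2 iB mulr0 addr0 subr0 subrr mul0r addr0; apply.
  - by rewrite mulr_ge0// mulr_ge0// ltW.
  - move=> s; apply: cvgD.
      exact: (@line_ext_cont _ E2 t x (sg * c) s (rvm_E2_C1 sol)).
    apply: cvgM; first exact: cvg_cst.
    exact: (@line_ext_cont _ B t x (sg * c) s (rvm_B_C1 sol)).
  move=> s /andP[s0 st]; set y := x + _.
  have cs : cone c t x (s, y) by apply: (cone_line x (ltW c0) sg1); rewrite !ltW.
  exists (- (4 * pi) * jj e v2 f s y); first exact: rvm_light.
  rewrite normrM normrN (ger0_norm (_ : 0 <= 4 * pi)) ?mulr_ge0 ?(ltW p0)//.
  rewrite -mulrA ler_wpM2l ?mulr_ge0 ?(ltW p0)// mulr_sumr.
  apply: (le_trans (ler_norm_sum _ _ _)); apply: ler_sum => a _.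
  rewrite normrM mulrCA ler_wpM2l// flux ?(ltW s0) ?(ltW st)//.
  have Bx := Bflux a sg s y (ltW s0) (ltW st) cs; have Bf := cb a s y (ltW s0) (ltW st) cs.
  rewrite -(momIZ Z P0 Bx); apply: (momI_abs_le P0 _ (cboxZ Z Bx)).
    exact: cboxM (@continuous_vel2 R kp (m a) kp_ge0 (m_gt0 a)) Bf.
  move=> p; rewrite normrM mulrA.
  have [pP|Pp] := leP `|p| P; last by rewrite (Bf.2 p Pp) normr0 !mulr0.
  have f00 : 0 <= ext (f a) s (y, p) by rewrite (extE _ (ltW s0)); exact: fge (ltW s0).
  rewrite (ger0_norm f00) ler_wpM2r//.
  apply: le_trans (vel2_le_flux p c0 (m_gt0 a) sg1) _.
  rewrite ler_wpM2r ?flux_ge0// ler_pdivrMr//.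
  apply: (le_trans (gam_le p k01 (m_gt0 a))).
  exact: (mass_scale (m_gt0 a) pP P0 (im_ge m_gt0 a)).
have E1b : `|E1 t x| <= ME + 4 * pi * qs * (2 * c * T * nb).
  have sg1 : `|1 : R| = 1 := normr1 _.
  apply: (le_trans (_ : _ <= `|E1 0 (x + (0 - t) * (1 * c))| + `|E1 t x - E1 0 (x + (0 - t) * (1 * c))|)).
    by rewrite -[X in `|X| <= _](subrK (E1 0 (x + (0 - t) * (1 * c)))) addrC ler_normD.
  apply: lerD; first exact: iE1.
  have := grow 1 (4 * pi) (fun s => ext E1 s (x + (s - t) * (1 * c))) (mulr1 _).
  rewrite !extE// subrr mul0r addr0; apply.
  - by rewrite mulr_ge0// ltW.
  - by move=> s; exact: (@line_ext_cont _ E1 t x (1 * c) s (rvm_E1_C1 sol)).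
  move=> s /andP[s0 st]; set y := x + _.
  have cs : cone c t x (s, y) by apply: (cone_line x (ltW c0) sg1); rewrite !ltW.
  exists (4 * pi * (c * rr e f s y - jj e v1 f s y)); first exact: rvm_light_E1.
  rewrite normrM (ger0_norm (_ : 0 <= 4 * pi)) ?mulr_ge0 ?(ltW p0)//.
  rewrite ler_wpM2l ?mulr_ge0 ?(ltW p0)// /rr /jj mulr_sumr -sumrB.
  apply: (le_trans (ler_norm_sum _ _ _)); apply: ler_sum => a _.
  rewrite mulrCA -mulrBr normrM ler_wpM2l// mul1r.
  rewrite -[X in c * _ - X]mul1r flux ?(ltW s0) ?(ltW st)// ger0_norm//.
  apply: Rintegral_ge0 => p _; rewrite mulr_ge0//; first exact: flux_ge0.
  by rewrite (extE _ (ltW s0)); exact: fge (ltW s0).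
have L1 := light 1 (mulr1 _).
have L2 : `|E2 t x - B t x| <= 4 * pi * Z * qs * (2 * c * T * nb).
  by rewrite -mulN1r; apply: light; rewrite mulrNN mulr1.
rewrite mul1r in L1.
have E2B := le_light (E2 t x) (B t x).
(* [E1] contributes one share and the two light combinations [Z] shares each:
   [1 + 2 * Z = 3 + 4 * im * P]. *)
apply: (three_fields E1b (le_trans E2B (lerD L1 L2))).
by rewrite /Z; ring.
Qed.

End rvm_solution.

(** The base of the cone, and with it the mass that can cross a light line, grows linearly in [c];
    hence the upper limit [c0]. *)
Lemma rvm_apriori (T c0 ME : R) : 0 <= T -> 1 <= c0 -> 0 <= ME -> 0 <= M0 ->
  exists2 C : R, 0 <= C & forall c f E1 E2 B, 1 <= c <= c0 ->
  RVM_solution e m c f E1 E2 B -> (forall a x p, f a 0 (x, p) = f0 a (x, p)) ->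
  (forall x, `|E1 0 x| <= ME) -> (forall x, E2 0 x = 0) -> (forall x, B 0 x = 0) ->
  forall t x : R, 0 <= t <= T -> `|E1 t x| + `|E2 t x| + `|B t x| <= C.
Proof.
move=> T0 c01 ME0 M00.
have Q00 := ltW (da_Q0_gt0 data); have p0 := pi_gt0 R.
have qs0 : 0 <= qs := qsum_ge0 e.
have im0 : 0 <= im := im_ge0 m_gt0.
pose G := 4 * pi * qs * (2 * c0 * T * ((2 * Q0) ^+ 2 * M0)).
have G0 : 0 <= G by rewrite !mulr_ge0// ?sqr_ge0 ?(ltW p0)//; lra.
(* The field step is affine in [Bd] with coefficient [4 * G * im * qs / l] in front of the weight,
   here at most [1 / 2]. *)
pose l := 8 * G * im * qs + 1.
have Gq : 0 <= 8 * G * im * qs by apply: mulr_ge0 qs0; apply: mulr_ge0 im0; apply: mulr_ge0 G0.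
have l1 : 1 <= l by rewrite /l lerDr.
have l0 : 0 < l by lra.
pose a := ME + G * (3 + 4 * im * Q0) + 4 * G * im.
have im4 : 0 <= 3 + 4 * im * Q0.
  by apply: addr_ge0 => //; apply: mulr_ge0 Q00; apply: mulr_ge0 im0.
have Gi : 0 <= 4 * G * im by apply: mulr_ge0 im0; apply: mulr_ge0 G0.
have a0 : 0 <= a by apply: addr_ge0 Gi; apply: addr_ge0 ME0 _; apply: mulr_ge0.
exists (2 * a * expR (l * T)); first by rewrite !mulr_ge0// expR_ge0.
move=> c f E1 E2 B /andP[c1 cc] sol ini iE1 iE2 iB t x /andP[t0 tT].
have cp : 0 < c by lra.
pose D (w : R * R) := `|ext E1 w.1 w.2| + `|ext E2 w.1 w.2| + `|ext B w.1 w.2|.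
have cD : continuous D.
  move=> w; apply: cvgD; first apply: cvgD; apply: cvg_norm.
  - exact: (ext_continuous (rvm_E1_C1 sol)).
  - exact: (ext_continuous (rvm_E2_C1 sol)).
  - exact: (ext_continuous (rvm_B_C1 sol)).
(* Compactness of the cone makes the weighted supremum finite; the bound obtained from the
   contraction no longer depends on [(t, x)]. *)
have [M MM0 HM] := cont_bounded (@compact_cone c t x (ltW cp)) cD.
have DE w : cone c t x w -> D w = `|E1 w.1 w.2| + `|E2 w.1 w.2| + `|B w.1 w.2|.
  by move=> [/andP[w0 _] _]; rewrite /D !extE.
have claim w : cone c t x w -> D w <= 2 * a * expR (l * w.1).
  apply: (@contraction_bound _ _ (cone c t x) D (fun w => expR (l * w.1)) M a) => //.
  - by move=> y _; exact: expR_gt0.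
  - move=> y cy; apply: (le_trans (ler_norm _)); apply: (le_trans (HM y cy)).
    have [/andP[y0 _] _] := cy.
    have e1 := expRM_ge1 (ltW l0) y0.
    by rewrite ler_peMr.
  move=> Bd Bd0 HB v cv; rewrite DE//.
  have [/andP[v0 vt] _] := cv.
  have vT : 0 <= v.1 <= T by rewrite v0 (le_trans vt).
  have HB' w' : cone c v.1 v.2 w' -> `|E1 w'.1 w'.2| + `|E2 w'.1 w'.2| + `|B w'.1 w'.2| <= Bd * expR (l * w'.1).
    by move=> /(cone_sub cv) cw'; rewrite -DE//; exact: HB.
  apply: (le_trans (rvm_field_step c1 sol ini l0 Bd0 vT T0 iE1 iE2 iB HB')).
  have e1 := expRM_ge1 (ltW l0) v0.
  set ev := expR (l * v.1) in e1 *.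
  pose Y := 3 + 4 * im * (Q0 + (qs * Bd + 1) / l * ev).
  have Y0 : 0 <= Y.
    rewrite addr_ge0// !mulr_ge0// addr_ge0// mulr_ge0//; last by lra.
    by rewrite divr_ge0 ?(ltW l0)// addr_ge0// mulr_ge0.
  apply: (@le_trans _ _ (ME + G * Y)).
    rewrite lerD2l ler_wpM2r// /G ler_wpM2l ?mulr_ge0 ?(ltW p0)//.
    rewrite ler_wpM2r ?mulr_ge0 ?sqr_ge0// ler_wpM2r// ler_wpM2l//.
  have EY : ME + G * Y = ME + G * (3 + 4 * im * Q0) + 4 * G * im * qs * Bd / l * ev + 4 * G * im / l * ev.
    by rewrite /Y; field; exact: lt0r_neq0.
  rewrite EY.
  have h1 : 4 * G * im * qs * Bd / l <= Bd / 2.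
    rewrite ler_pdivrMr// /l.
    have : 0 <= Bd by [].
    have -> : Bd / 2 * (8 * G * im * qs + 1) = 4 * G * im * qs * Bd + Bd / 2 by field.
    by lra.
  have h2 : 4 * G * im / l <= 4 * G * im by rewrite ler_pdivrMr// ler_peMr// !mulr_ge0.
  have h3 : ME + G * (3 + 4 * im * Q0) <= (ME + G * (3 + 4 * im * Q0)) * ev.
    by rewrite ler_peMr// addr_ge0// mulr_ge0// addr_ge0// !mulr_ge0.
  have ev0 : 0 <= ev by lra.
  have h4 := ler_wpM2r ev0 h1; have h5 := ler_wpM2r ev0 h2.
  by rewrite /a !mulrDl; rewrite !mulrDl in h3; lra.
have := claim _ (cone_apex c x t0); rewrite DE//=; last exact: cone_apex.
move/le_trans; apply; rewrite ler_wpM2l ?mulr_ge0// ler_expR ler_wpM2l//.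
exact: ltW.
Qed.

End relativistic.

(** * Scalar inequalities for the comparison *)

Section estimates.
Context {R : realType}.
Local Notation mom := (R * R)%type.

Lemma ext_slice (u : R -> R -> R) (x s : R) : C1_time u ->
  {for s, continuous (fun s => ext u s x)}.
Proof. by move=> Cu; exact: (@cont_slicel _ _ (ext u) x (ext_continuous Cu)). Qed.

Lemma mom_cont1 : continuous (fst : mom -> R). Proof. by move=> p; exact: cvg_fst. Qed.

Lemma mom_cont2 : continuous (snd : mom -> R). Proof. by move=> p; exact: cvg_snd. Qed.

Lemma mom_norm1 (p : mom) : `|p.1| <= `|p|.
Proof. by rewrite prod_normE le_max lexx. Qed.

Lemma mom_norm2 (p : mom) : `|p.2| <= `|p|.
Proof. by rewrite prod_normE le_max lexx orbT. Qed.

(** Here [s], [y1], [y2], [y3] are derivatives of the limit density, [v] is the classical velocity,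
    [u1] and [u2] are the relativistic ones, and [d] is [B / c]. Subtracting the limit equation
    leaves the velocity error and the deviation of the fields. *)
Lemma convective_error (v v2 w q a b d y1 y2 y3 u1 u2 k Lp s g : R) :
  s + v * y1 + q * (a + v2 * 0) * y2 + q * (0 - v * 0) * y3 = 0 ->
  `|y1| <= Lp -> `|y2| <= Lp -> `|y3| <= Lp -> `|u1 - v| <= k ->
  `|u1 * d| <= g -> `|u2 * d| <= g ->
  `|s + u1 * y1 + q * (b + u2 * d) * y2 + q * (w - u1 * d) * y3| <=
  Lp * k + 2 * (`|q| * Lp) * (`|b - a| + `|w| + g).
Proof.
move=> E0 h1 h2 h3 hv hu1 hu2.
have -> : s + u1 * y1 + q * (b + u2 * d) * y2 + q * (w - u1 * d) * y3 =
    (u1 - v) * y1 + q * (b - a + u2 * d) * y2 + q * (w - u1 * d) * y3.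
  rewrite -[RHS]add0r -E0; ring.
have Lp0 : 0 <= Lp := le_trans (normr_ge0 _) h1.
have g0 : 0 <= g := le_trans (normr_ge0 _) hu1.
set b' := b - a.
have k1 : `|(u1 - v) * y1| <= Lp * k by rewrite normrM mulrC ler_pM.
have k2 : `|q * (b' + u2 * d) * y2| <= `|q| * (`|b'| + `|w| + g) * Lp.
  rewrite !normrM ler_pM ?mulr_ge0// ler_wpM2l//.
  by apply: (le_trans (ler_normD _ _)); have := normr_ge0 w; lra.
have k3 : `|q * (w - u1 * d) * y3| <= `|q| * (`|b'| + `|w| + g) * Lp.
  rewrite !normrM ler_pM ?mulr_ge0// ler_wpM2l//.
  by apply: (le_trans (ler_normB _ _)); have := normr_ge0 b'; lra.
have n1 := ler_normD ((u1 - v) * y1 + q * (b' + u2 * d) * y2) (q * (w - u1 * d) * y3).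
have n2 := ler_normD ((u1 - v) * y1) (q * (b' + u2 * d) * y2).
have -> : 2 * (`|q| * Lp) * (`|b'| + `|w| + g) = `|q| * (`|b'| + `|w| + g) * Lp + `|q| * (`|b'| + `|w| + g) * Lp by ring.
lra.
Qed.

Lemma growth_derive (k l b s : R) : 0 < l ->
  is_derive s 1 (fun s => k / l * expR (l * s) + b * s) (k * expR (l * s) + b).
Proof.
move=> l0; have D1 := is_deriveZ (k / l) (is_derive_expRM l s).
have D2 := is_deriveZ b (is_derive_id s 1).
apply: (is_derive_eq (is_deriveD D1 D2)).
by rewrite /GRing.scale/= mulr1 (mulrA _ l) divfK// lt0r_neq0.
Qed.

Lemma growth_cont (k l b : R) : continuous (fun s : R => k / l * expR (l * s) + b * s).
Proof.
move=> s; apply: cvgD; apply: cvgM; try exact: cvg_cst; last exact: cvg_id.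
exact: cont_expRM.
Qed.

Lemma sum_bound (a u v k j : R) : a <= u + v -> v <= j -> u <= k -> a <= k + j.
Proof. by move=> *; lra. Qed.

Lemma increments (u v w a d j : R) : u - v <= w -> a - d <= j ->
  u + a - (v + d) <= w + j.
Proof. by move=> *; lra. Qed.

(** With [q = pi]: [E1], [E2 + B] and [E2 - B] contribute [4 * q] each, and [12 * q * G] against
    [l = 24 * q * G + 1] gives the factor [1 / 2]. *)
Lemma close_step (a u v q G r J l Bd ev tau c : R) : 0 < q -> 0 < c -> 0 <= G -> 0 <= Bd ->
  0 <= r -> 0 <= tau -> 0 <= J -> l = 24 * q * G + 1 -> 1 <= ev ->
  a <= 4 * q * (G * Bd / l / l * ev + r / c * tau) ->
  u + v <= 4 * q * (G * Bd / l / l * ev + r / c * tau + J / c * q) +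
           4 * q * (G * Bd / l / l * ev + r / c * tau + J / c * q) ->
  a + u + v <= (Bd / 2 + (12 * q * (r * tau) + 8 * q * (J * q)) / c) * ev.
Proof.
move=> q0 c0 G0 Bd0 r0 tau0 J0 lE e1 h1 h2.
have qG : 0 <= q * G by rewrite mulr_ge0// ltW.
have l1 : 1 <= l by rewrite lE lerDr -mulrA mulr_ge0.
have l0 : 0 < l by exact: lt_le_trans l1.
have ev0 : 0 <= ev by exact: le_trans e1.
have k1 : 12 * (q * G * Bd) / l / l <= Bd / 2.
  rewrite ler_pdivrMr// ler_pdivrMr//.
  have : Bd / 2 * l <= Bd / 2 * l * l by rewrite ler_peMr// mulr_ge0 ?(ltW l0)// divr_ge0.
  apply: le_trans; rewrite lE.
  have -> : Bd / 2 * (24 * q * G + 1) = 12 * (q * G * Bd) + Bd / 2 by field.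
  by rewrite lerDl divr_ge0.
have k2 := ler_wpM2r ev0 k1.
pose z := (12 * q * (r * tau) + 8 * q * (J * q)) / c.
have z0 : 0 <= z.
  by rewrite /z divr_ge0 ?(ltW c0)// addr_ge0// !mulr_ge0// ltW.
have k3 : z <= z * ev by rewrite ler_peMr.
rewrite mulrDl -/z.
have -> : a + u + v = a + (u + v) by rewrite addrA.
apply: (le_trans (lerD h1 h2)).
apply: (@le_trans _ _ (12 * (q * G * Bd) / l / l * ev + z)); last by lra.
rewrite le_eqVlt; apply/orP; left; apply/eqP; rewrite /z; field.
by rewrite !lt0r_neq0.
Qed.

Lemma rate_sum (d a u v q C r k Cw t' tau ev eT s : R) : 0 < s -> 0 < r -> 0 <= q -> 0 <= C ->
  0 <= k -> 0 <= Cw -> 0 <= t' -> t' <= tau -> ev <= eT -> 0 <= ev ->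
  d <= 2 * q * (2 * (C / s)) / r * ev + k * (Cw / s) * t' ->
  a + u + v <= 2 * (C / s) * ev ->
  d + a + u + v <= (4 * q * C / r * eT + k * Cw * tau + 2 * C * eT) / s.
Proof.
move=> s0 r0 q0 C0 k0 Cw0 t0 tt ee ev0 h1 h2.
have b1 : 4 * q * C / r * ev <= 4 * q * C / r * eT.
  by rewrite ler_wpM2l// divr_ge0 ?(ltW r0)// !mulr_ge0.
have b2 : k * Cw * t' <= k * Cw * tau by rewrite ler_wpM2l// mulr_ge0.
have b3 : 2 * C * ev <= 2 * C * eT by rewrite ler_wpM2l// mulr_ge0.
have -> : d + a + u + v = d + (a + u + v) by ring.
apply: (le_trans (lerD h1 h2)).
apply: (@le_trans _ _ ((4 * q * C / r * ev + k * Cw * t' + 2 * C * ev) / s)).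
  rewrite le_eqVlt; apply/orP; left; apply/eqP; field.
  by rewrite !lt0r_neq0.
rewrite ler_wpM2r ?invr_ge0 ?(ltW s0)//; lra.
Qed.

Lemma le_speed (c v b : R) : 0 < c -> `|v| <= c -> `|v * (c^-1 * b)| <= `|b|.
Proof.
move=> c0 vc; rewrite mulrA normrM ler_piMl// normrM normfV (gtr0_norm c0).
by rewrite ler_pdivrMr// mul1r.
Qed.

Lemma weighted_close (u v0 g k X d M' : R) : `|u| <= X -> `|u - v0| <= d -> `|k| <= M' ->
  `|u * g - v0 * k| <= X * `|g - k| + d * M'.
Proof.
move=> uX ud kM; have -> : u * g - v0 * k = u * (g - k) + (u - v0) * k by ring.
apply: (le_trans (ler_normD _ _)); rewrite !normrM.
by apply: lerD; [rewrite ler_wpM2r|rewrite ler_pM].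
Qed.

End estimates.

(** * Comparison of the two systems for large [c] *)

Section comparison.
Context {R : realType} {A : finType}.
Local Notation mom := (R * R)%type.
Local Notation phase := (R * mom)%type.
Variables (e m : A -> R) (f0 : A -> phase -> R) (F : A -> mom -> R) (R0 Q0 : R).
Hypothesis m_gt0 : forall a, 0 < m a.
Hypothesis data : data_assumptions e m f0 (fun=> 0) (fun=> 0) F R0 Q0.
Variable M0 : R.
Hypotheses (M0_ge0 : 0 <= M0) (f0M : forall a z, 0 <= f0 a z <= M0).
Let qs := \sum_a `|e a|.
Let im := \sum_a (m a)^-1.

(** Used with [k = c ^- 2] and [d = c^-1]: only the first order is kept, which matches the other
    errors. *)
Lemma vel_close (k S d x : R) a (p : mom) : 0 <= k <= d -> `|p| <= S -> `|x| <= S ->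
  `|x / gam k (m a) p - x / gam 0 (m a) p| <= 2 * S ^+ 3 * im ^+ 3 * d.
Proof.
move=> /andP[k0 kd] pS xS; have m0 := m_gt0 a.
apply: (le_trans (vel_classical x p k0 m0)).
have S0 : 0 <= S by apply: le_trans (normr_ge0 _) xS.
have sqle (y : R) : `|y| <= `|p| -> y ^+ 2 <= S ^+ 2.
  by move=> yp; rewrite -[y ^+ 2]real_normK ?num_real// ler_pXn2r ?nnegrE// (le_trans yp).
have p1 : p.1 ^+ 2 <= S ^+ 2 by apply: sqle; rewrite prod_normE le_max lexx.
have p2 : p.2 ^+ 2 <= S ^+ 2 by apply: sqle; rewrite prod_normE le_max lexx orbT.
have i3 : (m a) ^- 3 <= im ^+ 3.
  by rewrite -exprVn ler_pXn2r ?nnegrE ?im_ge ?im_ge0// invr_ge0 ltW.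
have -> : 2 * S ^+ 3 * im ^+ 3 * d = S * (d * (S ^+ 2 + S ^+ 2)) * im ^+ 3 by ring.
have pp : 0 <= p.1 ^+ 2 + p.2 ^+ 2 by rewrite addr_ge0// sqr_ge0.
apply: ler_pM => //; first by rewrite mulr_ge0// mulr_ge0.
  by rewrite invr_ge0 exprn_ge0// ltW.
apply: ler_pM => //; first by rewrite mulr_ge0.
by apply: ler_pM => //; exact: lerD.
Qed.

Variables (h : A -> R -> phase -> R) (Eo : R -> R -> R).
Hypothesis solV : VP_solution e m h Eo.
Hypothesis iniV : forall a x p, h a 0 (x, p) = f0 a (x, p).
Variables (T M Po L : R).
Hypotheses (T_ge0 : 0 <= T) (M_ge0 : 0 <= M) (QPo : Q0 <= Po) (L_ge0 : 0 <= L).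
Hypothesis EoM : forall t x : R, 0 <= t <= T -> `|Eo t x| <= M.
Hypothesis hP : forall a (t x : R) (p : mom), 0 <= t <= T -> Po < `|p| -> h a t (x, p) = 0.
Hypothesis hL : forall a (t : R) z, 0 <= t <= T ->
  [/\ `|dx (h a t) z| <= L, `|dp1 (h a t) z| <= L & `|dp2 (h a t) z| <= L].
(** While the deviation of the fields is at most 1, [K1] bounds the forces and [P] the momentum
    support of [f]. A backward domain starting at [|p| <= P] meets momenta up to [S], so the
    velocity error [Cv / c] is taken there. *)
Let K1 := qs * (M + 1) + 1.
Let P := Po + K1 * expR T.
Let S := P + K1 * expR T.
Let Cv := 2 * S ^+ 3 * im ^+ 3.

Let w1 a := vel1 0 (m a).
Let w2 a := vel2 0 (m a).
Variables (Rf X : R).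
Hypothesis hRf : forall s y : R, 0 <= s <= T -> Rf <= `|y| -> jj e w2 h s y = 0.
Hypothesis EoX : forall s, 0 <= s <= T -> Eo s X = 0.
Hypothesis ampere : forall y s, 0 < s <= T ->
  is_derive s 1 (fun s => ext Eo s y - ext Eo s X) (- (4 * pi) * jj e w1 h s y).
(** [J / (1 + y ^ 2)] bounds the transverse limit current. In the difference of currents [G] goes
    with the deviation and [A2] with [1 / c]. Then [lam] is the Gronwall rate, [C3 / c] the
    inhomogeneous term, [C4 / c] the final bound on the deviation up to [T]. *)
Let J := qs * (2 * P) ^+ 2 * (P * im * M0) * (1 + Rf ^+ 2).
Let G := qs * (2 * P) ^+ 2 * (P * im) * (2 * (qs * L)).
Let A2 := qs * (2 * P) ^+ 2 * (P * im * (L * Cv * T) + Cv * M0).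
Let lam := 24 * pi * G + 1.
Let C3 := 12 * pi * (A2 * T) + 8 * pi * (J * pi).
Let C4 := 2 * C3 * expR (lam * T).

Lemma cmp_K1_ge0 : 0 <= K1.
Proof. by rewrite /K1 addr_ge0// mulr_ge0 ?qsum_ge0// addr_ge0. Qed.

Lemma cmp_P_ge0 : 0 <= P.
Proof.
rewrite addr_ge0 ?mulr_ge0 ?cmp_K1_ge0 ?expR_ge0//.
by apply: le_trans QPo; exact: ltW (da_Q0_gt0 data).
Qed.

Lemma cmp_P_le_S : P <= S.
Proof. by rewrite /S lerDl mulr_ge0 ?cmp_K1_ge0 ?expR_ge0. Qed.

Lemma cmp_Cv_ge0 : 0 <= Cv.
Proof.
have S0 : 0 <= S := le_trans cmp_P_ge0 cmp_P_le_S.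
by rewrite /Cv mulr_ge0 ?exprn_ge0 ?im_ge0// mulr_ge0// exprn_ge0.
Qed.

Lemma cmp_constants : [/\ 0 <= G, 0 <= A2, 0 <= J & 0 <= C3].
Proof.
have P0 := cmp_P_ge0; have im0 : 0 <= im := im_ge0 m_gt0; have qs0 : 0 <= qs := qsum_ge0 e.
have qP : 0 <= qs * (2 * P) ^+ 2 by rewrite mulr_ge0// sqr_ge0.
have Pim : 0 <= P * im by exact: mulr_ge0.
have G0 : 0 <= G by apply: mulr_ge0; rewrite mulr_ge0// mulr_ge0.
have A0 : 0 <= A2.
  apply: (mulr_ge0 qP); apply: addr_ge0; last exact: mulr_ge0 cmp_Cv_ge0 _.
  by apply: (mulr_ge0 Pim); rewrite mulr_ge0// mulr_ge0// cmp_Cv_ge0.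
have J0 : 0 <= J by apply: mulr_ge0; [rewrite mulr_ge0// mulr_ge0|rewrite addr_ge0// sqr_ge0].
split => //; have p0 := ltW (pi_gt0 R).
apply: addr_ge0; first by apply: mulr_ge0; [exact: mulr_ge0|exact: mulr_ge0].
by apply: mulr_ge0; [exact: mulr_ge0|exact: mulr_ge0].
Qed.

Lemma cmp_l_gt0 : 0 < lam.
Proof.
have [G0 _ _ _] := cmp_constants; have p0 := ltW (pi_gt0 R).
by apply: ltr_wpDl => //; apply: mulr_ge0 G0; exact: mulr_ge0.
Qed.

Section at_speed.
Variables (c : R) (f : A -> R -> phase -> R) (E1 E2 B : R -> R -> R).
Hypotheses (c1 : 1 <= c) (sol : RVM_solution e m c f E1 E2 B).
Hypothesis ini : forall a x p, f a 0 (x, p) = f0 a (x, p).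
Hypotheses (iE1 : forall y, E1 0 y = Eo 0 y) (iE2 : forall y, E2 0 y = 0) (iB : forall y, B 0 y = 0).
Let c0 : 0 < c := lt_le_trans ltr01 c1.
Let kp := c ^- 2.
Let H (t x : R) := c^-1 * B t x.
Let dev (w : R * R) := `|E1 w.1 w.2 - Eo w.1 w.2| + `|E2 w.1 w.2| + `|B w.1 w.2|.

Section on_cone.
Variables (t x : R).
Hypotheses (t0 : 0 <= t) (tT : t <= T).
Hypothesis small : forall w, cone c t x w -> dev w <= 1.

Lemma cone_time (w : R * R) : cone c t x w -> 0 <= w.1 <= T.
Proof. by move=> [/andP[w0 wt] _]; rewrite w0 (le_trans wt). Qed.

(** The form required by [rvm_supp_cone], at rate 1. Momentum domains keep this rate throughout;
    [lam] enters the weights of the deviation only. *)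
Lemma cmp_fields w : cone c t x w ->
  `|E1 w.1 w.2| + `|E2 w.1 w.2| + `|B w.1 w.2| <= (M + 1) * expR (1 * w.1).
Proof.
move=> cw; have wT := cone_time cw; have /andP[w0 _] := wT.
apply: (@le_trans _ _ (M + 1)).
  have := small cw; rewrite /dev; have := EoM w.2 wT.
  have := ler_normD (E1 w.1 w.2 - Eo w.1 w.2) (Eo w.1 w.2); rewrite subrK; lra.
have e1 := expRM_ge1 ler01 w0.
by rewrite ler_peMr// addr_ge0.
Qed.

Lemma cmp_support a w (p : mom) : cone c t x w -> P < `|p| -> f a w.1 (w.2, p) = 0.
Proof.
move=> cw Pp; have M10 : 0 <= M + 1 by rewrite addr_ge0.
apply: (rvm_supp_cone m_gt0 data c1 sol ini a ltr01 M10 cmp_fields cw).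
apply: le_trans (ltW Pp); rewrite -/qs -/K1 divr1 mul1r; apply: lerD => //.
by rewrite ler_wpM2l ?cmp_K1_ge0// ler_expR; case/andP: (cone_time cw).
Qed.

(** The comparison function is [h], whose derivatives are bounded by [L] independently of [c]. Its
    defect along relativistic characteristics is a multiple of the field deviation plus
    [L * (Cv / c)]; integrating the weight gains [1 / l]. *)
Lemma cmp_density (l Bd : R) a w (p : mom) : 0 < l -> 0 <= Bd ->
  (forall w, cone c t x w -> dev w <= Bd * expR (l * w.1)) -> cone c t x w ->
  `|f a w.1 (w.2, p) - h a w.1 (w.2, p)| <=
    2 * (qs * L) * Bd / l * expR (l * w.1) + L * (Cv / c) * w.1.
Proof.
move=> l0 Bd0 HB cw; have wT := cone_time cw; have /andP[w0 wT'] := wT.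
have qs0 : 0 <= qs := qsum_ge0 e.
have r0 : 0 <= 2 * (qs * L) * Bd / l * expR (l * w.1) + L * (Cv / c) * w.1.
  apply: addr_ge0; apply: mulr_ge0 => //; rewrite ?expR_ge0//.
    by rewrite divr_ge0 ?(ltW l0)// mulr_ge0// mulr_ge0// mulr_ge0.
  by rewrite mulr_ge0// divr_ge0 ?cmp_Cv_ge0// ltW.
have [pP|Pp] := leP `|p| P; last first.
  rewrite cmp_support// hP ?subr0 ?normr0//.
  by apply: le_lt_trans Pp; rewrite lerDl mulr_ge0 ?expR_ge0// cmp_K1_ge0.
have M10 : 0 <= M + 1 by rewrite addr_ge0.
have sl := @rvm_slow_cone _ _ e _ m_gt0 c E1 E2 B c1 (M + 1) 1 t x a ltr01 M10 cmp_fields w p cw.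
have K10 : 0 < K1 by rewrite /K1 ltr_wpDl// mulr_ge0.
have hE : h a w.1 (w.2, p) = ext (h a) w.1 (w.2, p) by rewrite extE.
rewrite hE.
have onc y : domain 1 K1 c w.1 (w.2, p) y -> cone c t x (y.1, y.2.1).
  by move=> Dy; apply: (cone_sub cw); exact: domain_cone Dy.
have cG : continuous (fun y : R * phase => ext (h a) y.1 y.2) := ext_continuous (vp_f_C1 solV a).
have cmp := @vlasov_compare R kp (m a) (e a) E1 E2 H (f a) (fun y => ext (h a) y.1 y.2)
  (fun s => 2 * (qs * L) * Bd / l * expR (l * s) + L * (Cv / c) * s)
  (fun s => 2 * (qs * L) * Bd * expR (l * s) + L * (Cv / c)) 1 K1 c w.1 (w.2, p)
  (rvm_f_C1 sol a) ltr01 K10 (ltW c0) w0 sl (@rvm_material _ _ _ _ _ _ _ _ _ sol a) cG.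
apply: cmp.
- exact: growth_cont.
- by move=> s _; exact: growth_derive.
- move=> y Dy y0; have cy := onc y Dy; have yT := cone_time cy.
  exists (material kp (m a) (e a) E1 E2 H (h a) y.1 y.2); last exact: material_along (vp_f_C1 solV a) y0.
  have [d1 d2 d3] := hL a y.2 yT.
  have yS : `|y.2.2| <= S.
    apply: (le_trans (domain_mom ltr01 (ltW K10) Dy)); rewrite divr1 mul1r /S.
    by apply: lerD => //; rewrite ler_wpM2l ?(ltW K10)// ler_expR.
  have hv : `|vel1 kp (m a) y.2.2 - vel1 0 (m a) y.2.2| <= Cv / c.
    apply: vel_close => //; last exact: le_trans (mom_norm1 _) yS.
    by rewrite kp_ge0 kp_le.
  have hu1 := le_speed (B y.1 y.2.1) c0 (vel1_lt_c y.2.2 c0 (m_gt0 a)).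
  have hu2 := le_speed (B y.1 y.2.1) c0 (vel2_lt_c y.2.2 c0 (m_gt0 a)).
  have := convective_error (E2 y.1 y.2.1) (E1 y.1 y.2.1)
    (vp_material m_gt0 solV a y.2 y0) d1 d2 d3 hv hu1 hu2.
  move=> /le_trans; apply; rewrite addrC lerD2r.
  rewrite -!mulrA ler_wpM2l// !mulrA.
  have q1 := qsum_ge e a; have dB := HB _ cy.
  apply: (@le_trans _ _ (`|e a| * L * (Bd * expR (l * y.1)))).
    by rewrite ler_wpM2l// mulr_ge0.
  by rewrite !mulrA -!(mulrAC _ _ L) -!mulrA ler_wpM2r// !mulr_ge0// expR_ge0.
- move=> y Dy y0.
  rewrite y0 extE// (surjective_pairing y.2) ini iniV subrr normr0 mulr0 expR0 !mulr1 mulr0 addr0.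
  by rewrite divr_ge0 ?(ltW l0)// mulr_ge0// mulr_ge0// mulr_ge0.
Qed.

Let v1 a := vel1 kp (m a).
Let v2 a := vel2 kp (m a).

Lemma cmp_cbox_f a w : cone c t x w -> cbox P (fun p => ext (f a) w.1 (w.2, p)).
Proof.
move=> cw; have /andP[w0 _] := cone_time cw.
by apply: (cbox_ext (rvm_f_C1 sol a) w0) => p; exact: cmp_support.
Qed.

Lemma cmp_cbox_h a (s y : R) : 0 <= s <= T -> cbox P (fun p => ext (h a) s (y, p)).
Proof.
move=> sT; have /andP[s0 _] := sT; apply: (cbox_ext (vp_f_C1 solV a) s0) => p Pp.
by apply: hP => //; apply: le_lt_trans Pp; rewrite lerDl mulr_ge0 ?expR_ge0// cmp_K1_ge0.
Qed.

(* Both components of the velocity are [x_i p / gam k m p] for a coordinate [x_i]. *)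
Lemma cmp_current (xi : mom -> R) (d : R) w :
  (forall p, `|xi p| <= `|p|) -> continuous xi ->
  (forall a (p : mom), `|f a w.1 (w.2, p) - h a w.1 (w.2, p)| <= d) -> cone c t x w ->
  `|jj e (fun a p => xi p / gam kp (m a) p) f w.1 w.2 - jj e (fun a p => xi p / gam 0 (m a) p) h w.1 w.2| <=
  qs * (2 * P) ^+ 2 * (P * im * d + Cv / c * M0).
Proof.
move=> xip xic fd cw; have wT := cone_time cw; have /andP[w0 _] := wT.
have kp0 : 0 <= kp := kp_ge0 c.
apply: current_diff cmp_P_ge0 _ _ _.
- by move=> a; apply: cboxM (cmp_cbox_f a cw); exact: continuous_over_gam.
- by move=> a; apply: cboxM (cmp_cbox_h a w.2 wT); exact: continuous_over_gam.
move=> a p /boxE pP; have m0 := m_gt0 a.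
have xP : `|xi p| <= P := le_trans (xip p) pP.
rewrite !extE//.
have uX : `|xi p / gam kp (m a) p| <= P * im.
  exact: over_gam_bound.
have ud : `|xi p / gam kp (m a) p - xi p / gam 0 (m a) p| <= Cv / c.
  apply: vel_close; [by rewrite kp0 kp_le|exact: le_trans cmp_P_le_S|exact: le_trans cmp_P_le_S].
have hM : `|h a w.1 (w.2, p)| <= M0.
  by have /andP[h0 hM] := vp_range m_gt0 solV iniV a (w.2, p) f0M w0; rewrite ger0_norm.
apply: (le_trans (weighted_close _ uX ud hM)); rewrite lerD2r ler_wpM2l//.
by rewrite mulr_ge0 ?cmp_P_ge0 ?im_ge0.
Qed.

(** A current vanishing beyond [Rf] is dominated by a Lorentzian profile at the price of the factor
    [1 + Rf ^ 2] in [J]. The profile is chosen because its integral along a light line is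
    explicit. *)
Lemma cmp_tail (s y : R) : 0 <= s <= T -> `|jj e w2 h s y| <= J / (1 + y ^+ 2).
Proof.
move=> sT; have y1 : 0 < 1 + y ^+ 2 by rewrite ltr_wpDr ?sqr_ge0.
have P0 := cmp_P_ge0; have [_ _ J0 _] := cmp_constants.
have [Ry|yR] := leP Rf `|y|.
  by rewrite hRf// normr0 divr_ge0// ltW.
have jb : `|jj e w2 h s y| <= qs * (2 * P) ^+ 2 * (P * im * M0).
  rewrite /jj !mulr_suml; apply: (le_trans (ler_norm_sum _ _ _)); apply: ler_sum => a _.
  have m0 := m_gt0 a; have /andP[s0 _] := sT.
  rewrite normrM -mulrA ler_wpM2l//.
  have Bh := cboxM (@continuous_vel2 R 0 (m a) (lexx _) m0) (cmp_cbox_h a y sT).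
  apply: (momI_bound P0 Bh) => p /boxE pP; rewrite extE// normrM.
  have hM : `|h a s (y, p)| <= M0.
    by have /andP[h0 hM] := vp_range m_gt0 solV iniV a (y, p) f0M s0; rewrite ger0_norm.
  by apply: ler_pM => //; apply: over_gam_bound => //; exact: le_trans (mom_norm2 p) pP.
rewrite ler_pdivlMr// /J; apply: ler_pM => //; first exact: ltW.
rewrite lerD2l -[y ^+ 2]real_normK ?num_real// ler_pXn2r ?nnegrE// ?(ltW yR)//.
exact: le_trans (normr_ge0 y) (ltW yR).
Qed.

Section weighted.
Variables (l Bd : R).
Hypotheses (l0 : 0 < l) (Bd0 : 0 <= Bd).
Hypothesis HB : forall w, cone c t x w -> dev w <= Bd * expR (l * w.1).
Let k := G * Bd / l.
Let b := A2 / c.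

Lemma cmp_current_le (xi : mom -> R) w :
  (forall p, `|xi p| <= `|p|) -> continuous xi ->
  cone c t x w ->
  `|jj e (fun a p => xi p / gam kp (m a) p) f w.1 w.2 - jj e (fun a p => xi p / gam 0 (m a) p) h w.1 w.2| <=
  k * expR (l * w.1) + b.
Proof.
move=> xip xic cw; have wT := cone_time cw; have /andP[w0 wT'] := wT.

apply: (le_trans (cmp_current xip xic (fun a p => cmp_density a p l0 Bd0 HB cw) cw)).
set ev := expR _.
have -> : qs * (2 * P) ^+ 2 * (P * im * (2 * (qs * L) * Bd / l * ev + L * (Cv / c) * w.1) + Cv / c * M0) =
    k * ev + qs * (2 * P) ^+ 2 * (P * im * (L * Cv * w.1) + Cv * M0) / c.
  by rewrite /k /G; field; rewrite !lt0r_neq0.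
rewrite lerD2l /b ler_wpM2r ?invr_ge0 ?(ltW c0)// /A2 ler_wpM2l//.
  by rewrite mulr_ge0 ?sqr_ge0// qsum_ge0.
rewrite lerD2r ler_wpM2l ?mulr_ge0 ?cmp_P_ge0 ?im_ge0//.
by rewrite ler_wpM2l// mulr_ge0 ?cmp_Cv_ge0.
Qed.

Lemma cmp_k_ge0 : 0 <= k.
Proof.
by have [G0 _ _ _] := cmp_constants; rewrite /k divr_ge0 ?(ltW l0)// mulr_ge0.
Qed.

Lemma cmp_b_ge0 : 0 <= b.
Proof. by have [_ A0 _ _] := cmp_constants; rewrite /b divr_ge0// (le_trans ler01 c1). Qed.

Lemma growth_increment : (k / l * expR (l * t) + b * t) - (k / l * expR (l * 0) + b * 0) <=
  k / l * expR (l * t) + b * T.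
Proof.
have := cmp_k_ge0 => k0; have kl : 0 <= k / l * expR (l * 0) by rewrite mulr_ge0 ?expR_ge0// divr_ge0// ltW.
have := ler_wpM2l cmp_b_ge0 tT; rewrite (mulr0 b); lra.
Qed.

Lemma cmp_E1 : `|E1 t x - Eo t x| <= 4 * pi * (k / l * expR (l * t) + b * T).
Proof.
have p0 : 0 <= 4 * pi :> R by rewrite mulr_ge0// ltW// pi_gt0.
have := @deriv_growth R (fun s => ext E1 s x - (ext Eo s x - ext Eo s X))
  (fun s => 4 * pi * (k / l * expR (l * s) + b * s)) 0 t t0.
have tt : 0 <= t <= T by rewrite t0.
have zT : 0 <= (0 : R) <= T by apply/andP; split.
rewrite !extE// (EoX tt) (EoX zT) !subr0 iE1 subrr subr0 => Hg.
apply: (le_trans (Hg _ _ _)).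
- move=> s _; apply: cvgB; last apply: cvgB.
  + exact: (@ext_slice _ E1 x s (rvm_E1_C1 sol)).
  + exact: (@ext_slice _ Eo x s (vp_E1_C1 solV)).
  + exact: (@ext_slice _ Eo X s (vp_E1_C1 solV)).
- by move=> s _; apply: cvgM; [exact: cvg_cst|exact: growth_cont].
- move=> s /andP[s0 st].
  have sT : 0 < s <= T by rewrite s0 (le_trans (ltW st)).
  exists (- (4 * pi) * (jj e v1 f s x - jj e w1 h s x)), (4 * pi * (k * expR (l * s) + b)); split.
  + rewrite normrM normrN (ger0_norm p0) ler_wpM2l//.
    have cs : cone c t x (s, x).
      split; rewrite /= ?(ltW s0) ?(ltW st)// subrr normr0 mulr_ge0 ?subr_ge0 ?(ltW st)//.
      exact: le_trans c1.
    exact: (cmp_current_le (xi := fst) mom_norm1 mom_cont1 cs).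
  + rewrite mulrBr; exact: (is_deriveB (rvm_E1_derive sol x s0) (ampere x sT)).
  + exact: (is_deriveZ (4 * pi) (growth_derive k b s l0)).
by rewrite -mulrBr ler_wpM2l// growth_increment.
Qed.

Lemma cmp_light (sg : R) : sg * sg = 1 ->
  `|E2 t x + sg * B t x| <= 4 * pi * (k / l * expR (l * t) + b * T + J / c * pi).
Proof.
move=> sg2; have sg1 := unit_sign sg2.
have p0 : 0 <= 4 * pi :> R by rewrite mulr_ge0// ltW// pi_gt0.
pose y (s : R) := x + (s - t) * (sg * c).
have yt : y t = x by rewrite /y subrr mul0r addr0.
have Dy (s : R) : is_derive s 1 y (sg * c).
  have D := is_deriveD (is_derive_cst x s (1 : R)) (is_deriveM (is_deriveB (is_derive_id s (1 : R)) (is_derive_cst t s (1 : R))) (is_derive_cst (sg * c) s (1 : R))).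
  apply: (is_derive_eq D).
  by rewrite /GRing.scale/= mulr0 add0r subr0 mulr1 add0r.
have cy (s : R) : {for s, continuous y} := is_derive_continuous (Dy s).
have Da (s : R) : is_derive s 1 (fun s => atan (y s)) (sg * c / (1 + y s ^+ 2)).
  have D := @is_derive1_comp R (@atan R) y s _ _ (is_derive1_atan (y s)) (Dy s).
  by apply: (is_derive_eq D); rewrite mulrC.
(* As [y] has slope [sg * c], the term [J / c * sg * atan (y s)] has derivative [J / (1 + y s ^ 2)],
   the bound of [cmp_tail]; its increase is at most [J / c * pi], however long the light line. *)
have := @deriv_growth R (fun s => ext E2 s (y s) + sg * ext B s (y s))
  (fun s => 4 * pi * ((k / l * expR (l * s) + b * s) + J / c * sg * atan (y s))) 0 t t0.
rewrite yt !extE// iE2 iB mulr0 addr0 subr0 => Hg.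
apply: (le_trans (Hg _ _ _)).
- move=> s _; apply: cvgD.
    exact: (@line_ext_cont _ E2 t x (sg * c) s (rvm_E2_C1 sol)).
  apply: cvgM; first exact: cvg_cst.
  exact: (@line_ext_cont _ B t x (sg * c) s (rvm_B_C1 sol)).
- move=> s _; apply: cvgM; first exact: cvg_cst.
  apply: cvgD; first exact: growth_cont.
  apply: cvgM; first exact: cvg_cst.
  by apply: (continuous_comp (cy s)); exact: continuous_atan.
- move=> s /andP[s0 st].
  have sT : 0 <= s <= T by rewrite (ltW s0) (le_trans (ltW st)).
  have cs : cone c t x (s, y s) by apply: (cone_line x (ltW c0) sg1); rewrite !ltW.
  exists (- (4 * pi) * jj e v2 f s (y s)),
    (4 * pi * ((k * expR (l * s) + b) + J / c * sg * (sg * c / (1 + y s ^+ 2)))); split.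
  + rewrite normrM normrN (ger0_norm p0) ler_wpM2l//.
    have -> : J / c * sg * (sg * c / (1 + y s ^+ 2)) = (sg * sg) * (J / (1 + y s ^+ 2)).
      by field; rewrite !lt0r_neq0// ltr_wpDr ?sqr_ge0.
    rewrite sg2 mul1r.
    have close : `|jj e v2 f s (y s) - jj e w2 h s (y s)| <= k * expR (l * s) + b.
      exact: (cmp_current_le (xi := snd) mom_norm2 mom_cont2 cs).
    have tail := cmp_tail (y s) sT.
    have := ler_normD (jj e v2 f s (y s) - jj e w2 h s (y s)) (jj e w2 h s (y s)).
    by rewrite subrK => tri; exact: sum_bound tri tail close.
  + exact: (rvm_light sol t x sg2 s0).
  + apply: is_deriveZ; exact: (is_deriveD (growth_derive k b s l0) (is_deriveZ (J / c * sg) (Da s))).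
rewrite -mulrBr ler_wpM2l//.
have at1 : sg * atan x - sg * atan (y 0) <= pi.
  have b1 := atan_gtNpi2 x; have b2 := atan_ltpi2 x.
  have b3 := atan_gtNpi2 (y 0); have b4 := atan_ltpi2 (y 0).
  rewrite -mulrBr; apply: (le_trans (ler_norm _)); rewrite normrM sg1 mul1r.
  by rewrite ler_norml; apply/andP; split; lra.
have Jc : 0 <= J / c by have [_ _ J0 _] := cmp_constants; rewrite divr_ge0// ltW.
have := ler_wpM2l Jc at1; rewrite mulrBr !mulrA; exact: increments growth_increment.
Qed.

Lemma cmp_step : l = 24 * pi * G + 1 ->
  dev (t, x) <= (Bd / 2 + (12 * pi * (A2 * T) + 8 * pi * (J * pi)) / c) * expR (l * t).
Proof.
move=> lE.
have L0 := cmp_E1.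
have L1 := cmp_light (mulr1 1).
have L2 : `|E2 t x - B t x| <= 4 * pi * (k / l * expR (l * t) + b * T + J / c * pi).
  by rewrite -mulN1r; apply: cmp_light; rewrite mulrNN mulr1.
rewrite mul1r in L1.
have E2B := le_trans (le_light (E2 t x) (B t x)) (lerD L1 L2).
have e1 := expRM_ge1 (ltW l0) t0; have [G0 A0 J0 _] := cmp_constants.
exact: (close_step (pi_gt0 R) c0 G0 Bd0 A0 T_ge0 J0 lE e1 L0 E2B).
Qed.

End weighted.

End on_cone.
(** [cmp_step] concerns the apex of a cone. Each point of the cone is the apex of a smaller one that
    inherits the hypotheses, and the bound 1 makes the weighted supremum finite. *)
Lemma cmp_contract (t x : R) : 0 <= t -> t <= T -> (forall w, cone c t x w -> dev w <= 1) ->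
  forall w, cone c t x w -> dev w <= 2 * (C3 / c) * expR (lam * w.1).
Proof.
move=> t0 tT small; have l0 := cmp_l_gt0.
have [_ _ _ C30] := cmp_constants.
apply: (@contraction_bound _ _ (cone c t x) dev (fun w => expR (lam * w.1)) 1 (C3 / c)).
- by rewrite divr_ge0// ltW.
- by move=> w _; exact: expR_gt0.
- move=> w cw; rewrite mul1r; apply: (le_trans (small w cw)).
  have /andP[w0 _] := cone_time tT cw.
  exact: expRM_ge1 (ltW l0) w0.
move=> Bd Bd0 HB v cv; have /andP[v0 vT] := cone_time tT cv.
have small' w : cone c v.1 v.2 w -> dev w <= 1 by move=> /(cone_sub cv); exact: small.
have HB' w : cone c v.1 v.2 w -> dev w <= Bd * expR (lam * w.1) by move=> /(cone_sub cv); exact: HB.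
rewrite {1}(surjective_pairing v).
exact: (cmp_step v0 vT small' l0 Bd0 HB').
Qed.

(** The deviation with fields frozen before time 0: it is continuous on the whole plane, so the set
    where it reaches 1 is closed. *)
Let dcont (w : R * R) := `|ext E1 w.1 w.2 - ext Eo w.1 w.2| + `|ext E2 w.1 w.2| + `|ext B w.1 w.2|.

Lemma dcontE w : 0 <= w.1 -> dcont w = dev w.
Proof. by move=> w0; rewrite /dcont /dev !extE. Qed.

Lemma dcont_continuous : continuous dcont.
Proof.
move=> w; apply: cvgD; first apply: cvgD; apply: cvg_norm.
- apply: cvgB; first exact: (ext_continuous (rvm_E1_C1 sol)).
  exact: (ext_continuous (vp_E1_C1 solV)).
- exact: (ext_continuous (rvm_E2_C1 sol)).
- exact: (ext_continuous (rvm_B_C1 sol)).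
Qed.

Lemma dev_initial y : dev (0, y) = 0.
Proof. by rewrite /dev /= iE1 iE2 iB subrr !normr0 !addr0. Qed.

(* Bootstrap: at a first time where the deviation reaches 1 it is at most [C4 / c < 1]. *)
Lemma cmp_small : C4 < c -> forall t x : R, 0 <= t <= T -> dev (t, x) <= 1.
Proof.
move=> C4c t x /andP[t0 tT].
have l0 := cmp_l_gt0; have [_ _ _ C30] := cmp_constants.
rewrite leNgt; apply/negP => big.
pose Z := cone c t x `&` [set w | 1 <= dcont w].
have cZ : compact Z.
  rewrite /Z; apply: compact_closedI; first exact: compact_cone (ltW c0).
  by apply: closed_le_cont dcont_continuous => w; exact: cvg_cst.
have Z0 : Z !=set0.
  exists (t, x); split; first exact: cone_apex.
  by rewrite /= dcontE//; exact: ltW.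
have cfst : continuous (fun w : R * R => w.1) by move=> w; exact: cvg_fst.
have [w + wmin] := compact_EVT_min Z0 cZ (continuous_subspaceT cfst).
rewrite inE => -[cw w1Z]; have /andP[w0 wT] := cone_time tT cw.
have before v : cone c t x v -> v.1 < w.1 -> dcont v < 1.
  move=> cv vw; rewrite ltNge; apply/negP => v1Z.
  by have := wmin v; rewrite inE => /(_ (conj cv v1Z)); rewrite leNgt vw.
have wpos : 0 < w.1.
  rewrite lt_neqAle w0 andbT; apply/eqP => E0; move: w1Z => /=.
  by rewrite dcontE// (surjective_pairing w) -E0 dev_initial ler10.
(* Points straight below [w] are in the cone and earlier, so continuity bounds the deviation at [w]
   by 1. *)
have wle : dcont w <= 1.
  rewrite leNgt; apply/negP => wbig.
  have cw' : {for w, continuous dcont} by exact: dcont_continuous.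
  have e0 : 0 < dcont w - 1 by rewrite subr_gt0.
  have [r r0 rP] := (proj1 (contP _ _) cw') _ e0.
  pose s := Num.min w.1 (r / 2).
  have s0 : 0 < s by rewrite lt_min wpos divr_gt0.
  have sw : s <= w.1 by rewrite ge_min lexx.
  have sr : s < r by rewrite gt_min; apply/orP; right; lra.
  have cv : cone c t x (w.1 - s, w.2).
    apply: (cone_sub cw); split => /=; first by apply/andP; split; lra.
    by rewrite subrr normr0 mulr_ge0 ?(ltW c0)//; lra.
  have v1 : (w.1 - s, w.2).1 < w.1 by rewrite /=; lra.
  have := before _ cv v1.
  have /rP : `|(w.1 - s, w.2) - w| < r.
    rewrite prod_norm_lt/= subrr normr0 r0 andbT.
    by rewrite addrAC subrr add0r normrN gtr0_norm.
  by move=> /ltr_normlP[? ?]; lra.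
(* Apart from its apex, the cone below [w] consists of strictly earlier points. *)
have small v : cone c w.1 w.2 v -> dev v <= 1.
  move=> cv; have [/andP[v0 vw] vx] := cv; rewrite -dcontE//.
  move: vw; rewrite le_eqVlt => /predU1P[vw|vw]; last first.
    by apply/ltW/before => //; exact: cone_sub cv.
  move: vx; rewrite vw subrr mulr0 normr_le0 subr_eq0 => /eqP vx.
  by rewrite (surjective_pairing v) vw vx -surjective_pairing.
have := cmp_contract w0 wT small (cone_apex c w.2 w0).
have e1 : expR (lam * w.1) <= expR (lam * T) by rewrite ler_expR ler_wpM2l// ltW.
have := w1Z; rewrite /= dcontE// {1}(surjective_pairing w) => w1' h1.
have : 2 * (C3 / c) * expR (lam * w.1) < 1.
  apply: (@le_lt_trans _ _ (C4 / c)); last by rewrite ltr_pdivrMr// mul1r.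
  rewrite /C4 mulrA mulrAC ler_wpM2r ?invr_ge0 ?(ltW c0)//.
  by rewrite ler_wpM2l// mulr_ge0.
by move=> h2; move: (le_lt_trans (le_trans w1' h1) h2); rewrite ltxx.
Qed.

Lemma cmp_rate a (t x : R) (p : mom) : C4 < c -> 0 <= t <= T ->
  `|f a t (x, p) - h a t (x, p)| + `|E1 t x - Eo t x| + `|E2 t x| + `|B t x| <=
  (4 * (qs * L) * C3 / lam * expR (lam * T) + L * Cv * T + C4) / c.
Proof.
move=> C4c tT; have /andP[t0 tT'] := tT.
have l0 := cmp_l_gt0; have [_ _ _ C30] := cmp_constants.
have small w : cone c t x w -> dev w <= 1.
  by move=> /(cone_time tT') wT; rewrite (surjective_pairing w); exact: cmp_small.
have HB := cmp_contract t0 tT' small.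
have C3c : 0 <= 2 * (C3 / c) by rewrite mulr_ge0// divr_ge0// ltW.
have h1 := cmp_density tT' small a p l0 C3c HB (cone_apex c x t0).
have h2 := HB _ (cone_apex c x t0).
have e1 : expR (lam * t) <= expR (lam * T) by rewrite ler_expR ler_wpM2l// ltW.
have qL : 0 <= qs * L by rewrite mulr_ge0// qsum_ge0.
exact: (rate_sum c0 l0 qL C30 L_ge0 cmp_Cv_ge0 t0 tT' e1 (expR_ge0 _) h1 h2).
Qed.

End at_speed.

Lemma cmp_uniform : exists c0 C : R, [/\ 1 <= c0, 0 <= C &
  forall c f E1 E2 B, c0 <= c ->
  RVM_solution e m c f E1 E2 B -> (forall a x p, f a 0 (x, p) = f0 a (x, p)) ->
  (forall y, E1 0 y = Eo 0 y) -> (forall y, E2 0 y = 0) -> (forall y, B 0 y = 0) ->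
  forall a (t x : R) (p : mom), 0 <= t <= T ->
  `|f a t (x, p) - h a t (x, p)| + `|E1 t x - Eo t x| + `|E2 t x| + `|B t x| <= C / c].
Proof.
have [_ _ _ C30] := cmp_constants; have l0 := cmp_l_gt0.
have C40 : 0 <= C4 by rewrite /C4 mulr_ge0 ?expR_ge0// mulr_ge0.
(* The first witness secures [C4 < c] for the bootstrap; the second adds the errors of the densities
   and of the fields at time [T]. *)
exists (C4 + 1), (4 * (qs * L) * C3 / lam * expR (lam * T) + L * Cv * T + C4).
split; first by rewrite lerDr.
  have qL : 0 <= qs * L by rewrite mulr_ge0// qsum_ge0.
  apply: addr_ge0 => //; apply: addr_ge0; last by rewrite mulr_ge0// mulr_ge0// cmp_Cv_ge0.
  by rewrite mulr_ge0 ?expR_ge0// divr_ge0 ?(ltW l0)// mulr_ge0// mulr_ge0.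
move=> c f E1 E2 B cC sol ini iE1 iE2 iB a t x p tT.
have c1 : 1 <= c by apply: le_trans cC; rewrite lerDr.
apply: (cmp_rate c1 sol ini iE1 iE2 iB a x p _ tT).
by apply: lt_le_trans cC; rewrite ltrDl.
Qed.
End comparison.

Lemma range_dist {R : realType} (a b M : R) : 0 <= a <= M -> 0 <= b <= M -> `|a - b| <= M.
Proof. by move=> /andP[? ?] /andP[? ?]; rewrite ler_norml; apply/andP; split; lra. Qed.

Lemma bounded_rate {R : realType} (d a k u v M0 M Cap C c0 c : R) :
  0 < c -> c <= c0 -> 0 <= M0 -> 0 <= M -> 0 <= Cap -> 0 <= C ->
  d <= M0 -> a <= `|k| + M -> `|k| + u + v <= Cap ->
  d + a + u + v <= (C + (M0 + Cap + M) * c0 + 1) / c.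
Proof.
move=> c_gt0 cc M00 MM Cap0 C0 h1 h2 h3.
rewrite ler_pdivlMr//; apply: (@le_trans _ _ ((M0 + Cap + M) * c)).
  by rewrite ler_wpM2r ?(ltW c_gt0)//; lra.
have : (M0 + Cap + M) * c <= (M0 + Cap + M) * c0 by rewrite ler_wpM2l// !addr_ge0.
by lra.
Qed.

Theorem theorem1p2 (R : realType) (A : finType) (e m : A -> R)
    (f0 : A -> R * (R * R) -> R) (F : A -> R * R -> R) (R0 Q0 : R)
    (m_gt0 : forall a, 0 < m a)
    (f0_C2 : forall a, C2 (f0 a))
    (data : data_assumptions e m f0 (fun=> 0) (fun=> 0) F R0 Q0) :
  forall T : R, 0 < T ->
  exists2 C0 : R, 0 < C0 &
  forall c : R, 1 <= c ->
  forall (f : A -> R -> R * (R * R) -> R) (E1 E2 B : R -> R -> R)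
    (foo : A -> R -> R * (R * R) -> R) (E1oo : R -> R -> R),
  RVM_solution e m c f E1 E2 B ->
  (forall a x p, f a 0 (x, p) = f0 a (x, p)) ->
  (forall x, E1 0 x = poisson_field (charge_density e f0) x) ->
  (forall x, E2 0 x = 0) ->
  (forall x, B 0 x = 0) ->
  VP_solution e m foo E1oo ->
  (forall a x p, foo a 0 (x, p) = f0 a (x, p)) ->
  forall a t x p, 0 <= t <= T ->
    `|f a t (x, p) - foo a t (x, p)| + `|E1 t x - E1oo t x|
    + `|E2 t x| + `|B t x| <= C0 * c^-1.
Proof.
move=> T T_gt0; have T0 := ltW T_gt0.
(* The constant has to precede [c] and all solutions, so a reference limit solution is fixed here;
   if there is none, the claim holds vacuously. *)
have [[h [Eo [solV iniV]]]|noV] := pselect (exists h Eo, VP_solution e m h Eo /\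
    forall a x p, h a 0 (x, p) = f0 a (x, p)); last first.
  exists 1 => // c _ f E1 E2 B foo E1oo _ _ _ _ _ solV iniV.
  by exfalso; apply: noV; exists foo, E1oo.
have [M0 M00 f0M] := f0_bounded data solV iniV.
have [M M_ge0 EoM] := vp_field_bound solV T.
have [Po QPo hP] := vp_support m_gt0 data solV iniV T0.
have [L L0 hL] := vp_lip m_gt0 data solV iniV T0.
have [Rf _ HRf] := vp_current_far m_gt0 data solV iniV T0 (current_F2 m_gt0 data).
have [X [EoX amp]] := vp_ampere m_gt0 data solV iniV T0.
have tail (s y : R) : 0 <= s <= T -> Rf <= `|y| -> jj e (fun a => vel2 0 (m a)) h s y = 0.
  by move=> sT Ry; exact: (HRf s y sT Ry).2.
have [c0 [C [c01 C0 large]]] := cmp_uniform m_gt0 data M00 f0M solV iniV T0 M_ge0 QPo L0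
  EoM hP hL tail EoX amp.
have [Cap Cap0 small] := rvm_apriori m_gt0 data f0M T0 c01 M_ge0 M00.
(* For [c < c0] a bound independent of [c] is one of order [c0 / c]: the densities differ by at most
   [M0], the fields by at most [Cap + M]. The [1] secures positivity. *)
exists (C + (M0 + Cap + M) * c0 + 1).
  by rewrite ltr_wpDl// addr_ge0// mulr_ge0 ?addr_ge0// (le_trans _ c01).
move=> c c1 f E1 E2 B foo E1oo sol ini iE1 iE2 iB solV' iniV' a t x p tT.
have c_gt0 : 0 < c := lt_le_trans ltr01 c1.
(* Uniqueness exchanges the given limit solution for the reference one, from which all constants
   were taken. *)
have [-> Ef] := vp_unique m_gt0 data solV iniV solV' iniV' T0 x tT; rewrite Ef.
have EE y : E1 0 y = Eo 0 y by rewrite iE1 (vp_initial_E solV iniV).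
have [cc|cc] := leP c0 c.
  apply: (le_trans (large c f E1 E2 B cc sol ini EE iE2 iB a t x p tT)).
  rewrite ler_wpM2r ?invr_ge0 ?(ltW c_gt0)// -addrA lerDl addr_ge0//.
  by rewrite mulr_ge0 ?addr_ge0// (le_trans _ c01).
have /andP[t0 _] := tT.
have E1M y : `|E1 0 y| <= M by rewrite EE; apply: EoM; rewrite lexx.
have cc' : 1 <= c <= c0 by rewrite c1 ltW.
have fields := small c f E1 E2 B cc' sol ini E1M iE2 iB t x tT.
have fh := range_dist (rvm_range m_gt0 f0M c1 sol ini a (x, p) t0)
  (vp_range m_gt0 solV iniV a (x, p) f0M t0).
have dE : `|E1 t x - Eo t x| <= `|E1 t x| + M.
  by apply: (le_trans (ler_normB _ _)); rewrite lerD2l EoM.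
exact: (bounded_rate c_gt0 (ltW cc) M00 M_ge0 Cap0 C0 fh dE fields).
Qed.
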